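(* Assume Assumptions (LS), (UT) and (LT) below hold, with $\alpha>0$ the common exponent in (UT) and (LT). Then there exist constants $c>0$, $r_0$ and $\theta_0$ (depending on $\alpha$) such that for all $\theta>\theta_0$ and $r>r_0$, $$\mathbb{P}\left(X_r-\mathbb{E}[X_r]\le-\theta r^{1/3}\right)\le\exp\left(-c\theta^3\right).$$
   Context: Let $\{\xi_v:v\in\mathbb{Z}^2\}$ be i.i.d. random variables with a common law $\nu$ supported on $[0,\infty)$. A directed path is an up-right nearest-neighbour path in $\mathbb{Z}^2$, and its weight is $\ell(\gamma)=\sum_{u\in\gamma}\xi_u$. For $u\preceq v$ coordinatewise, $X_{u,v}=\max_{\gamma:u\to v}\ell(\gamma)$ over directed paths from $u$ to $v$ ($-\infty$ if none). For $r\in\mathbb{N}$, $z\in\mathbb{Z}$, $X_r^z=X_{(1,1),(r-z,r+z)}$ and $X_r=X_r^0$. It is assumed that $\mu=\lim_{r\to\infty}r^{-1}\mathbb{E}[X_r]<\infty$. Assumption (LS): there exist positive finite constants $\rho,G,H,g_1,g_2$ such that for all large enough $r$ and all $z\in[-\rho r,\rho r]$, $\mathbb{E}[X_r^z]\in \mu r-G\frac{z^2}{r}+\left[-H\frac{z^4}{r^3},0\right]+\left[-g_1r^{1/3},-g_2r^{1/3}\right]$. Assumptions (UT) and (LT): there exists $\alpha>0$ such that for every $\varepsilon>0$ there exist positive finite $c,\theta_0,r_0$ (depending only on $\varepsilon$) such that for all $r>r_0$, $\theta>\theta_0$ and $|z|\le(1-\varepsilon)r$: (UT) $\mathbb{P}(X_r^z-\mathbb{E}[X_r^z]>\theta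 r^{1/3})\le\exp(-c\theta^\alpha)$ and (LT) $\mathbb{P}(X_r^z-\mathbb{E}[X_r^z]<-\theta r^{1/3})\le\exp(-c\theta^\alpha)$. *)

(* Defs.v *)
From HB Require Import structures.
From mathcomp Require Import all_boot all_order all_algebra.
From mathcomp Require Import all_classical all_reals all_analysis.
Set Implicit Arguments. Unset Strict Implicit. Unset Printing Implicit Defensive.
Import Order.TTheory GRing.Theory Num.Theory.
Local Open Scope classical_set_scope.
Local Open Scope ring_scope.

Definition site := (int * int)%type.

Definition dstep (a b : site) : bool :=
  (b == (a.1 + 1, a.2)) || (b == (a.1, a.2 + 1)).

Definition directed_path (u v : site) (g : seq site) : bool :=
  path dstep u g && (last u g == v).

Definition path_weight (R : realType) (xi : site -> R) (u : site) (g : seq site) : R :=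
  \sum_(x <- u :: g) xi x.

(* X_{u,v} : supremum (a maximum over finitely many paths) of path weights,
   equal to -oo when there is no directed path from u to v. *)
Definition Xuv (R : realType) (T : Type) (xi : site -> T -> R) (u v : site) (w : T)
  : \bar R :=
  ereal_sup [set (path_weight (fun x => xi x w) u g)%:E | g in [set g | directed_path u v g]].

Definition Xrz (R : realType) (T : Type) (xi : site -> T -> R) (r : nat) (z : int) (w : T)
  : \bar R :=
  Xuv xi (1, 1) (r%:Z - z, r%:Z + z) w.

Definition Eb (d : measure_display) (T : measurableType d) (R : realType)
  (P : probability T R) (f : T -> \bar R) : \bar R :=
  (\int[P]_w f w)%E.

(* Main.v *)
(* Time runs along the antidiagonals, and a passage from time s to time t is compared with
   mu (t - s).

   Fluctuation away from the diagonal: consider the first time at which a geodesic that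
   loses little weight reaches distance W ~ sqrt(th) n^(2/3). A backup path from there is
   independent of this choice and is typical with probability 1/2, so the exit produces a
   passage to a far point that (UT) and the curvature term in (LS) forbid. Hence (LT) holds
   for the passage time restricted to a strip; cutting a strip of fixed width L n^(2/3) into
   about sqrt(th) blocks gives a polynomial lower tail there.

   Coarse graining: for a deficit th r^(1/3) cut the middle of the box into K ~ th^(3/2)
   blocks of length r/K, along J ~ A th disjoint parallel strips of width about (r/K)^(2/3),
   whose ends spread over a transversal distance A r^(2/3). All J chains lose more than K
   typical block fluctuations with probability at most exp(- phi(K) J) by independence, and
   a good chain is joined to the two endpoints by recursion at scale r/216. With the
   polynomial tail, phi is constant and A = 1, giving exp(- c th). With this exponential
   tail, Chernoff's bound gives phi(K) ~ K, and A ~ sqrt(th) gives phi(K) J ~ th^3. *)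

Require Import Defs.
From HB Require Import structures.
From mathcomp Require Import all_boot all_order all_algebra.
From mathcomp Require Import all_classical all_reals all_analysis.
From mathcomp Require Import measurable_realfun.
From mathcomp Require Import zify ring lra.
Import Order.TTheory GRing.Theory Num.Theory.
Import numFieldNormedType.Exports.
Local Open Scope classical_set_scope.
Local Open Scope ring_scope.
Set Implicit Arguments. Unset Strict Implicit. Unset Printing Implicit Defensive.

(** The obstacle is that the exponent in (LT) may be small, so that block losses have no exponential
    moments and Chernoff's bound does not apply to them. The first coarse graining only serves to
    create such moments for the second. Moreover the exit argument yields a width that grows with
    the deficit, while disjoint strips need one width for all deficits; this is why a fixed width is
    prepared beforehand. The exponents are forced. A chain of [K] blocks of length [r/K] loses about
    [K (r/K)^(1/3) = K^(2/3) r^(1/3)], so a loss [th r^(1/3)] means [K ~ th^(3/2)]. A chain whose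
    ends differ by [A r^(2/3)] shifts by [A r^(2/3) / K] per block, which is below [(r/K)^(2/3)]
    only if [A <= K^(1/3) ~ sqrt th]; this limits the spread of the strips. The two end pieces
    cannot be left to (LT), whose bound is too weak. As 216 = 6^3, a third of the deficit equals
    [2 th] at their scale, and the induction hypothesis at [2 th] is better than what has to be
    proved at [th], with room for a constant factor. *)

Section RealFacts.
Variable R : realType.
Implicit Types x y : R.

Definition cb x : R := x `^ 3^-1.

Lemma cb_ge0 x : 0 <= cb x.
Proof. exact: powR_ge0. Qed.

Lemma cb3 x : 0 <= x -> cb x ^+ 3 = x.
Proof.
move=> x0; rewrite /cb -powR_mulrn ?powR_ge0 // -powRrM mulVf ?pnatr_eq0 //.
exact: powRr1.
Qed.

Lemma cube_le x y : 0 <= y -> x ^+ 3 <= y ^+ 3 -> x <= y.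
Proof.
move=> y0 h; case: (leP 0 x) => [x0|x0]; last exact: le_trans (ltW x0) y0.
by rewrite -(@ler_pXn2r _ 3).
Qed.

Lemma cb_le x y : 0 <= x -> x <= y -> cb x <= cb y.
Proof. by move=> x0 xy; apply: cube_le; rewrite ?cb_ge0 // !cb3 //; exact: le_trans xy. Qed.

Lemma cb_gt0 x : 0 < x -> 0 < cb x.
Proof. exact: powR_gt0. Qed.

Lemma cb_ge1 x : 1 <= x -> 1 <= cb x.
Proof. by move=> x1; apply: cube_le; rewrite ?cb_ge0 // cb3 ?expr1n //; lra. Qed.

Lemma exists_nat_ge x : exists k : nat, x <= k%:R.
Proof. by exists (Num.bound `|x|); apply: le_trans (ler_norm x) (ltW (archi_boundP _)). Qed.

Lemma exists_floor x : 0 <= x -> exists k : nat, k%:R <= x < k%:R + 1.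
Proof. by move=> x0; exists (Num.trunc x); have := truncn_itv x0; rewrite -natr1. Qed.

Lemma exists_ceil x : 0 <= x -> exists k : nat, x <= k%:R < x + 1.
Proof.
move=> x0; have [k /andP[k1 k2]] := exists_floor x0.
have [->|kx] := eqVneq x k%:R; first by exists k; rewrite lexx ltrDl ltr01.
exists k.+1; rewrite -natr1; apply/andP; split; first exact: ltW.
by rewrite ltrD2r lt_neqAle eq_sym kx.
Qed.

Lemma powR_le_mono (a x y : R) : 0 < a -> 0 <= x -> x <= y -> x `^ a <= y `^ a.
Proof.
move=> a0 x0 xy; apply: ge0_ler_powR => //; rewrite ?nnegrE ?(ltW a0) //.
exact: le_trans xy.
Qed.

Lemma powR_unbounded (a c M : R) : 0 < a -> 0 < c -> exists t0 : R,
  0 < t0 /\ forall t, t0 <= t -> M <= c * t `^ a.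
Proof.
move=> a0 c0; exists ((`|M| / c + 1) `^ a^-1).
have h : 0 < `|M| / c + 1 by rewrite ltr_pwDr // divr_ge0 // ltW.
split; first exact: powR_gt0.
move=> t tt0.
have := powR_le_mono a0 (powR_ge0 _ _) tt0.
rewrite -powRrM mulVf ?gt_eqF // (powRr1 (ltW h)) => h1.
have h2 : c * (`|M| / c + 1) <= c * t `^ a by rewrite ler_pM2l.
apply: (le_trans _ h2); apply: (le_trans (ler_norm M)).
by rewrite mulrDr mulrCA divff ?gt_eqF // !mulr1 lerDl (ltW c0).
Qed.

End RealFacts.

(** * Events on weight configurations *)

Section Configurations.
Variable R : realType.

Definition config := site -> R.

Definition cylinder (A : set site) : set (set config) :=
  [set M | exists2 v, A v & exists2 B : set R, measurable B & M = [set f | B (f v)]].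

Definition sig (A : set site) : set (set config) := <<s cylinder A >>.

Definition shift_config (a : site) (f : config) : config :=
  fun v => f (v.1 + a.1, v.2 + a.2).

(** The interface between probability theory and the path argument: a real-valued set function, so
    that the later estimates stay in [R]. It is instantiated by [law_of_field]. *)
Record field_law := FieldLaw {
  pr : set config -> R ;
  pr_ge0 : forall M, 0 <= pr M ;
  pr_setT : pr setT = 1 ;
  pr_disjU : forall M N, sig setT M -> sig setT N -> M `&` N = set0 ->
    pr (M `|` N) = pr M + pr N ;
  pr_indep : forall A B M N, A `&` B = set0 -> sig A M -> sig B N ->
    pr (M `&` N) = pr M * pr N ;
  pr_shift : forall a M, sig setT M -> pr (shift_config a @^-1` M) = pr M }.

Lemma sig_sigma A : sigma_algebra setT (sig A).
Proof. exact: smallest_sigma_algebra. Qed.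

Lemma sig0 A : sig A set0.
Proof. by case: (sig_sigma A). Qed.

Lemma sigC A M : sig A M -> sig A (~` M).
Proof. by case: (sig_sigma A) => _ + _ => h /h; rewrite setTD. Qed.

Lemma sigT A : sig A setT.
Proof. by rewrite -setC0; apply: sigC; exact: sig0. Qed.

Lemma sig_bigcup A (F : nat -> set config) :
  (forall i, sig A (F i)) -> sig A (\bigcup_i F i).
Proof. by case: (sig_sigma A) => _ _; apply. Qed.

Lemma sigU A M N : sig A M -> sig A N -> sig A (M `|` N).
Proof.
move=> hM hN; rewrite -bigcup2E; apply: sig_bigcup => -[|[|i]] //=.
exact: sig0.
Qed.

Lemma sigI A M N : sig A M -> sig A N -> sig A (M `&` N).
Proof.
by move=> hM hN; rewrite -(setCK (_ `&` _)) setCI; apply: sigC; apply: sigU; apply: sigC.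
Qed.

Lemma sigD A M N : sig A M -> sig A N -> sig A (M `\` N).
Proof. by move=> hM hN; rewrite setDE; apply: sigI => //; apply: sigC. Qed.

Lemma sig_sub A B M : A `<=` B -> sig A M -> sig B M.
Proof.
move=> AB; apply: smallest_sub; first exact: sig_sigma.
move=> N [v Av h]; by apply: sub_sigma_algebra; exists v => //; exact: AB.
Qed.

Lemma sig_setT A M : sig A M -> sig setT M.
Proof. exact: sig_sub. Qed.

Lemma sig_ex A n (E : nat -> set config) :
  (forall i, (i < n)%N -> sig A (E i)) ->
  sig A [set f | exists2 i, (i < n)%N & E i f].
Proof.
move=> h.
have -> : [set f | exists2 i, (i < n)%N & E i f] =
    \bigcup_i (if (i < n)%N then E i else set0).
  apply/seteqP; split=> f /=.
    by case=> i lin Ef; exists i => //; rewrite lin.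
  by case=> i _; case: ifP => // lin Ef; exists i.
by apply: sig_bigcup => i; case: ifP => [/h //|_]; exact: sig0.
Qed.

Lemma sig_coord (A : set site) v (B : set R) : A v -> measurable B ->
  sig A [set f | B (f v)].
Proof. by move=> Av mB; apply: sub_sigma_algebra; exists v => //; exists B. Qed.

Section Law.
Variable L : field_law.
Notation Pr := (pr L).
Notation ev := (sig setT).

Lemma pr_setC M : ev M -> Pr (~` M) = 1 - Pr M.
Proof.
move=> hM; have := pr_disjU L hM (sigC hM) (setICr M).
by rewrite setUv pr_setT => ->; rewrite addrAC subrr add0r.
Qed.

Lemma pr_le M N : ev M -> ev N -> M `<=` N -> Pr M <= Pr N.
Proof.
move=> hM hN MN.
have -> : N = M `|` (N `\` M) by rewrite setDUK.
rewrite pr_disjU //; first by rewrite lerDl pr_ge0.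
  exact: sigD.
by exact: setDIK.
Qed.

Lemma pr_le1 M : ev M -> Pr M <= 1.
Proof. by move=> hM; rewrite -(pr_setT L); apply: pr_le => //; exact: sigT. Qed.

Lemma pr_set0 : Pr set0 = 0.
Proof. by rewrite -setCT pr_setC ?pr_setT ?subrr//; exact: sigT. Qed.

Lemma pr_setU M N : ev M -> ev N -> Pr (M `|` N) <= Pr M + Pr N.
Proof.
move=> hM hN.
have -> : M `|` N = M `|` (N `\` M).
  by rewrite setDE setUIr setUv setIT.
rewrite pr_disjU //; last by exact: setDIK.
  by rewrite lerD2l; apply: pr_le => //; apply: sigD.
exact: sigD.
Qed.

Lemma pr_setU_le M N x y : ev M -> ev N -> Pr M <= x -> Pr N <= y ->
  Pr (M `|` N) <= x + y.
Proof. by move=> hM hN Mx Ny; apply: le_trans (pr_setU hM hN) _; rewrite lerD. Qed.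

Lemma pr_setD M N : ev M -> ev N -> N `<=` M -> Pr (M `\` N) = Pr M - Pr N.
Proof.
move=> hM hN NM; rewrite -[in RHS](setDUK NM) pr_disjU //.
- by rewrite addrAC subrr add0r.
- exact: sigD.
- by exact: setDIK.
Qed.

Lemma pr_ex n (E : nat -> set config) (q : nat -> R) :
  (forall i, (i < n)%N -> ev (E i)) -> (forall i, (i < n)%N -> Pr (E i) <= q i) ->
  Pr [set f | exists2 i, (i < n)%N & E i f] <= \sum_(i < n) q i.
Proof.
elim: n => [|n IH] hE hq.
  rewrite big_ord0 (_ : [set f | _] = set0) ?pr_set0//.
  by apply/seteqP; split => // f [].
rewrite big_ord_recr /= (_ : [set f | _] =
   [set f | exists2 i, (i < n)%N & E i f] `|` E n); last first.
  apply/seteqP; split => f /=.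
    case=> i; rewrite ltnS leq_eqVlt => /predU1P[-> ?|lin Ef]; first by right.
    by left; exists i.
  by case=> [[i lin Ef]|Ef]; [exists i => //; exact: ltnW|exists n].
apply: pr_setU_le.
- by apply: sig_ex => i lin; apply: hE; exact: ltnW.
- exact: hE.
- by apply: IH => i lin; [apply: hE|apply: hq]; exact: ltnW.
- exact: hq.
Qed.

(** Splitting a union by the first index that occurs makes the pieces disjoint while each piece
    still depends only on the events up to that index. *)
Definition first_of (E : nat -> set config) i : set config :=
  E i `\` [set f | exists2 j, (j < i)%N & E j f].

Lemma sig_first_of A E i : (forall j, (j <= i)%N -> sig A (E j)) ->
  sig A (first_of E i).
Proof.
move=> h; apply: sigD; first exact: h.
by apply: sig_ex => j ji; apply: h; exact: ltnW.
Qed.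

Lemma ex_first_of E n f : (exists2 i, (i < n)%N & E i f) ->
  exists2 i, (i < n)%N & first_of E i f.
Proof.
move=> [i lin Ef].
have ex : exists i, `[< E i f >] by exists i; apply/asboolP.
exists (ex_minn ex).
  case: ex_minnP => m _ /(_ i); rewrite asboolE => /(_ Ef) mi.
  exact: leq_ltn_trans mi lin.
case: ex_minnP => m /asboolP Em hm; split => //= -[j jm Ej].
by have := hm j; rewrite asboolE => /(_ Ej); rewrite leqNgt jm.
Qed.

Lemma first_of_uniq E i j f : first_of E i f -> first_of E j f -> i = j.
Proof.
move=> [Ei ni] [Ej nj]; case: (ltngtP i j) => // h.
- by exfalso; apply: nj; exists i.
- by exfalso; apply: ni; exists j.
Qed.

Lemma pr_first_of_sum E (D : nat -> set config) n :
  (forall i, (i < n)%N -> ev (D i)) -> (forall i, D i `<=` first_of E i) ->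
  Pr [set f | exists2 i, (i < n)%N & D i f] = \sum_(i < n) Pr (D i).
Proof.
move=> + sub; elim: n => [|n IH] hD.
  rewrite big_ord0 (_ : [set f | _] = set0) ?pr_set0//.
  by apply/seteqP; split => // f [].
rewrite big_ord_recr /= -IH; last by move=> i lin; apply: hD; exact: ltnW.
rewrite -pr_disjU; first last.
- apply/seteqP; split => // f /= [[i lin /sub Di] /sub Dn].
  by move: lin; rewrite (first_of_uniq Di Dn) ltnn.
- exact: hD.
- by apply: sig_ex => i lin; apply: hD; exact: ltnW.
congr (Pr _); apply/seteqP; split => f /=.
  case=> i; rewrite ltnS leq_eqVlt => /predU1P[-> ?|lin Ef]; first by right.
  by left; exists i.
by case=> [[i lin Ef]|Ef]; [exists i => //; exact: ltnW|exists n].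
Qed.

Section FirstOf.
Variables (n : nat) (E H : nat -> set config) (q : R).
Hypothesis evE : forall i, (i < n)%N -> ev (E i).
Hypothesis evH : forall i, (i < n)%N -> ev (H i).
Hypothesis EHindep : forall i, (i < n)%N ->
  Pr (first_of E i `&` H i) = Pr (first_of E i) * Pr (H i).

Let ev_first i : (i < n)%N -> ev (first_of E i).
Proof.
by move=> lin; apply: sig_first_of => j ji; apply: evE; exact: leq_ltn_trans lin.
Qed.

(** A discrete strong Markov property: given that [E i] is the first to occur, [H i] keeps its
    probability, so both occur together at the cost of the factor [q] alone. *)
Lemma pr_first_of_ge : (forall i, (i < n)%N -> q <= Pr (H i)) ->
  q * Pr [set f | exists2 i, (i < n)%N & E i f] <=
  Pr [set f | exists2 i, (i < n)%N & E i f /\ H i f].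
Proof.
move=> qH.
have -> : [set f | exists2 i, (i < n)%N & E i f] =
    [set f | exists2 i, (i < n)%N & first_of E i f].
  apply/seteqP; split => f /=; first exact: ex_first_of.
  by case=> i lin [Ei _]; exists i.
rewrite (@pr_first_of_sum E (first_of E)) //; last by move=> i f.
apply: (@le_trans _ _ (Pr [set f | exists2 i, (i < n)%N & (first_of E i `&` H i) f])).
  rewrite (@pr_first_of_sum E (fun i => first_of E i `&` H i)); first last.
  - by move=> i f [].
  - by move=> i lin; apply: sigI; [exact: ev_first|exact: evH].
  rewrite mulr_sumr; apply: ler_sum => i _; rewrite EHindep // mulrC.
  by rewrite ler_wpM2l ?pr_ge0 // qH.
apply: pr_le.
- by apply: sig_ex => i lin; apply: sigI; [exact: ev_first|exact: evH].
- by apply: sig_ex => i lin; apply: sigI; [exact: evE|exact: evH].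
- by move=> f [i lin [[Ei _] Hi]]; exists i.
Qed.

(** The disjoint pieces have total probability at most 1, so the factor [n] of a union bound does
    not appear. *)
Lemma pr_first_of_le : (forall i, (i < n)%N -> Pr (H i) <= q) -> 0 <= q ->
  Pr [set f | exists2 i, (i < n)%N & first_of E i f /\ H i f] <= q.
Proof.
move=> qH q0.
rewrite (@pr_first_of_sum E (fun i => first_of E i `&` H i)); first last.
- by move=> i f [].
- by move=> i lin; apply: sigI; [exact: ev_first|exact: evH].
apply: (@le_trans _ _ (\sum_(i < n) Pr (first_of E i) * q)).
  by apply: ler_sum => i _; rewrite EHindep // ler_wpM2l ?pr_ge0 // qH.
rewrite -mulr_suml -(@pr_first_of_sum E (first_of E)) //; last by move=> i f.
rewrite -[leRHS]mul1r ler_wpM2r // pr_le1 //; exact: sig_ex.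
Qed.

End FirstOf.
End Law.
End Configurations.

(** * The law of the i.i.d. weights as a [field_law] *)

Section LawOfField.
Variable R : realType.

Definition finite_cylinder (A : set site) : set (set (config R)) :=
  [set M | exists (s : seq site) (B : site -> set R),
    [/\ uniq s, (forall v, v \in s -> A v), (forall v, measurable (B v))
      & M = [set f | forall v, v \in s -> B v (f v)]]].

Lemma finite_cylinderI A : setI_closed (finite_cylinder A).
Proof.
move=> _ _ [s1 [B1 [u1 A1 m1 ->]]] [s2 [B2 [u2 A2 m2 ->]]].
exists (undup (s1 ++ s2)).
exists (fun v => (if v \in s1 then B1 v else setT) `&` (if v \in s2 then B2 v else setT)).
split; first exact: undup_uniq.
- by move=> v; rewrite mem_undup mem_cat => /orP[/A1|/A2].
- by move=> v; apply: measurableI; case: ifP.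
- apply/seteqP; split => f /=.
    by move=> [h1 h2] v _; split; case: ifP => //; [exact: h1|exact: h2].
  move=> h; split => v vs; have := h v; rewrite mem_undup mem_cat vs ?orbT => /(_ isT).
    by case.
  by case.
Qed.

Lemma sig_finite_cylinder A : sig (R:=R) A `<=` <<s finite_cylinder A >>.
Proof.
apply: smallest_sub; first exact: smallest_sigma_algebra.
move=> M [v Av [B mB ->]]; apply: sub_sigma_algebra.
exists [:: v], (fun=> B); split => //.
- by move=> w; rewrite inE => /eqP ->.
- apply/seteqP; split => f /=; last by apply; rewrite inE.
  by move=> Bf w; rewrite inE => /eqP ->.
Qed.

Lemma finite_cylinder_sig A M : finite_cylinder A M -> sig A M.
Proof.
move=> [s [B [_ sA mB ->]]].
have -> : [set f : config R | forall v, v \in s -> B v (f v)] =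
    ~` [set f | exists2 i, (i < size s)%N & (~` B (nth (0, 0) s i)) (f (nth (0, 0) s i))].
  apply/seteqP; split => f /=.
    by move=> h [i ilt]; apply; apply: h; exact: mem_nth.
  move=> h v vs; apply: contrapT => nB; apply: h; exists (index v s).
    by rewrite index_mem.
  by rewrite nth_index.
apply: sigC; apply: (@sig_ex _ A _ (fun i => [set f | (~` B (nth (0, 0) s i)) (f (nth (0, 0) s i))])) => i ilt.
by apply: sig_coord; [apply: sA; exact: mem_nth|apply: measurableC].
Qed.

(** Complements are taken relative to [m setT] because the definition must also cover the traces of
    the law on a fixed event and its multiples, whose total mass is not 1. *)
Definition sigma_additive_pr (m : set (config R) -> R) :=
  (forall M, sig setT M -> m (~` M) = m setT - m M) /\
  (forall F : nat -> set (config R), (forall n, sig setT (F n)) -> trivIset setT F ->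
    (fun n => \sum_(0 <= i < n) m (F i)) @ \oo --> m (\bigcup_n F n)).

(** Dynkin's pi-lambda theorem: finite cylinders are stable under intersection and generate, and the
    events on which [m1] and [m2] agree form a lambda-system. *)
Lemma sig_ext A m1 m2 : sigma_additive_pr m1 -> sigma_additive_pr m2 ->
  m1 setT = m2 setT -> (forall M, finite_cylinder A M -> m1 M = m2 M) ->
  forall M, sig A M -> m1 M = m2 M.
Proof.
move=> [c1 s1] [c2 s2] eT eA M sM.
suff : <<s finite_cylinder A >> `<=` [set M | sig setT M /\ m1 M = m2 M].
  by move=> /(_ M); case=> //; exact: sig_finite_cylinder.
apply: lambda_system_subset.
- exact: finite_cylinderI.
- apply/dynkin_lambda_system; split.
  + by split => //; exact: sigT.
  + by move=> B [sB eB]; split; [exact: sigC|rewrite c1// c2// eT eB].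
  + move=> F tF hF; split; first by apply: sig_bigcup => n; case: (hF n).
    have h1 := s1 F (fun n => (hF n).1) tF.
    have h2 := s2 F (fun n => (hF n).1) tF.
    have E : (fun n => \sum_(0 <= i < n) m1 (F i)) = (fun n => \sum_(0 <= i < n) m2 (F i)).
      by apply/funext => n; apply: eq_bigr => i _; case: (hF i).
    by rewrite E in h1; exact: (cvg_unique _ h1 h2).
- by move=> N hN; split; [apply: (@sig_setT _ A); exact: finite_cylinder_sig|exact: eA].
- by move=> X _ x.
Qed.

Variables (d : measure_display) (T : measurableType d) (P : probability T R).
Variables (nu : probability R R) (xi : site -> T -> R).
Hypothesis xi_meas : forall v : site, measurable_fun setT (xi v).
Hypothesis xi_law : forall (v : site) (B : set R), measurable B ->
     P (xi v @^-1` B) = nu B.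
Hypothesis xi_indep : forall (s : seq site) (B : site -> set R), uniq s ->
     (forall i, measurable (B i)) ->
     P (\bigcap_(i in [set i | i \in s]) (xi i @^-1` B i)) =
     (\prod_(i <- s) P (xi i @^-1` B i))%E.

Definition field_of (w : T) : config R := fun v => xi v w.

Definition field_pr (M : set (config R)) : R := fine (P (field_of @^-1` M)).

Lemma measurable_field M : sig setT M -> measurable (field_of @^-1` M).
Proof.
move: M; apply: smallest_sub.
  split => /=.
  - by rewrite preimage_set0; exact: measurable0.
  - by move=> A mA; rewrite setTD preimage_setC; exact: measurableC.
  - by move=> F mF; rewrite preimage_bigcup; exact: bigcupT_measurable.
move=> M [v _ [B mB ->]] /=.
by rewrite -[X in measurable X]setTI; exact: xi_meas.
Qed.

Lemma field_prE M : sig setT M -> P (field_of @^-1` M) = (field_pr M)%:E.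
Proof. by move=> /measurable_field mM; rewrite fineK // fin_num_measure. Qed.

Lemma field_prC M : sig setT M -> field_pr (~` M) = 1 - field_pr M.
Proof.
move=> sM; apply: EFin_inj; rewrite EFinB -(field_prE sM) -(field_prE (sigC sM)) preimage_setC.
by rewrite probability_setC //; exact: measurable_field.
Qed.

Lemma field_prT : field_pr setT = 1.
Proof. by rewrite /field_pr preimage_setT probability_setT. Qed.

Lemma field_pr_sigma F : (forall n, sig setT (F n)) -> trivIset setT F ->
  (fun n => \sum_(0 <= i < n) field_pr (F i)) @ \oo --> field_pr (\bigcup_n F n).
Proof.
move=> sF tF.
have := @measure_semi_sigma_additive _ _ _ P (fun n => field_of @^-1` F n).
move=> /(_ (fun n => measurable_field (sF n))).
have tF' : trivIset setT (fun n => field_of @^-1` F n).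
  by apply/trivIsetP => i j _ _ ij; move/trivIsetP: tF => /(_ i j I I ij); rewrite -preimage_setI => ->; rewrite preimage_set0.
move=> /(_ tF'); rewrite -preimage_bigcup.
move=> /(_ (measurable_field (sig_bigcup sF))).
have hE := field_prE (sig_bigcup sF).
move=> h0; have : (fun n => (\sum_(0 <= i < n) P (field_of @^-1` F i))%E) @ \oo -->
  (field_pr (\bigcup_n F n))%:E by rewrite -hE; exact: h0.
set s := (X in X @ \oo --> _) => h.
have -> : (fun n => \sum_(0 <= i < n) field_pr (F i)) = fine \o s.
  by apply/funext => n; rewrite /s /= (eq_bigr _ (fun i _ => field_prE (sF i))) sumEFin.
exact: fine_cvg h.
Qed.

Lemma field_pr_disjU M N : sig setT M -> sig setT N -> M `&` N = set0 ->
  field_pr (M `|` N) = field_pr M + field_pr N.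
Proof.
move=> sM sN MN; apply: EFin_inj; rewrite EFinD -(field_prE sM) -(field_prE sN).
rewrite -(field_prE (sigU sM sN)).
rewrite preimage_setU measureU //; [exact: measurable_field|exact: measurable_field|].
by rewrite -preimage_setI MN preimage_set0.
Qed.

Lemma additive_field_pr N : sig setT N ->
  sigma_additive_pr (fun M => field_pr (M `&` N)).
Proof.
move=> sN; split.
- move=> M sM; rewrite setTI -[X in field_pr X - _](setUIDK N M).
  rewrite (_ : (N `&` M) = M `&` N); last by rewrite setIC.
  rewrite field_pr_disjU; last by rewrite setIC setDE -setIA [X in _ `&` X]setIA setICl set0I setI0.
  by rewrite addrAC subrr add0r setIC setDE.
  exact: sigI.
  exact: sigD.
- move=> F sF tF; rewrite setI_bigcupl; apply: field_pr_sigma.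
    by move=> n; exact: sigI.
  by apply: trivIset_setIr.
Qed.

Lemma additiveM c : sigma_additive_pr (fun M => field_pr M * c).
Proof.
split.
- by move=> M sM; rewrite field_prC // field_prT mulrBl.
- move=> F sF tF.
  rewrite (_ : (fun n => _) = (fun n => (\sum_(0 <= i < n) field_pr (F i)) * c)).
    by apply: cvgMl; exact: field_pr_sigma.
  by apply/funext => n; rewrite mulr_suml.
Qed.

Lemma sig_shift a M : sig setT M -> sig setT (shift_config (R:=R) a @^-1` M).
Proof.
move: M; apply: smallest_sub.
  split => /=.
  - by rewrite preimage_set0; exact: sig0.
  - by move=> A sA; rewrite setTD preimage_setC; exact: sigC.
  - by move=> F sF; rewrite preimage_bigcup; exact: sig_bigcup.
move=> M [v _ [B mB ->]] /=.
exact: (@sig_coord _ setT (v.1 + a.1, v.2 + a.2)).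
Qed.

Lemma additive_shift a : sigma_additive_pr (fun M => field_pr (shift_config a @^-1` M)).
Proof.
split.
- by move=> M sM; rewrite preimage_setC field_prC ?preimage_setT ?field_prT//; exact: sig_shift.
- move=> F sF tF; rewrite preimage_bigcup; apply: field_pr_sigma.
    by move=> n; exact: sig_shift.
  apply/trivIsetP => i j _ _ ij; move/trivIsetP: tF => /(_ i j I I ij).
  by rewrite -preimage_setI => ->; rewrite preimage_set0.
Qed.

Lemma field_pr_cylinder (s : seq site) (B : site -> set R) : uniq s ->
  (forall v, measurable (B v)) ->
  field_pr [set f | forall v, v \in s -> B v (f v)] = \prod_(v <- s) fine (nu (B v)).
Proof.
move=> us mB; rewrite /field_pr.
have -> : field_of @^-1` [set f | forall v, v \in s -> B v (f v)] =
    \bigcap_(i in [set i | i \in s]) (xi i @^-1` B i) by [].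
rewrite xi_indep // (eq_bigr (fun i => (fine (nu (B i)))%:E)); last first.
  by move=> i _; rewrite xi_law // fineK // fin_num_measure.
by rewrite prodEFin.
Qed.

(** Both sides are additive in each event separately. With a cylinder fixed over [B], the identity
    extends from cylinders to all events over [A]; with such an event fixed, it then extends over
    [B]. *)
Lemma field_pr_indep A B M N : A `&` B = set0 -> sig A M -> sig B N ->
  field_pr (M `&` N) = field_pr M * field_pr N.
Proof.
move=> AB sM sN.
have step1 M' N' : sig A M' -> finite_cylinder B N' ->
    field_pr (M' `&` N') = field_pr M' * field_pr N'.
  move=> sM' fN'; move: M' sM'; apply: sig_ext.
  - apply: additive_field_pr; apply: (@sig_setT _ B); exact: finite_cylinder_sig.
  - exact: additiveM.
  - by rewrite setTI field_prT mul1r.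
  - case: fN' => [s2 [B2 [u2 A2 m2 ->]]] _ [s1 [B1 [u1 A1 m1 ->]]].
    have dis v : v \in s1 -> v \in s2 -> False.
      by move=> /A1 Av /A2 Bv; have : (A `&` B) v by []; rewrite AB.
    have -> : [set f : config R | forall v, v \in s1 -> B1 v (f v)] `&`
        [set f | forall v, v \in s2 -> B2 v (f v)] =
        [set f | forall v, v \in s1 ++ s2 -> (if v \in s1 then B1 v else B2 v) (f v)].
      apply/seteqP; split => f /=.
        move=> [h1 h2] v; rewrite mem_cat => /orP[vs|vs]; first by rewrite vs; exact: h1.
        by case: ifP => [vs1|_]; [case: (dis v)|exact: h2].
      move=> h; split => v vs; have := h v; rewrite mem_cat vs ?orbT => /(_ isT) //.
      by case: ifP => // vs1; case: (dis v).
    have us : uniq (s1 ++ s2).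
      rewrite cat_uniq u1 u2 andbT /=; apply/hasPn => v vs2.
      by apply/negP => vs1; exact: (dis v).
    have ms v : measurable (if v \in s1 then B1 v else B2 v) by case: ifP.
    rewrite (field_pr_cylinder us ms) (field_pr_cylinder u1 m1) (field_pr_cylinder u2 m2).
    rewrite big_cat /=; congr (_ * _).
      by apply: eq_big_seq => v ->.
    apply: eq_big_seq => v vs2; case: ifP => // vs1.
    by case: (dis v).
move: N sN; apply: sig_ext.
- by under [X in sigma_additive_pr X]eq_fun do rewrite setIC; apply: additive_field_pr; exact: sig_setT sM.
- under [X in sigma_additive_pr X]eq_fun do rewrite mulrC.
  exact: additiveM.
- by rewrite setIT field_prT mulr1.
- by move=> N fN; exact: step1.
Qed.

Lemma field_pr_shift a M : sig setT M ->
  field_pr (shift_config a @^-1` M) = field_pr M.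
Proof.
move: M; apply: sig_ext.
- exact: additive_shift.
- have h := additiveM 1; move: h.
  by under [X in sigma_additive_pr X]eq_fun do rewrite mulr1.
- by rewrite preimage_setT.
- move=> _ [s [B [us sA mB ->]]].
  have inj : injective (fun v : site => (v.1 + a.1, v.2 + a.2)).
    by move=> [x y] [x' y'] /= [/addIr -> /addIr ->].
  have -> : shift_config a @^-1` [set f : config R | forall v, v \in s -> B v (f v)] =
      [set f | forall v, v \in map (fun v => (v.1 + a.1, v.2 + a.2)) s ->
        B (v.1 - a.1, v.2 - a.2) (f v)].
    apply/seteqP; split => f /= h v.
      by move=> /mapP[w ws ->] /=; rewrite !addrK -surjective_pairing; exact: h.
    move=> vs; have := h (v.1 + a.1, v.2 + a.2).
    by rewrite (mem_map inj) vs => /(_ isT) /=; rewrite !addrK -surjective_pairing.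
  rewrite (field_pr_cylinder us mB).
  rewrite (@field_pr_cylinder _ (fun v => B (v.1 - a.1, v.2 - a.2))) ?map_inj_uniq //.
  by rewrite big_map; apply: eq_bigr => v _; rewrite /= !addrK -surjective_pairing.
Qed.

Definition law_of_field : field_law R :=
  @FieldLaw R field_pr (fun M => fine_ge0 (measure_ge0 P _)) field_prT field_pr_disjU
    field_pr_indep field_pr_shift.

End LawOfField.

(** * Directed paths *)

(** Time [t] is the antidiagonal of coordinate sum [2 t], and [z] is the transversal offset. Thus
    (1,1) is [pt 1 0], and X_r^z is the passage time from [pt 1 0] to [pt r z]. *)
Definition pt (t z : int) : site := (t - z, t + z).

Definition between (u v w : site) : Prop :=
  [/\ u.1 <= w.1, u.2 <= w.2, w.1 <= v.1 & w.2 <= v.2].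

Lemma dstepP (a b : site) : dstep a b ->
  (b.1 = a.1 + 1 /\ b.2 = a.2) \/ (b.1 = a.1 /\ b.2 = a.2 + 1).
Proof. by case/orP => /eqP -> /=; [left|right]. Qed.

Lemma directed_path_cons u v w g :
  directed_path u v (w :: g) = dstep u w && directed_path w v g.
Proof. by rewrite /directed_path /= andbA. Qed.

Lemma directed_path_le u v g : directed_path u v g -> u.1 <= v.1 /\ u.2 <= v.2.
Proof.
elim: g u => [|w g IH] u; first by rewrite /directed_path /= => /eqP ->.
rewrite directed_path_cons => /andP[/dstepP st /IH] h; lia.
Qed.

Lemma directed_path_cat u v w g1 g2 : directed_path u v g1 -> directed_path v w g2 ->
  directed_path u w (g1 ++ g2).
Proof.
rewrite /directed_path cat_path last_cat.
by move=> /andP[-> /eqP ->] /andP[-> ->].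
Qed.

Lemma directed_path_split u v w g : directed_path u v g -> w \in u :: g ->
  exists g1 g2, [/\ g = g1 ++ g2, directed_path u w g1 & directed_path w v g2].
Proof.
rewrite inE => + /predU1P[->|]; first by exists [::], g; rewrite /directed_path /= eqxx.
move=> /[swap] /splitPr[p1 p2]; rewrite /directed_path => /andP[+ /eqP].
rewrite cat_path last_cat /= => /andP[h1 /andP[h2 h3]] lv.
exists (rcons p1 w), p2; split; first by rewrite cat_rcons.
  by rewrite rcons_path h1 h2 last_rcons eqxx.
by rewrite h3 lv eqxx.
Qed.

Lemma directed_path_between u v g w : directed_path u v g -> w \in u :: g ->
  between u v w.
Proof.
move=> /directed_path_split /[apply] -[g1 [g2 [_ /directed_path_le[? ?] /directed_path_le[? ?]]]].
by split.
Qed.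

(** A discrete intermediate value theorem, since a step changes [w.2 - w.1] by exactly one. *)
Lemma directed_path_cross u v g (c : int) : directed_path u v g ->
  u.2 - u.1 <= c -> (exists2 w : site, w \in u :: g & c <= w.2 - w.1) ->
  exists2 w : site, w \in u :: g & w.2 - w.1 = c.
Proof.
elim: g u => [|w g IH] u.
  move=> _ uc [w]; rewrite inE => /eqP -> cu; exists u; first by rewrite inE.
  by apply/eqP; rewrite eq_le uc cu.
rewrite directed_path_cons => /andP[/dstepP st dp] uc ex.
have [uc'|uc'] := eqVneq (u.2 - u.1) c; first by exists u => //; rewrite inE eqxx.
case: (IH w dp); first by case: st; lia.
  case: ex => x; rewrite inE => /predU1P[->|xg] cx; first by case: st; lia.
  by exists x.
by move=> x xg xc; exists x => //; rewrite inE xg orbT.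
Qed.

Lemma directed_path_cross_neg u v g (c : int) : directed_path u v g ->
  c <= u.2 - u.1 -> (exists2 w : site, w \in u :: g & w.2 - w.1 <= c) ->
  exists2 w : site, w \in u :: g & w.2 - w.1 = c.
Proof.
elim: g u => [|w g IH] u.
  move=> _ uc [w]; rewrite inE => /eqP -> cu; exists u; first by rewrite inE.
  by apply/eqP; rewrite eq_le uc cu.
rewrite directed_path_cons => /andP[/dstepP st dp] uc ex.
have [uc'|uc'] := eqVneq (u.2 - u.1) c; first by exists u => //; rewrite inE eqxx.
case: (IH w dp); first by case: st; lia.
  case: ex => x; rewrite inE => /predU1P[->|xg] cx; first by case: st; lia.
  by exists x.
by move=> x xg xc; exists x => //; rewrite inE xg orbT.
Qed.

(** * Passage events: concatenation, translation, measurability, exit from a strip *)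

Section Passage.
Variable R : realType.
Implicit Types (f : config R) (S : pred site) (x y : R).
Implicit Types (s t a b c z W : int) (n : nat).

(* Truncating the weights at 0 makes the monotonicity of path weights hold for every
   configuration; almost surely it changes nothing. *)
Definition pw f u (g : seq site) : R := path_weight (fun v => Num.max (f v) 0) u g.

Definition passes S u v x : set (config R) :=
  [set f | exists g, [/\ directed_path u v g, all S (u :: g) & x <= pw f u g]].

(* Starting one antidiagonal after [pt s a] makes the passages over consecutive time
   intervals use disjoint sites, hence independent. *)
Definition gd S s a t b x := passes S (pt (s + 1) a) (pt t b) x.

(** The factors 2 are there because [v.2 - v.1] is twice the offset; sites between two integer times
    have half-integer offset. *)
Definition strip (c W : int) : pred site := fun v => `|v.2 - v.1 - 2 * c| <= 2 * W.

Lemma pw_cat f u g1 g2 : pw f u (g1 ++ g2) =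
  pw f u g1 + \sum_(v <- g2) Num.max (f v) 0.
Proof. by rewrite /pw /path_weight -cat_cons big_cat. Qed.

Lemma pos_sum_ge0 f (g : seq site) : 0 <= \sum_(v <- g) Num.max (f v) 0.
Proof. by apply: sumr_ge0 => v _; rewrite le_max lexx orbT. Qed.

Lemma pw_ge0 f u g : 0 <= pw f u g.
Proof. exact: pos_sum_ge0. Qed.

Lemma passes_le S u v x y f : y <= x -> passes S u v x f -> passes S u v y f.
Proof. by move=> yx [g [? ? h]]; exists g; split => //; exact: le_trans h. Qed.

Lemma passes_sub S S' u v x f : (forall w, between u v w -> S w -> S' w) ->
  passes S u v x f -> passes S' u v x f.
Proof.
move=> SS [g [dg /allP Sg h]]; exists g; split => //.
apply/allP => w wg; apply: SS; last exact: Sg.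
exact: directed_path_between dg wg.
Qed.

(** Two steps lead from [pt t b] to [pt (t + 1) b], through either of two joint sites. The joint has
    nonnegative truncated weight, so it can only help, and one of the two lying in [S] is enough. *)
Lemma gd_cat S s a t b u c x y f : S (t - b, t + b + 1) || S (t - b + 1, t + b) ->
  gd S s a t b x f -> gd S t b u c y f -> gd S s a u c (x + y) f.
Proof.
move=> Sj [g1 [d1 S1 h1]] [g2 [d2 S2 h2]].
have [j [Sj' st1 st2]] : exists j, [/\ S j, dstep (pt t b) j & dstep j (pt (t + 1) b)].
  case/orP: Sj => Sj.
    exists (t - b, t + b + 1); split => //; rewrite /dstep /pt /= ?eqxx ?orbT //.
    by apply/orP; left; apply/eqP; congr pair; lia.
  exists (t - b + 1, t + b); split => //; rewrite /dstep /pt /= ?eqxx ?orbT //.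
  by apply/orP; right; apply/eqP; congr pair; lia.
exists (g1 ++ j :: pt (t + 1) b :: g2); split.
- apply: directed_path_cat d1 _.
  by rewrite !directed_path_cons st1 st2.
- by move: S1 => /= /andP[-> S1]; rewrite all_cat S1 /= Sj'; exact: S2.
- rewrite pw_cat big_cons lerD //; apply: le_trans h2 _.
  by rewrite lerDr le_max lexx orbT.
Qed.

Lemma shift_pw f k u g : pw (shift_config k f) u g =
  pw f (u.1 + k.1, u.2 + k.2) [seq (v.1 + k.1, v.2 + k.2) | v <- g].
Proof. by rewrite /pw /path_weight -map_cons big_map. Qed.

Lemma shift_directed_path (k u v : site) g :
  directed_path (u.1 + k.1, u.2 + k.2) (v.1 + k.1, v.2 + k.2)
    [seq (w.1 + k.1, w.2 + k.2) | w <- g] = directed_path u v g.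
Proof.
rewrite /directed_path; congr andb.
- rewrite path_map; apply: eq_path => a b; rewrite /dstep /=.
  case: a b k {u v} => a1 a2 [b1 b2] [k1 k2] /=; rewrite !xpair_eqE /=.
  by congr orb; congr andb; apply/eqP/eqP; lia.
- rewrite last_map; case: (last u g) v k => a1 a2 [b1 b2] [k1 k2] /=.
  by rewrite !xpair_eqE; congr andb; apply/eqP/eqP; lia.
Qed.

Lemma shift_passes S k u v x :
  shift_config k @^-1` passes (fun w => S (w.1 + k.1, w.2 + k.2)) u v x =
  passes S (u.1 + k.1, u.2 + k.2) (v.1 + k.1, v.2 + k.2) x.
Proof.
apply/seteqP; split => f /= [g [dg Sg hg]].
  exists [seq (w.1 + k.1, w.2 + k.2) | w <- g]; split.
  - by rewrite shift_directed_path.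
  - by rewrite -map_cons all_map.
  - by rewrite -shift_pw.
pose h := [seq (w.1 - k.1, w.2 - k.2) | w <- g].
have gh : g = [seq (w.1 + k.1, w.2 + k.2) | w <- h].
  rewrite /h -map_comp -[LHS]map_id; apply: eq_map => w /=.
  by rewrite !subrK -surjective_pairing.
exists h; split.
- by rewrite -(shift_directed_path k) -gh.
- by move: Sg; rewrite gh -map_cons all_map.
- by rewrite shift_pw -gh.
Qed.

(** Finite sequences of sites are countable, so the event is a countable union, enumerated by
    [pickle], of conditions on the weights along one path. *)
Lemma sig_passes (A : set site) S u v x :
  (forall w, between u v w -> S w -> A w) -> sig A (passes S u v x).
Proof.
move=> SA.
pose E (g : seq site) : set (config R) :=
  if directed_path u v g && all S (u :: g) then [set f | x <= pw f u g] else set0.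
have -> : passes S u v x = \bigcup_n (if @unpickle (seq site) n is Some g then E g else set0).
  apply/seteqP; split => f.
    move=> [g [dg Sg h]]; exists (pickle g) => //; rewrite pickleK /E dg Sg.
    exact: h.
  move=> [n _]; case: (@unpickle (seq site) n) => // g; rewrite /E; case: ifP => // /andP[dg Sg] h.
  by exists g.
have sigE0 : forall g, sig A (E g); last first.
  apply: sig_bigcup => n; case: (@unpickle (seq site) n) => [g|]; first exact: sigE0.
  by apply: sigE0.
move=> g; rewrite /E; case: ifP => [/andP[dg /allP Sg]|_]; last exact: sig0.
have Ag w : w \in u :: g -> A w.
  by move=> wg; apply: SA; [exact: directed_path_between dg wg|exact: Sg].
have mf : measurable_fun setT
    ((fun f : g_sigma_algebraType (cylinder (R:=R) A) => pw f u g) : _ -> R).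
  (* Summing measurable functions requires each summand to be measurable at every site; off the path
     the summand is set to 0, as such a site may lie outside [A]. *)
  have -> : (fun f => pw f u g) = (fun f : config R =>
      \sum_(v <- u :: g) (if v \in u :: g then Num.max (f v) 0 else 0)).
    apply/funext => f; rewrite /pw /path_weight.
    by apply: eq_big_seq => w ->.
  apply: measurable_sum => w; case wg: (w \in u :: g); last exact: measurable_cst.
  have Aw := Ag _ wg.
  apply: measurable_maxr; last exact: measurable_cst.
  by move=> _ B mB; rewrite setTI; exact: sig_coord.
have := mf measurableT `[x, +oo[%classic (measurable_itv _).
rewrite setTI; congr (sig A _); apply/seteqP; split => f /=; by rewrite in_itv /= andbT.
Qed.

(** One unit of time is two steps and changes the offset by -1, 0 or 1, chosen towards the target.
    The site in between is off by half a unit, which the margin in [W - 1] absorbs. *)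
Lemma directed_path_in_strip c W n s a b : `|b - a| <= n%:Z ->
  `|a - c| <= W - 1 -> `|b - c| <= W - 1 ->
  exists2 g, directed_path (pt s a) (pt (s + n%:Z) b) g & all (strip c W) (pt s a :: g).
Proof.
elim: n s a => [|n IH] s a ba ac bc.
  have -> : b = a by lia.
  exists [::]; first by rewrite /directed_path /= addr0 eqxx.
  by rewrite /= andbT /strip /pt /=; lia.
have [e [e1 e2 e3]] : exists e : int, [/\ `|e| <= 1, `|b - (a + e)| <= n%:Z &
    `|a + e - c| <= W - 1].
  case: (ltrgtP a b) => ab; [exists 1|exists (-1)|exists 0]; split; lia.
have [g dg Sg] := IH (s + 1) (a + e) e2 e3 bc.
have [j [j1 j2 Sj]] : exists j : site, [/\ dstep (pt s a) j, dstep j (pt (s + 1) (a + e))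
    & strip c W j].
  have [e0|[e0|e0]] : e = 1 \/ e = -1 \/ e = 0 by lia.
  - exists (s - a, s + a + 1); rewrite /dstep /pt /strip /= e0; split.
    + by apply/orP; right; rewrite eqxx.
    + by apply/orP; right; apply/eqP; congr pair; lia.
    + lia.
  - exists (s - a + 1, s + a); rewrite /dstep /pt /strip /= e0; split.
    + by apply/orP; left; rewrite eqxx.
    + by apply/orP; left; apply/eqP; congr pair; lia.
    + lia.
  - exists (s - a + 1, s + a); rewrite /dstep /pt /strip /= e0; split.
    + by apply/orP; left; rewrite eqxx.
    + by apply/orP; right; apply/eqP; congr pair; lia.
    + lia.
exists (j :: pt (s + 1) (a + e) :: g).
  rewrite !directed_path_cons j1 j2 /=.
  by rewrite (_ : s + n.+1%:Z = s + 1 + n%:Z) //; lia.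
move: Sg; rewrite /= Sj => -> /=; rewrite andbT /strip /pt /=; lia.
Qed.

(** Every path has nonnegative truncated weight, so only reachability matters. This settles all
    deficits that exceed [mu n]. *)
Lemma gd_exists c W s a t b x f : `|b - a| <= t - s - 1 ->
  `|a - c| <= W - 1 -> `|b - c| <= W - 1 -> x <= 0 -> gd (strip c W) s a t b x f.
Proof.
move=> ba ac bc x0.
have [|g dg Sg] := @directed_path_in_strip c W (absz (t - s - 1)%R) (s + 1) a b _ ac bc; first lia.
exists g; split => //; last exact: le_trans (pw_ge0 _ _ _).
by move: dg; rewrite (_ : s + 1 + (absz (t - s - 1)%R)%:Z = t) //; lia.
Qed.

(** A path leaving the strip meets its side at a site [pt t s], where it is cut. That site belongs
    to both parts, as the second one starts after time [t - 1]; counting its nonnegative weight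
    twice gives [x <= x1 + x2]. *)
Lemma gd_exit W n z x f : 0 <= W -> `|z| <= W -> gd predT 0 0 n z x f ->
  gd (strip 0 W) 0 0 n z x f \/
  exists s t x1 x2, [/\ s = W \/ s = - W, 1 <= t <= n, x <= x1 + x2,
    gd predT 0 0 t s x1 f & gd predT (t - 1) s n z x2 f].
Proof.
move=> W0 zW [g [dg _ hg]].
have [Sg|nS] := boolP (all (strip 0 W) (pt (0 + 1) 0 :: g)); first by left; exists g.
right; have [w [wg nw]] : exists w : site, w \in pt (0 + 1) 0 :: g /\ ~~ strip 0 W w.
  by move/allPn: nS => [w ? ?]; exists w.
have [s [sW [v vg vs]]] : exists s : int, (s = W \/ s = - W) /\
    exists2 v : site, v \in pt (0 + 1) 0 :: g & v.2 - v.1 = 2 * s.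
  move: nw; rewrite /strip => nw.
  have [wp|wp] : 2 * W <= w.2 - w.1 \/ w.2 - w.1 <= 2 * (- W) by lia.
    exists W; split; first by left.
    apply: (directed_path_cross dg); first by rewrite /pt /=; lia.
    by exists w.
  exists (- W); split; first by right.
  apply: (directed_path_cross_neg dg); first by rewrite /pt /=; lia.
  by exists w.
have [b1 b2 b3 b4] := directed_path_between dg vg.
have [g1 [g2 [gE d1 d2]]] := directed_path_split dg vg.
have vE : v = pt (v.1 + s) s.
  by rewrite /pt [LHS]surjective_pairing; congr pair; lia.
exists s, (v.1 + s), (pw f (pt (0 + 1) 0) g1), (pw f v g2).
move: b1 b2 b3 b4; rewrite /pt /= => b1 b2 b3 b4; split => //.
- lia.
- apply: le_trans hg _; rewrite gE pw_cat lerD2l /pw /path_weight big_cons lerDr.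
  by rewrite le_max lexx orbT.
- by exists g1; rewrite -vE; split => //; apply/allP.
- by exists g2; rewrite subrK -vE; split => //; apply/allP.
Qed.

Section Law.
Variable L : field_law R.
Notation Pr := (pr L).

Lemma pr_gd_shift S S' s a t b x :
  (forall w : site, S' w = S (w.1 + (s - a), w.2 + (s + a))) ->
  Pr (gd S s a t b x) = Pr (gd S' 0 0 (t - s) (b - a) x).
Proof.
move=> SS; pose k : site := (s - a, s + a).
have e : S' = (fun w : site => S (w.1 + k.1, w.2 + k.2)) by apply/funext => w; rewrite SS.
rewrite -(@pr_shift _ L k (gd S' 0 0 (t - s) (b - a) x)); last first.
  by apply: sig_passes.
rewrite /gd e (shift_passes S k) /k /pt /=; congr (Pr (passes _ _ _ _)); congr pair; lia.
Qed.

Lemma pr_gd_strip c W s a t b x :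
  Pr (gd (strip c W) s a t b x) = Pr (gd (strip (c - a) W) 0 0 (t - s) (b - a) x).
Proof. by apply: pr_gd_shift => w; rewrite /strip /=; congr (_ <= _); congr (`|_|); lia. Qed.

Lemma pr_gd_predT s a t b x :
  Pr (gd predT s a t b x) = Pr (gd predT 0 0 (t - s) (b - a) x).
Proof. exact: pr_gd_shift. Qed.

Lemma ev_gd S s a t b x : sig setT (gd S s a t b x : set (config R)).
Proof. exact: sig_passes. Qed.

End Law.
End Passage.

(** * Passage times restricted to a strip *)

Section Tails.
Variables (R : realType) (L : field_law R) (mu al : R).
Notation Pr := (pr L).
Notation ev := (@sig R setT).

(** (LT) recentred at [mu n]: for offsets up to n^(2/3) the curvature term has order n^(1/3) and is
    absorbed by [th]. In [upper_tail] it stays explicit, because the exit argument draws its gain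
    from it. *)
Definition lower_tail (c th0 : R) (n0 : nat) := forall (n : nat) (z : int) (th : R),
  (n0 <= n)%N -> `|z|%:~R <= cb (R:=R) n%:R ^+ 2 -> th0 <= th ->
  Pr (~` gd predT 0 0 n z (mu * n%:R - th * cb n%:R)) <= expR (- (c * th `^ al)).

Definition upper_tail (G rho c th0 : R) (n0 : nat) := forall (n : nat) (z : int) (th : R),
  (n0 <= n)%N -> `|z|%:~R <= rho * n%:R -> th0 <= th ->
  Pr (gd predT 0 0 n z (mu * n%:R - G * z%:~R ^+ 2 / n%:R + th * cb n%:R))
    <= expR (- (c * th `^ al)).

(** * The cost of reaching the side of a strip *)

Section Fluctuation.
Variables (G rho c th0 C : R) (n0 : nat).
Hypothesis th01 : 1 <= th0.
Hypotheses (low : lower_tail c th0 n0) (thC : th0 <= C)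
  (Chalf : expR (- (c * C `^ al)) <= 2^-1).

(** The deficit is expressed through [N] so that it is the same for all exit times: a backup runs up
    to time [2 n], or from time [-n], so its length [m] lies between [n] and [N = 2 n]. *)
Lemma backup_tail (m N : nat) (s s' a : int) : (n0 <= m)%N -> (m <= N)%N -> s' = s + m%:Z ->
  2^-1 <= Pr (gd predT s a s' a (mu * m%:R - C * cb N%:R)).
Proof.
move=> n0m mN ->; rewrite pr_gd_predT subrr addrAC subrr add0r.
have cbm : cb (R:=R) m%:R <= cb N%:R by apply: cb_le; rewrite ?ler0n ?ler_nat.
have C0 : 0 <= C by move: (le_trans th01 thC); lra.
have h : Pr (~` gd predT 0 0 m 0 (mu * m%:R - C * cb m%:R)) <= 2^-1.
  by apply: le_trans Chalf; apply: low => //; rewrite normr0 exprn_ge0 // cb_ge0.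
rewrite pr_setC ?ev_gd // in h; last exact: ev_gd.
apply: (@le_trans _ _ (Pr (gd predT 0 0 m 0 (mu * m%:R - C * cb m%:R)))); first lra.
apply: pr_le; try exact: ev_gd.
by move=> f; apply: passes_le; rewrite lerD2l lerN2 ler_wpM2l.
Qed.

(* The points (t, s) of a fixed diagonal are totally ordered, so the weights used
   after the first bad one are independent of how it was selected. *)
Lemma pr_exit_before (n : nat) (s : int) (A : R) : (n0 <= n)%N ->
  Pr [set f | exists2 i, (i < n)%N & gd predT 0 0 i.+1 s (mu * i.+1%:R - A) f] <=
  2 * Pr (gd predT 0 0 (n + n)%N s (mu * (n + n)%:R - A - C * cb (n + n)%:R)).
Proof.
move=> n0n.
pose E i : set (config R) := gd predT 0 0 i.+1 s (mu * i.+1%:R - A).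
pose H i : set (config R) := gd predT i.+1 s (n + n)%N s
  (mu * (n + n - i.+1)%:R - C * cb (n + n)%:R).
rewrite -[leLHS]mul1r -[X in X * _ <= _](@mulfV _ 2) ?pnatr_eq0 // -mulrA.
rewrite ler_pM2l //.
apply: (@le_trans _ _ (Pr [set f | exists2 i, (i < n)%N & E i f /\ H i f])).
  apply: pr_first_of_ge.
  - by move=> i _; exact: ev_gd.
  - by move=> i _; exact: ev_gd.
  - move=> i _.
    apply: (@pr_indep _ L [set v | v.1 <= i.+1%:Z - s] [set v | i.+2%:Z - s <= v.1]).
    + by apply/seteqP; split => // v [] /=; lia.
    + apply: sig_first_of => j ji; apply: sig_passes => w.
      by rewrite /between /pt /= => -[]; lia.
    + by apply: sig_passes => w; rewrite /between /pt /= => -[]; lia.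
  - move=> i lin; apply: backup_tail; lia.
apply: pr_le; [|exact: ev_gd|].
  by apply: sig_ex => i _; apply: sigI; exact: ev_gd.
move=> f [i lin [Ei Hi]].
have := gd_cat _ Ei Hi => /(_ isT); congr (gd _ _ _ _ _ _ f).
rewrite natrB; last lia.
lra.
Qed.

(** Time reversal of [pr_exit_before]: indices count from the end, so the first one is the latest
    start and the backup precedes it. The passage spans [i + 1] units of time but is only asked for
    [mu i - A], because the exit site is counted twice; hence the additional [mu]. *)
Lemma pr_exit_after (n : nat) (s z : int) (A : R) : (n0 <= n)%N ->
  Pr [set f | exists2 i, (i < n)%N &
    gd predT (n%:Z - i.+1%:Z) s n z (mu * i%:R - A) f] <=
  2 * Pr (gd predT 0 0 (n + n)%N (z - s) (mu * (n + n)%:R - mu - A - C * cb (n + n)%:R)).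
Proof.
move=> n0n.
pose E i : set (config R) := gd predT (n%:Z - i.+1%:Z) s n z (mu * i%:R - A).
pose H i : set (config R) := gd predT (- n%:Z) s (n%:Z - i.+1%:Z) s
  (mu * (n + n - i.+1)%:R - C * cb (n + n)%:R).
rewrite -[leLHS]mul1r -[X in X * _ <= _](@mulfV _ 2) ?pnatr_eq0 // -mulrA.
rewrite ler_pM2l //.
apply: (@le_trans _ _ (Pr [set f | exists2 i, (i < n)%N & E i f /\ H i f])).
  apply: pr_first_of_ge.
  - by move=> i _; exact: ev_gd.
  - by move=> i _; exact: ev_gd.
  - move=> i _.
    apply: (@pr_indep _ L [set v | n%:Z - i%:Z - s <= v.1] [set v | v.1 <= n%:Z - i.+1%:Z - s]).
    + by apply/seteqP; split => // v [] /=; lia.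
    + apply: sig_first_of => j ji; apply: sig_passes => w.
      by rewrite /between /pt /= => -[]; lia.
    + by apply: sig_passes => w; rewrite /between /pt /= => -[]; lia.
  - move=> i lin; apply: backup_tail; lia.
rewrite (_ : Pr (gd _ _ _ _ _ _) = Pr (gd predT (- n%:Z) s n z
   (mu * (n + n)%:R - mu - A - C * cb (n + n)%:R))); last first.
  rewrite [RHS]pr_gd_predT; congr (Pr (gd _ _ _ _ _ _)); lia.
apply: pr_le; [|exact: ev_gd|].
  by apply: sig_ex => i _; apply: sigI; exact: ev_gd.
move=> f [i lin [Ei Hi]].
have := gd_cat _ Hi Ei => /(_ isT); congr (gd _ _ _ _ _ _ f).
rewrite natrB; last lia.
rewrite -natr1; lra.
Qed.

End Fluctuation.

Lemma cb_double (n : nat) : cb (R:=R) (n + n)%:R <= 2 * cb n%:R.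
Proof.
apply: cube_le; first by rewrite mulr_ge0 // cb_ge0.
rewrite exprMn !cb3 ?ler0n // natrD.
have : 0 <= n%:R :> R by rewrite ler0n.
lra.
Qed.

(** The hypothesis makes the curvature at distance [W] and time [2 n] worth [11/2 th u]. It pays
    [2 th u] for each of [th v] and [C v], [th u] for [mu], and [th u / 2] for the deficit. *)
Lemma curvature_gain (G C th u v W K : R) (n : nat) : 0 < G -> 1 <= u -> u ^+ 3 = n%:R ->
  0 <= C -> C <= th -> 1 <= th -> `|mu| <= th -> 0 <= v -> v <= 2 * u ->
  11 * th * u ^+ 4 <= G * W ^+ 2 ->
  mu * (n + n)%:R - G * W ^+ 2 / (n + n)%:R + th * v <=
  mu * (n + n)%:R - `|mu| - th * u / 2 - C * v.
Proof.
move=> G0 u1 un C0 Cth th1 muth v0 v2 h.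
have u0 : 0 < u by lra.
have nn : (n + n)%:R = 2 * u ^+ 3 :> R by rewrite natrD -un; lra.
have u3 : 0 < 2 * u ^+ 3 by rewrite mulr_gt0 // exprn_gt0.
have hK : 11 / 2 * (th * u) <= G * W ^+ 2 / (2 * u ^+ 3).
  rewrite ler_pdivlMr //; apply: le_trans h.
  have -> : 11 / 2 * (th * u) * (2 * u ^+ 3) = 11 * th * u ^+ 4 by field.
  by [].
rewrite nn.
have h1 : C * v <= th * (2 * u) by apply: ler_pM.
have h2 : th * v <= th * (2 * u) by rewrite ler_wpM2l //; lra.
have h3 : `|mu| <= th * u.
  apply: le_trans muth _.
  by rewrite ler_peMr //; lra.
lra.
Qed.

Lemma block_tail (G rho c th0 : R) (n0 : nat) : 0 < al -> 0 < c -> 1 <= th0 ->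
  (0 < n0)%N -> 0 < G -> 0 < rho -> lower_tail c th0 n0 -> upper_tail G rho c th0 n0 ->
  exists C1 dl th1 : R, exists n1 : nat, [/\ 0 < C1, 0 < dl, 1 <= th1, (0 < n1)%N &
    forall (n : nat) (z W : int) (th : R), (n1 <= n)%N -> `|z|%:~R <= cb (R:=R) n%:R ^+ 2 ->
      th1 <= th -> th <= dl * cb n%:R ^+ 2 -> C1 * Num.sqrt th * cb n%:R ^+ 2 <= W%:~R ->
      Pr (~` gd (strip 0 W) 0 0 n z (mu * n%:R - th * cb n%:R)) <=
        9 * expR (- (c * th `^ al))].
Proof.
move=> al0 c0 th01 n00 G0 rho0 low up.
have [t0 [t00 ht0]] := powR_unbounded (ln 2) al0 c0.
pose C := Num.max t0 th0.
have thC : th0 <= C by rewrite le_max lexx orbT.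
have Chalf : expR (- (c * C `^ al)) <= 2^-1.
  rewrite -[leRHS]lnK ?posrE ?invr_gt0 // ler_expR lnV ?posrE // lerN2.
  by apply: ht0; rewrite le_max lexx.
(* The summand 2 gives [W0 >= 2 u^2], so after subtracting [z] an offset of at least [W0 / 2]
   remains. Halving the offset turns the 11 of [curvature_gain] into 44. *)
pose C1 := 2 + 44 / G.
have C1_2 : 2 <= C1 by rewrite lerDl divr_ge0 // ltW.
have C1G : 44 <= G * C1 ^+ 2.
  have -> : G * C1 ^+ 2 = 4 * G + 176 + 44 ^+ 2 / G by rewrite /C1; field; lra.
  have : 0 <= 44 ^+ 2 / G by rewrite divr_ge0 // ltW.
  lra.
have C10 : 0 < C1 by lra.
(* Keeps the exit distance [C1 sqrt(th) u^2] below [rho n / 4], within the range of the upper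
   tail. *)
pose dl := (rho / (4 * C1)) ^+ 2.
pose th1 := Num.max C `|mu|.
have [n1 hn1] := exists_nat_ge ((4 / rho + 1) ^+ 3).
exists C1, dl, th1, (maxn n0 n1).
split.
- lra.
- by rewrite /dl exprn_gt0 // divr_gt0 //; lra.
- by rewrite le_max (le_trans th01 thC).
- by rewrite leq_max n00.
move=> n z W th; rewrite geq_max => /andP[n0n n1n] zn.
rewrite ge_max => /andP[Cth muth] thdl hW.
set u := cb (R:=R) n%:R in zn thdl hW *.
have n_0 : 0 <= n%:R :> R by rewrite ler0n.
have un : u ^+ 3 = n%:R by rewrite /u cb3.
have hrho : 0 < 4 / rho by rewrite divr_gt0.
have u4 : 4 / rho + 1 <= u.
  apply: cube_le; first exact: cb_ge0.
  by rewrite un; apply: le_trans hn1 _; rewrite ler_nat.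
have u1 : 1 <= u by lra.
have u0 : 0 < u by lra.
have u20 : 0 < u ^+ 2 by rewrite exprn_gt0.
have urho : 4 <= rho * u.
  have : rho * (4 / rho + 1) <= rho * u by rewrite ler_pM2l.
  by rewrite mulrDr mulrCA divff ?gt_eqF //; lra.
have thge1 : 1 <= th by lra.
pose s := Num.sqrt th.
have s2 : s ^+ 2 = th by rewrite sqr_sqrtr //; lra.
have s0 : 0 <= s by exact: sqrtr_ge0.
have s1 : 1 <= s by rewrite -(@ler_pXn2r _ 2) ?nnegrE // expr1n s2.
have su : s <= rho / (4 * C1) * u.
  have C14 : 0 <= rho / (4 * C1) by rewrite divr_ge0 ?mulr_ge0 ?(ltW rho0) ?(ltW C10).
  rewrite -(@ler_pXn2r _ 2) ?nnegrE //; last by rewrite mulr_ge0 // (ltW u0).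
  by rewrite s2 exprMn.
(* Exits are measured at the smallest suitable integer [W0] instead of [W], which may lie beyond the
   range of the upper tail. *)
have [W0 /andP[hW01 hW02]] : exists k : nat, C1 * s * u ^+ 2 <= k%:R < C1 * s * u ^+ 2 + 1.
  by apply: exists_ceil; rewrite !mulr_ge0 // ltW.
have u2u : u <= u ^+ 2 by rewrite expr2 ler_peMr // ltW.
have W0u : 2 * u ^+ 2 <= W0%:R.
  apply: le_trans hW01; rewrite ler_pM2r //.
  have : C1 * 1 <= C1 * s by rewrite ler_pM2l.
  clear -C1_2; lra.
rewrite -/s in hW.
have W0W : (W0%:Z <= W).
  have : (W0%:Z%:~R : R) < (W + 1)%:~R by rewrite intrD -pmulrn; clear -hW02 hW; lra.
  by rewrite ltr_int ltzD1.
have W0n : W0%:R + u ^+ 2 <= rho * (n + n)%:R.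
  have h1 : C1 * s * u ^+ 2 <= rho / 4 * u ^+ 3.
    have : C1 * s <= C1 * (rho / (4 * C1) * u) by rewrite ler_pM2l.
    rewrite (_ : C1 * (_ * u) = rho / 4 * u); last by field; rewrite (gt_eqF C10).
    by move=> h; rewrite [u ^+ 3]exprS mulrA ler_pM2r.
  have h2 : 4 * u ^+ 2 <= rho * u ^+ 3.
    by rewrite [u ^+ 3]exprS mulrA ler_pM2r.
  rewrite natrD -un; clear -h1 h2 hW02 u2u u1; lra.
have zW0 : `|z| <= W0%:Z.
  have : (`|z|%:~R : R) <= W0%:Z%:~R by rewrite -pmulrn; rewrite -/u in zn; have := ltW u20; clear -zn W0u; lra.
  by rewrite ler_int.
have gainW (w : R) : W0%:R ^+ 2 <= 4 * w ^+ 2 -> 11 * th * u ^+ 4 <= G * w ^+ 2.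
  move=> hw.
  have h1 : (C1 * s * u ^+ 2) ^+ 2 <= W0%:R ^+ 2.
    by rewrite ler_pXn2r ?nnegrE // !mulr_ge0 // ltW.
  have h2 : G * (C1 * s * u ^+ 2) ^+ 2 <= G * (4 * w ^+ 2).
    by rewrite ler_pM2l // (le_trans h1).
  have h3 : 44 * (s ^+ 2 * u ^+ 4) <= G * C1 ^+ 2 * (s ^+ 2 * u ^+ 4).
    by rewrite ler_wpM2r // mulr_ge0 // exprn_ge0 // ltW.
  have h4 : G * (C1 * s * u ^+ 2) ^+ 2 = G * C1 ^+ 2 * (s ^+ 2 * u ^+ 4) by ring.
  rewrite s2 in h3 h4; clear -h2 h3 h4; lra.
have C0 : 0 <= C by clear -thC th01; lra.
have nn0 : (n0 <= n + n)%N by apply: leq_trans n0n _; exact: leq_addr.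
have upper (z' : int) : `|z'|%:~R <= W0%:R + u ^+ 2 -> W0%:R ^+ 2 <= 4 * z'%:~R ^+ 2 :> R ->
    Pr (gd predT 0 0 (n + n)%N z' (mu * (n + n)%:R - `|mu| - th * u / 2 - C * cb (n + n)%:R)) <=
    expR (- (c * th `^ al)).
  move=> z1 z2; apply: le_trans (up _ z' th nn0 _ _); first last.
  - exact: le_trans thC Cth.
  - exact: le_trans W0n.
  - apply: pr_le; try exact: ev_gd.
    move=> f; apply: passes_le; apply: (curvature_gain (u := u)) => //.
    + exact: cb_ge0.
    + exact: cb_double.
    + exact: gainW.
have before (sg : int) : `|sg| = W0%:Z ->
    Pr [set f | exists2 i, (i < n)%N & gd predT 0 0 i.+1 sg (mu * i.+1%:R - th * u / 2) f]
    <= 2 * expR (- (c * th `^ al)).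
  move=> sgW.
  have sgR : `|sg|%:~R = W0%:R :> R by rewrite sgW -pmulrn.
  apply: le_trans (pr_exit_before th01 low thC Chalf sg _ n0n) _.
  rewrite ler_pM2l //; apply: (le_trans _ (upper sg _ _)).
  - apply: pr_le; try exact: ev_gd.
    move=> f; apply: passes_le; have := normr_ge0 mu; lra.
  - by rewrite sgR lerDl ltW.
  - have : (sg%:~R : R) ^+ 2 = W0%:R ^+ 2 by rewrite -sgR intr_norm real_normK // num_real.
    by move=> ->; rewrite ler_peMl ?sqr_ge0 // ler1n.
have after (sg : int) : `|sg| = W0%:Z ->
    Pr [set f | exists2 i, (i < n)%N & gd predT (n%:Z - i.+1%:Z) sg n z (mu * i%:R - th * u / 2) f]
    <= 2 * expR (- (c * th `^ al)).
  move=> sgW.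
  have sgR : `|sg|%:~R = W0%:R :> R by rewrite sgW -pmulrn.
  have zR := zn; rewrite intr_norm in zR; rewrite intr_norm in sgR.
  apply: le_trans (pr_exit_after th01 low thC Chalf sg z _ n0n) _.
  rewrite ler_pM2l //; apply: (le_trans _ (upper (z - sg) _ _)).
  - apply: pr_le; try exact: ev_gd.
    move=> f; apply: passes_le; have := ler_norm mu; lra.
  - rewrite intr_norm intrB; apply: le_trans (ler_normB _ _) _; clear -zR sgR; lra.
  - have h1 : W0%:R <= 2 * `|(z - sg)%:~R| :> R.
      rewrite intrB distrC.
      have := lerB_dist (sg%:~R : R) z%:~R; clear -zR sgR W0u; lra.
    have : W0%:R ^+ 2 <= (2 * `|(z - sg)%:~R : R|) ^+ 2.
      by rewrite ler_pXn2r ?nnegrE // mulr_ge0.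
    have four : 2 ^+ 2 = 4 :> R by ring.
    by rewrite exprMn real_normK ?num_real // four.
pose Eb sg : set (config R) := [set f | exists2 i, (i < n)%N & gd predT 0 0 i.+1 sg (mu * i.+1%:R - th * u / 2) f].
pose Ea sg : set (config R) := [set f | exists2 i, (i < n)%N & gd predT (n%:Z - i.+1%:Z) sg n z (mu * i%:R - th * u / 2) f].
have evb sg : ev (Eb sg) by apply: sig_ex => i _; exact: ev_gd.
have eva sg : ev (Ea sg) by apply: sig_ex => i _; exact: ev_gd.
pose D : set (config R) := ~` gd predT 0 0 n z (mu * n%:R - th * u).
have evD : ev D by apply: sigC; exact: ev_gd.
have sub : ~` gd (strip 0 W) 0 0 n z (mu * n%:R - th * u) `<=`
    D `|` ((Eb W0 `|` Eb (- W0%:Z)) `|` (Ea W0 `|` Ea (- W0%:Z))).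
  move=> f nf; apply: contrapT => nU; apply: nf.
  have fD : gd predT 0 0 n z (mu * n%:R - th * u) f.
    by apply: contrapT => h; apply: nU; left.
  case: (@gd_exit _ W0%:Z n z _ f _ zW0 fD) => //.
    by apply: passes_sub => w _; rewrite /strip; clear -W0W; lia.
  move=> [sg [t [x1 [x2 [sgW tn hx g1 g2]]]]]; exfalso; apply: nU; right.
  have hx' : mu * n%:R - th * u <= x1 + x2 by [].
  have [i [tE lin]] : exists i : nat, t = i.+1%:Z /\ (i < n)%N.
    by exists (absz (t - 1)%R); clear -tn; lia.
  (* At least one of the two parts loses no more than half of the deficit [th u]. *)
  have [x1t|x1t] := leP (mu * i.+1%:R - th * u / 2) x1.
    left; have : Eb sg f.
      by exists i => //; apply: (passes_le x1t); rewrite -tE.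
    by case: sgW => ->; [left|right].
  right; have : Ea sg f.
    exists (n - i.+1)%N; first by clear -lin; lia.
    have -> : n%:Z - (n - i.+1).+1%:Z = t - 1 by clear -lin tE; lia.
    apply: passes_le g2; rewrite natrB // mulrBr.
    clear -hx' x1t; lra.
  by case: sgW => ->; [left|right].
apply: le_trans (pr_le L _ _ sub) _.
- by apply: sigC; exact: ev_gd.
- by apply: sigU => //; apply: sigU; apply: sigU.
(* 9 = 1 + 4 * 2: the unrestricted deficit, and a factor 2 for each of two sides and two parts. *)
have -> : 9 * expR (- (c * th `^ al)) = expR (- (c * th `^ al)) + (2 * expR (- (c * th `^ al)) +
   2 * expR (- (c * th `^ al)) + (2 * expR (- (c * th `^ al)) + 2 * expR (- (c * th `^ al)))) by ring.
have h0 : th0 <= th by exact: le_trans thC Cth.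
have absW : `|W0%:Z| = W0%:Z by [].
have absNW : `|- W0%:Z| = W0%:Z by rewrite normrN.
have evU A B : ev A -> ev B -> ev (A `|` B) by exact: sigU.
have evB : ev (Eb W0 `|` Eb (- W0%:Z)) by apply: evU.
have evA : ev (Ea W0 `|` Ea (- W0%:Z)) by apply: evU.
apply: pr_setU_le; [exact: evD|by apply: evU| |].
  exact: (low _ _ _ n0n zn h0).
apply: pr_setU_le => //.
  by apply: pr_setU_le; [exact: evb|exact: evb|exact: before|exact: before].
by apply: pr_setU_le; [exact: eva|exact: eva|exact: after|exact: after].
Qed.

End Tails.

(** * Chains of blocks *)

Section Chain.
Variables (R : realType) (L : field_law R) (mu : R).
Notation Pr := (pr L).
Notation ev := (@sig R setT).

Lemma pr_all (J : nat) (E : nat -> set (config R)) (A : nat -> set site) (p : R) :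
  (forall i j, (i < j)%N -> (j < J)%N -> A i `&` A j = set0) ->
  (forall j, (j < J)%N -> sig (A j) (E j)) ->
  (forall j, (j < J)%N -> Pr (E j) <= p) ->
  Pr [set f | forall j, (j < J)%N -> E j f] <= p ^+ J.
Proof.
move=> dis sE pE.
suff : sig [set w | exists2 j, (j < J)%N & A j w] [set f | forall j, (j < J)%N -> E j f] /\
    Pr [set f | forall j, (j < J)%N -> E j f] <= p ^+ J by case.
elim: J dis sE pE => [|J IH] dis sE pE.
  have -> : [set f | forall j, (j < 0)%N -> E j f] = setT by apply/seteqP; split.
  by split; [exact: sigT|rewrite pr_setT expr0 lexx].
have [IH1 IH2] : sig [set w | exists2 j, (j < J)%N & A j w]
      [set f | forall j, (j < J)%N -> E j f] /\
    Pr [set f | forall j, (j < J)%N -> E j f] <= p ^+ J.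
  apply: IH => [i j ij jJ|j jJ|j jJ]; [apply: dis => //|apply: sE|apply: pE]; exact: ltnW.
have -> : [set f | forall j, (j < J.+1)%N -> E j f] =
    [set f | forall j, (j < J)%N -> E j f] `&` E J.
  apply/seteqP; split => f /=.
    by move=> h; split; [move=> j jJ; apply: h; exact: ltnW|exact: h].
  by move=> [h1 h2] j; rewrite ltnS leq_eqVlt => /predU1P[->//|]; exact: h1.
split.
  apply: sigI.
    by apply: sig_sub IH1 => w [j jJ Aj]; exists j => //; exact: ltnW.
  by apply: sig_sub (sE J (ltnSn J)) => w AJ; exists J.
rewrite exprSr (@pr_indep _ L [set w | exists2 j, (j < J)%N & A j w] (A J)) //.
- by apply: ler_pM; rewrite ?pr_ge0 // pE.
- apply/seteqP; split => // w [[j jJ Aj] AJ].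
  by have : (A j `&` A J) w by []; rewrite dis.
- exact: sE.
Qed.

(** Abel summation, which passes from the probabilities of exact loss levels to tail probabilities,
    the quantities that are bounded by [h]. *)
Lemma sum_by_parts (p x : nat -> R) (n : nat) :
  \sum_(m < n.+1) (p m - p m.+1) * x m =
  p 0%N * x 0%N + \sum_(m < n) p m.+1 * (x m.+1 - x m) - p n.+1 * x n.
Proof.
elim: n => [|n IH]; first by rewrite big_ord_recr !big_ord0 /=; ring.
by rewrite big_ord_recr /= IH [in RHS]big_ord_recr /=; ring.
Qed.

Variables (v : R) (t z : nat -> int) (W : int) (K : nat) (S0 : pred site).
Hypotheses (v0 : 0 <= v) (W1 : 1 <= W).
Hypothesis S0P : forall i (w : site), (i < K)%N ->
  2 * t i + 1 <= w.1 + w.2 -> w.1 + w.2 <= 2 * t i.+1 -> strip (z i) W w -> S0 w.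

Definition block_bad i (j : nat) : set (config R) :=
  ~` gd (strip (z i) W) (t i) (z i) (t i.+1) (z i.+1)
    (mu * (t i.+1 - t i)%:~R - j%:R * v).

(** The empty chain loses nothing, hence the convention for [k = 0]: there is no passage from a time
    to itself, since passages start one unit later. *)
Definition chain_bad k (S : R) : set (config R) :=
  if k is 0 then [set _ | S < 0]
  else ~` gd S0 (t 0%N) (z 0%N) (t k) (z k) (mu * (t k - t 0%N)%:~R - S * v).

Variables (h : nat -> R) (B : nat) (lam : R).
Hypothesis block_tailh : forall i j, (i < K)%N -> Pr (block_bad i j) <= h j.
Hypothesis lam0 : 0 <= lam.

(** An upper bound for the moment generating function at [lam] of the block loss, rounded up and
    truncated at [B], in the form produced by Abel summation. *)
Let M : R := 1 + \sum_(m < B) h m * (expR (lam * m.+1%:R) - expR (lam * m%:R)).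

Let ev_block i j : ev (block_bad i j).
Proof. by apply: sigC; exact: ev_gd. Qed.

Let ev_chain k S : ev (chain_bad k S).
Proof.
case: k => [|k] /=; last by apply: sigC; exact: ev_gd.
have [|] := boolP (S < 0) => _.
  by rewrite (_ : [set _ | _] = setT); [exact: sigT|apply/seteqP; split].
by rewrite (_ : [set _ | _] = set0); [exact: sig0|apply/seteqP; split].
Qed.

Let block_badS i j : block_bad i j.+1 `<=` block_bad i j.
Proof.
move=> f nf g; apply: nf; apply: passes_le g.
by rewrite lerD2l lerN2 ler_wpM2r // ler_nat.
Qed.

(** The level sets of the rounded loss of block [k]; their probabilities are differences of
    consecutive tails. *)
Let level k m : set (config R) :=
  (if m is m'.+1 then block_bad k m' else setT) `\` block_bad k m.

Let ev_level k m : ev (level k m).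
Proof. by apply: sigD => //; case: m => [|m] //; exact: sigT. Qed.

Let pr_level k m : Pr (level k m) =
  (if m is m'.+1 then Pr (block_bad k m') else 1) - Pr (block_bad k m).
Proof.
rewrite /level pr_setD //; last by case: m => [|m].
  by case: m => [|m] //; rewrite pr_setT.
by case: m => [|m] //; exact: sigT.
Qed.

Lemma chain_join k S m f : (k < K)%N -> ~ block_bad k m f ->
  ~ chain_bad k (S - m%:R) f -> ~ chain_bad k.+1 S f.
Proof.
move=> kK gm gk bad; have {}gm : gd S0 (t k) (z k) (t k.+1) (z k.+1)
    (mu * (t k.+1 - t k)%:~R - m%:R * v) f.
  move: gm => /contrapT; apply: passes_sub => w [].
  by rewrite /pt /= => b1 b2 b3 b4; apply: S0P => //; clear -b1 b2 b3 b4; lia.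
case: k kK bad gm gk => [|k] kK bad gm /= gk.
  apply: bad; apply: passes_le gm.
  by rewrite lerD2l lerN2 ler_wpM2r // -subr_ge0 leNgt; apply/negP.
apply: gk => gk; apply: bad.
(* The joint lies on the antidiagonal [2 t + 1], which [S0P] assigns to the later block; this is why
   the range there begins one antidiagonal before the passage itself. *)
have Sj : S0 (t k.+1 - z k.+1, t k.+1 + z k.+1 + 1).
  have tt : t k.+1 + 1 <= t k.+2.
    case: gm => g [/directed_path_le + _ _]; rewrite /pt /=; clear; lia.
  by apply: (S0P kK) => /=; [clear; lia|clear -tt; lia|rewrite /strip /=; clear -W1; lia].
have := gd_cat _ gk gm => /(_ _).
rewrite Sj => /(_ isT); congr (gd _ _ _ _ _ _ f).
by rewrite !intrB; ring.
Qed.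

Lemma chain_bad_union k : (k <= K)%N ->
  chain_bad k k%:R `<=` [set f | exists2 i, (i < k)%N & block_bad i 1 f].
Proof.
elim: k => [|k IH] kK f; first by rewrite /= ltxx.
move=> bad; have [|g1] := pselect (block_bad k 1 f); first by exists k.
have [gk|gk] := pselect (chain_bad k k%:R f).
  by have [i ik bi] := IH (ltnW kK) _ gk; exists i => //; exact: ltnW.
case: (@chain_join k k.+1%:R 1 f kK g1) => //.
by rewrite -natr1 addrK.
Qed.

Let chain_step k S : (k < K)%N -> chain_bad k.+1 S `<=`
  block_bad k B `|` [set f | exists2 m, (m < B.+1)%N & (level k m `&` chain_bad k (S - m%:R)) f].
Proof.
move=> kK f bad.
have [|gB] := pselect (block_bad k B f); [by left|right].
have ex : exists m, ~~ `[< block_bad k m f >] by exists B; apply/asboolPn.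
have [m /asboolPn gm mmin] := ex_minnP ex.
exists m; first by rewrite ltnS; apply: mmin; apply/asboolPn.
split; last by apply: contrapT => gk; exact: chain_join gk bad.
split => //; case: m mmin {gm} => // m mmin.
by apply: contrapT => /asboolPn /mmin; rewrite ltnn.
Qed.

(** Chernoff's bound by induction on [k]. If the last block has rounded loss [m], the earlier chain
    must lose more than [S - m], an event independent of that block. The term [k h B] pays for
    blocks whose loss exceeds the truncation. *)
Lemma pr_chain_bad k S : (k <= K)%N ->
  Pr (chain_bad k S) <= k%:R * h B + expR (- (lam * S)) * M ^+ k.
Proof.
elim: k S => [|k IH] S kK.
  rewrite mul0r add0r expr0 mulr1.
  have [S0'|S0'] := ltP S 0.
    apply: le_trans (pr_le1 L (ev_chain 0 S)) _.
    by rewrite -[leLHS]expR0 ler_expR oppr_ge0 mulr_ge0_le0 // ltW.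
  rewrite (_ : chain_bad 0 S = set0) ?pr_set0 ?expR_ge0 //.
  by apply/seteqP; split => // f /=; rewrite ltNge S0'.
have h0 : 0 <= h B by apply: le_trans (block_tailh B kK); exact: pr_ge0.
have M0 : 0 <= M.
  rewrite addr_ge0 // sumr_ge0 // => m _; rewrite mulr_ge0 //.
    by apply: le_trans (block_tailh m kK); exact: pr_ge0.
  by rewrite subr_ge0 ler_expR ler_wpM2l // ler_nat.
apply: le_trans (pr_le L _ _ (chain_step kK)) _ => //.
  by apply: sigU => //; apply: sig_ex => m _; apply: sigI.
rewrite -natr1 mulrDl mul1r -addrA [_ + (h B + _)]addrCA.
apply: pr_setU_le => //; first by apply: sig_ex => m _; apply: sigI.
  exact: block_tailh.
pose q m := Pr (block_bad k m); pose p m := if m is m'.+1 then q m' else 1.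
pose E m := level k m `&` chain_bad k (S - m%:R).
have evE m : (m < B.+1)%N -> ev (E m) by move=> _; apply: sigI.
apply: le_trans (@pr_ex _ L B.+1 E (fun m => Pr (E m)) evE (fun m _ => lexx _)) _.
rewrite /E.
have Eq m : Pr (level k m `&` chain_bad k (S - m%:R)) =
    (p m - p m.+1) * Pr (chain_bad k (S - m%:R)).
  rewrite -pr_level.
  apply: (@pr_indep _ L [set w | t k + 1 - z k <= w.1] [set w | w.1 <= t k - z k]).
  - by apply/seteqP; split => // w [] /=; clear; lia.
  - have sb j : sig [set w : site | t k + 1 - z k <= w.1] (block_bad k j).
      apply: sigC; apply: sig_passes => w; rewrite /between /pt /= => -[]; clear; lia.
    by apply: sigD => //; case: m => [|m] //; exact: sigT.
  - case: (k) => [|k'] /=.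
      have [|] := boolP (S - m%:R < 0) => _.
        have -> : [set _ : config R | is_true true] = setT by apply/seteqP; split.
        exact: sigT.
      have -> : [set _ : config R | is_true false] = set0 by apply/seteqP; split.
      exact: sig0.
    apply: sigC; apply: sig_passes => w; rewrite /between /pt /= => -[]; clear; lia.
under eq_bigr do rewrite Eq.
have pmono m : 0 <= p m - p m.+1.
  by rewrite -pr_level pr_ge0.
apply: le_trans (_ : \sum_(m < B.+1) (p m - p m.+1) *
    (k%:R * h B + expR (- (lam * S)) * M ^+ k * expR (lam * m%:R)) <= _).
  apply: ler_sum => m _; rewrite ler_wpM2l //.
  apply: le_trans (IH (S - m%:R) (ltnW kK)) _; rewrite lerD2l mulrAC -expRD.
  by rewrite ler_wpM2r ?exprn_ge0 // ler_expR; lra.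
have eD : \sum_(m < B.+1) (p m - p m.+1) <= 1.
  have := sum_by_parts p (fun=> 1) B.
  under eq_bigr do rewrite mulr1.
  move=> ->; rewrite big1 => [|m _]; last by rewrite subrr mulr0.
  by rewrite addr0 !mulr1 /= lerBlDr lerDl pr_ge0.
have eM : \sum_(m < B.+1) (p m - p m.+1) * expR (lam * m%:R) <= M.
  rewrite (sum_by_parts p (fun m => expR (lam * m%:R))) /= mulr0 expR0 mul1r.
  rewrite lerBlDr -addrA lerD2l ler_wpDr ?mulr_ge0 ?pr_ge0 ?expR_ge0 //.
  apply: ler_sum => m _; rewrite ler_wpM2r //; last exact: block_tailh.
  by rewrite subr_ge0 ler_expR ler_wpM2l // ler_nat.
under eq_bigr do rewrite mulrDr [X in _ + X]mulrCA.
rewrite big_split -mulr_suml -mulr_sumr exprSr [_ * (_ * M)]mulrA lerD //.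
  by rewrite -[leRHS]mul1r ler_wpM2r // mulr_ge0.
by rewrite ler_wpM2l // mulr_ge0 ?expR_ge0 ?exprn_ge0.
Qed.

(** For [lam <= 1] one has [expR lam - 1 <= lam * expR 1], hence [M <= expR (lam * (expR 1 * H))]. A
    budget of [expR 1 * H] per block cancels [M], and the extra unit leaves the factor
    [expR (- lam)] per block. *)
Lemma chain_tail H : lam <= 1 -> \sum_(m < B) h m * expR (lam * m%:R) <= H ->
  Pr (chain_bad K ((expR 1 * H + 1) * K%:R)) <= K%:R * h B + expR (- (lam * K%:R)).
Proof.
move=> lam1 hH; apply: le_trans (pr_chain_bad _ (leqnn K)) _; rewrite lerD2l.
case: (posnP K) => [->|K0].
  by rewrite !mulr0 expr0 mulr1.
have h0 m : 0 <= h m by apply: le_trans (block_tailh m K0); exact: pr_ge0.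
have M0 : 0 <= M.
  rewrite addr_ge0 // sumr_ge0 // => m _; rewrite mulr_ge0 //.
  by rewrite subr_ge0 ler_expR ler_wpM2l // ler_nat.
have el : expR lam - 1 <= lam * expR 1.
  have h1 : 1 - lam <= expR (- lam) by exact: expR_ge1Dx.
  have h2 : expR lam * (1 - lam) <= 1.
    by rewrite -[leRHS](expR0 R) -(subrr lam) expRD ler_wpM2l // expR_ge0.
  have h3 : lam * expR lam <= lam * expR 1 by rewrite ler_wpM2l // ler_expR.
  rewrite mulrBr mulr1 [_ * lam]mulrC in h2; lra.
have MH : M <= expR (lam * (expR 1 * H)).
  apply: le_trans (expR_ge1Dx _); rewrite lerD2l.
  apply: le_trans (_ : \sum_(m < B) (h m * expR (lam * m%:R)) * (lam * expR 1) <= _).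
    apply: ler_sum => m _; rewrite -mulrA ler_wpM2l //.
    rewrite -natr1 mulrDr mulr1 expRD -[X in _ - X]mulr1 -mulrBr ler_wpM2l ?expR_ge0 //.
  rewrite -mulr_suml [leRHS]mulrA mulrC ler_wpM2l // mulr_ge0 // expR_ge0.
have : M ^+ K <= expR (lam * (expR 1 * H)) ^+ K by rewrite ler_pXn2r ?nnegrE ?expR_ge0.
rewrite -expRM_natl => hM.
apply: (le_trans (ler_wpM2l (expR_ge0 _) hM)).
by rewrite -expRD ler_expR; lra.
Qed.

End Chain.

(** * Fixed strip width *)

(* Rounded linear interpolation from 0 to [a] in [K] steps. *)
Definition interp (a : int) (K i : nat) : int := ((i%:Z * a) %/ K%:Z)%Z.

Lemma interp_itv a K i : (0 < K)%N ->
  interp a K i * K%:Z <= i%:Z * a /\ i%:Z * a < interp a K i * K%:Z + K%:Z.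
Proof.
move=> K0; rewrite /interp; set b := i%:Z * a.
have E := divz_eq b K%:Z.
have r0 : 0 <= (b %% K%:Z)%Z by apply: modz_ge0; lia.
have r1 : (b %% K%:Z)%Z < K%:Z by apply: ltz_pmod; lia.
by clear -E r0 r1; lia.
Qed.

Lemma interp0 a K : interp a K 0 = 0.
Proof. by rewrite /interp mul0r div0z. Qed.

Lemma interpK a K : (0 < K)%N -> interp a K K = a.
Proof. by move=> K0; rewrite /interp mulrC mulzK //; lia. Qed.

Lemma interp_step a K i : (0 < K)%N ->
  a - K%:Z < (interp a K i.+1 - interp a K i) * K%:Z < a + K%:Z.
Proof.
move=> K0; have [] := interp_itv a i K0; have [] := interp_itv a i.+1 K0.
rewrite mulrBl (_ : i.+1%:Z = i%:Z + 1) ?mulrDl ?mul1r; last lia.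
by move: (interp a K i.+1 * _) (interp a K i * _) (i%:Z * a) => p q r; clear; lia.
Qed.

Lemma interp_le a K i : (0 < K)%N -> (i <= K)%N -> `|interp a K i| <= `|a|.
Proof.
move=> K0 iK; have [h1 h2] := interp_itv a i K0.
have hi : i%:Z * a <= K%:Z * `|a|.
  apply: le_trans (_ : i%:Z * `|a| <= _); first by rewrite ler_wpM2l ?ler_norm.
  by rewrite ler_wpM2r //; lia.
have hi' : - (K%:Z * `|a|) <= i%:Z * a.
  have : i%:Z * - a <= K%:Z * `|a|; last by rewrite mulrN lerNl.
  apply: le_trans (_ : i%:Z * `|a| <= _).
    by rewrite ler_wpM2l // -normrN ler_norm.
  by rewrite ler_wpM2r //; lia.
have K0' : 0 < K%:Z by lia.
rewrite ler_norml; apply/andP; split.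
  rewrite -ltzD1 -(ltr_pM2r K0') mulNr mulrDl mul1r mulrC.
  by apply: le_lt_trans hi' _.
by rewrite -(ler_pM2r K0'); apply: (le_trans h1); rewrite [leRHS]mulrC.
Qed.

(** * Polynomial tail from a union bound over about sqrt(x) blocks *)

Section PolynomialTail.
Variable R : realType.

(** For an integer [N >= k / a], [(c x^a / N)^N <= expR (c x^a)], and the left side already
    dominates a multiple of [x^k]. *)
Lemma expR_stretch_le (a c : R) (k : nat) : 0 < a -> 0 < c ->
  exists2 C, 0 < C & forall x : R, 1 <= x -> expR (- (c * x `^ a)) <= C / x ^+ k.
Proof.
move=> a0 c0; have [N hN] := exists_nat_ge (k%:R / a + 1).
have N0 : 0 < N%:R :> R.
  by apply: lt_le_trans hN; rewrite ltr_wpDl // divr_ge0 // ltW.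
exists ((N%:R / c) ^+ N); first by rewrite exprn_gt0 // divr_gt0.
move=> x x1; have x0 : 0 < x by exact: lt_le_trans x1.
have xa0 : 0 < x `^ a by exact: powR_gt0.
have xk : x ^+ k <= (x `^ a) ^+ N.
  rewrite -powR_mulrn ?(ltW x0) // -[leRHS]powR_mulrn ?powR_ge0 // -powRrM.
  apply: ler_powR => //.
  have : k%:R / a <= N%:R by apply: le_trans hN; rewrite lerDl.
  by rewrite ler_pdivrMr // mulrC.
have h1 : (c * x `^ a / N%:R) ^+ N <= expR (c * x `^ a).
  have -> : expR (c * x `^ a) = expR (c * x `^ a / N%:R) ^+ N.
    by rewrite -expRM_natl [in RHS]mulrC divfK // gt_eqF.
  have p0 : 0 <= c * x `^ a / N%:R by rewrite divr_ge0 ?mulr_ge0 ?ltW.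
  rewrite ler_pXn2r ?nnegrE ?expR_ge0 //.
    by apply: le_trans (expR_ge1Dx _); rewrite lerDr.
  by move: N0; rewrite ltr0n.
have P0 : 0 < (c * x `^ a / N%:R) ^+ N by rewrite exprn_gt0 // divr_gt0 // mulr_gt0.
rewrite expRN; apply: (@le_trans _ _ ((c * x `^ a / N%:R) ^- N)).
  by rewrite lef_pV2 ?posrE ?expR_gt0.
have -> : (c * x `^ a / N%:R) ^- N = (N%:R / c) ^+ N / (x `^ a) ^+ N.
  by rewrite -!exprVn -exprMn !invfM invrK; congr (_ ^+ _); ring.
rewrite ler_wpM2l ?exprn_ge0 ?divr_ge0 ?(ltW c0) //.
by rewrite lef_pV2 ?posrE ?exprn_gt0.
Qed.

Section Block.
Variables (u x y d c e dl K : R).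
Hypotheses (u0 : 0 < u) (y3 : y ^+ 3 = x) (c3 : c ^+ 3 = d) (y0 : 0 < y) (c0 : 0 <= c).
Hypotheses (K32 : 32 <= K) (Kx : K ^+ 2 <= x) (xK : x <= 2 * K ^+ 2).
Hypotheses (eK : e * K = u ^+ 3) (e2 : 2 <= e) (de : e - 1 <= d) (de' : d <= e + 1).
Hypotheses (dl0 : 0 < dl) (xdl : x <= dl * u ^+ 2).

Let d1 : e / 2 <= d. Proof. by move: e2 de; lra. Qed.
Let d2 : d <= 2 * e. Proof. by move: e2 de'; lra. Qed.
Let e0 : 0 < e. Proof. by move: e2; lra. Qed.
Let d0 : 0 <= d. Proof. by move: d1 e0; lra. Qed.
Let e20 : 0 <= e / 2. Proof. by move: e0; lra. Qed.
Let K0 : 0 < K. Proof. by move: K32; lra. Qed.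
Let x0 : 0 < x. Proof. by rewrite -y3 exprn_gt0. Qed.

(** Here [u] is n^(1/3), [x u] the total deficit, [e = n / K] the ideal and [d = c^3] the rounded
    block length. As [K ~ sqrt x] and [c ~ u / K^(1/3)], the share [x u / K] of one block is of
    order [x^(2/3) c = y^2 c]. *)
Lemma block_deficit : y ^+ 2 / 2 * c <= x * u / K.
Proof.
apply: cube_le; first by rewrite divr_ge0 ?mulr_ge0 ?(ltW dl0) ?(ltW x0) ?(ltW u0) ?(ltW K0) ?(ltW e0) ?(ltW y0).
have -> : (y ^+ 2 / 2 * c) ^+ 3 = x ^+ 2 / 8 * d by rewrite -y3 -c3; field.
have -> : (x * u / K) ^+ 3 = x ^+ 3 * e / K ^+ 2.
  have -> : (x * u / K) ^+ 3 = x ^+ 3 * u ^+ 3 / K ^+ 3 by field; rewrite gt_eqF.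
  by rewrite -eK; field; rewrite gt_eqF.
rewrite ler_pdivlMr ?exprn_gt0 //.
apply: le_trans (_ : x ^+ 2 / 8 * (2 * e) * x <= _).
  have x80 : 0 <= x ^+ 2 / 8 by rewrite divr_ge0 ?sqr_ge0.
  by apply: ler_pM; [exact: mulr_ge0|exact: sqr_ge0|exact: ler_wpM2l|].
have : 0 <= x ^+ 3 * e by rewrite mulr_ge0 ?exprn_ge0 ?(ltW dl0) ?(ltW x0) ?(ltW u0) ?(ltW K0) ?(ltW e0) ?(ltW y0).
rewrite (_ : x ^+ 2 / 8 * (2 * e) * x = x ^+ 3 * e / 4); last by field.
lra.
Qed.

Lemma block_level : y ^+ 2 / 2 <= dl * c ^+ 2.
Proof.
apply: cube_le; first by rewrite mulr_ge0 ?exprn_ge0 ?(ltW dl0) ?(ltW x0) ?(ltW u0) ?(ltW K0) ?(ltW e0) ?(ltW y0).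
have -> : (y ^+ 2 / 2) ^+ 3 = x ^+ 2 / 8 by rewrite -y3; field.
have -> : (dl * c ^+ 2) ^+ 3 = dl ^+ 3 * d ^+ 2 by rewrite -c3; ring.
apply: le_trans (_ : dl ^+ 3 * (e / 2) ^+ 2 <= _); last first.
  by rewrite ler_wpM2l ?exprn_ge0 ?(ltW dl0) ?(ltW x0) ?(ltW u0) ?(ltW K0) ?(ltW e0) ?(ltW y0) // ler_pXn2r ?nnegrE ?d0 ?e20 //.
have h1 : x ^+ 3 <= dl ^+ 3 * (e ^+ 2 * x).
  apply: le_trans (_ : (dl * u ^+ 2) ^+ 3 <= _).
    by rewrite ler_pXn2r ?nnegrE ?mulr_ge0 ?exprn_ge0 ?(ltW dl0) ?(ltW x0) ?(ltW u0) ?(ltW K0) ?(ltW e0) ?(ltW y0).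
  rewrite exprMn ler_wpM2l ?exprn_ge0 ?(ltW dl0) ?(ltW x0) ?(ltW u0) ?(ltW K0) ?(ltW e0) ?(ltW y0) //.
  rewrite (_ : (u ^+ 2) ^+ 3 = e ^+ 2 * K ^+ 2); last by rewrite -exprM mulnC exprM -eK exprMn.
  by rewrite ler_wpM2l ?exprn_ge0 ?(ltW dl0) ?(ltW x0) ?(ltW u0) ?(ltW K0) ?(ltW e0) ?(ltW y0).
have h2 : x ^+ 2 * x <= dl ^+ 3 * e ^+ 2 * x by rewrite -exprSr -mulrA.
rewrite ler_pM2r // in h2.
have : 0 <= x ^+ 2 by exact: sqr_ge0.
rewrite expr_div_n; lra.
Qed.

(** The cube of [2 u^2 / K] is [8 e^2 / K], which is at most [(e / 2)^2] once [K >= 32]; the added 1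
    is the rounding of the interpolation. *)
Lemma block_offset : K <= u ^+ 2 -> u ^+ 2 / K + 1 <= c ^+ 2.
Proof.
move=> Ku.
apply: le_trans (_ : 2 * u ^+ 2 / K <= _).
  by rewrite mulrDl mul1r mulrDl lerD2l ler_pdivlMr // mul1r.
apply: cube_le; first by rewrite exprn_ge0.
have -> : (2 * u ^+ 2 / K) ^+ 3 = 8 * (u ^+ 3) ^+ 2 / K ^+ 3 by field; rewrite gt_eqF.
rewrite -eK -exprM mulnC exprM c3.
apply: le_trans (_ : (e / 2) ^+ 2 <= _); last first.
  by rewrite ler_pXn2r ?nnegrE ?d0 ?e20 //.
rewrite ler_pdivrMr ?exprn_gt0 // exprMn.
have : e ^+ 2 * K ^+ 2 * 32 <= e ^+ 2 * K ^+ 2 * K.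
  by rewrite ler_wpM2l // mulr_ge0 ?sqr_ge0.
rewrite expr_div_n [K ^+ 3]exprSr; lra.
Qed.

(** The reason for [K ~ sqrt x]: a deficit of order [y^2] at block scale calls for a strip of width
    [y c^2], and this is of order [u^2] whatever [x] is. *)
Lemma block_width : y * c ^+ 2 <= 3 * u ^+ 2.
Proof.
apply: cube_le; first by rewrite mulr_ge0 ?exprn_ge0 ?(ltW dl0) ?(ltW x0) ?(ltW u0) ?(ltW K0) ?(ltW e0) ?(ltW y0).
have -> : (y * c ^+ 2) ^+ 3 = x * d ^+ 2 by rewrite -y3 -c3; ring.
have -> : (3 * u ^+ 2) ^+ 3 = 27 * (e ^+ 2 * K ^+ 2).
  by rewrite -exprMn eK; ring.
apply: le_trans (_ : (2 * K ^+ 2) * (2 * e) ^+ 2 <= _).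
  apply: ler_pM; rewrite ?sqr_ge0 ?(ltW x0) //.
  by rewrite ler_pXn2r ?nnegrE ?d0 // mulr_ge0 // (ltW e0).
have : 0 <= e ^+ 2 * K ^+ 2 by rewrite mulr_ge0 ?sqr_ge0.
rewrite exprMn; lra.
Qed.

End Block.
End PolynomialTail.

Local Notation ev := (sig setT).

Lemma pr_bad_shift (R : realType) (L : field_law R) c W s a t b (x : R) :
  pr L (~` gd (strip c W) s a t b x) = pr L (~` gd (strip (c - a) W) 0 0 (t - s) (b - a) x).
Proof. by rewrite (pr_setC L (ev_gd _ _ _ _ _ _)) pr_gd_strip (pr_setC L (ev_gd _ _ _ _ _ _)). Qed.

Lemma pr_bad_le (R : realType) (L : field_law R) (S S' : pred site) (s a t b : int) (x x' : R) : (forall w, S' w -> S w) -> x <= x' ->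
  pr L (~` gd S s a t b x) <= pr L (~` gd S' s a t b x').
Proof.
move=> SS xx; apply: pr_le; try (by apply: sigC; exact: ev_gd).
move=> f nf g; apply: nf; apply: (passes_le xx).
by apply: passes_sub g => w _; exact: SS.
Qed.

Lemma pr_bad0 (R : realType) (L : field_law R) c W s a t b (x : R) : `|b - a| <= t - s - 1 -> `|a - c| <= W - 1 ->
  `|b - c| <= W - 1 -> x <= 0 -> pr L (~` gd (strip c W) s a t b x) = 0.
Proof.
move=> h1 h2 h3 h4; rewrite (_ : ~` _ = set0) ?pr_set0 //.
by apply/seteqP; split => // f nf; apply: nf; exact: gd_exists.
Qed.

Lemma interp_stepR (R : realType) (a : int) (K i : nat) : (0 < K)%N ->
  a%:~R - K%:R < (interp a K i.+1 - interp a K i)%:~R * K%:R :> R /\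
  (interp a K i.+1 - interp a K i)%:~R * K%:R < a%:~R + K%:R :> R.
Proof.
move=> K0; have /andP[h1 h2] := interp_step a i K0.
rewrite -(@ltr_int R) in h1; rewrite -(@ltr_int R) in h2.
split; first by rewrite intrB intrM in h1; exact: h1.
by rewrite intrD intrM in h2; exact: h2.
Qed.

Definition block_bound (R : realType) (L : field_law R) (mu al c C1 dl th1 : R) (n1 : nat) :=
  forall (n : nat) (z W : int) (th : R),
  (n1 <= n)%N -> `|z|%:~R <= cb (R:=R) n%:R ^+ 2 ->
  th1 <= th -> th <= dl * cb n%:R ^+ 2 -> C1 * Num.sqrt th * cb n%:R ^+ 2 <= W%:~R ->
  pr L (~` gd (strip 0 W) 0 0 n z (mu * n%:R - th * cb n%:R)) <= 9 * expR (- (c * th `^ al)).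

Lemma block_in_chain (R : realType) (L : field_law R) (mu al c C1 dl th1 : R)
    (n1 n K : nat) (z Wb : int) (x u : R) i :
  0 < C1 -> 0 < dl -> 1 <= th1 -> block_bound L mu al c C1 dl th1 n1 -> u = cb n%:R ->
  (32 <= K)%N -> K%:R ^+ 2 <= x -> x <= 2 * K%:R ^+ 2 -> (2 * th1) ^+ 3 <= x ->
  K%:R <= u -> n1%:R + 2 <= u -> x <= dl * u ^+ 2 ->
  `|z|%:~R <= u ^+ 2 -> 3 * C1 * u ^+ 2 <= Wb%:~R -> (i < K)%N ->
  pr L (block_bad mu (x * u / K%:R) (interp n K) (interp z K) Wb i 1) <=
  9 * expR (- (c * (cb x ^+ 2 / 2) `^ al)).
Proof.
move=> C10 dl0 th11 block uE K32 Kx xK thx Ku nu xdl zu hWb iK.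
set t := interp n K; set zz := interp z K.
have K0 : (0 < K)%N by exact: leq_trans K32.
have KR0 : 0 < K%:R :> R by rewrite ltr0n.
have KR32 : 32 <= K%:R :> R by rewrite (ler_nat R 32).
have u0 : 0 < u by exact: lt_le_trans Ku.
have x0 : 0 < x by apply: lt_le_trans Kx; rewrite exprn_gt0.
pose y := cb x.
have y3 : y ^+ 3 = x by rewrite /y cb3 // ltW.
have y0 : 0 < y by exact: cb_gt0.
have yth : 2 * th1 <= y by apply: cube_le; rewrite ?(ltW y0) // y3.
have un : u ^+ 3 = n%:R by rewrite uE cb3.
pose e := u ^+ 3 / K%:R.
have eK : e * K%:R = u ^+ 3 by rewrite /e divfK // gt_eqF.
have ue : u ^+ 2 <= e by rewrite /e ler_pdivlMr // [u ^+ 3]exprSr ler_wpM2l // sqr_ge0.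
have n10 : 0 <= n1%:R :> R by [].
have u2 : u * 2 <= u ^+ 2 by rewrite expr2 ler_wpM2l ?(ltW u0) //; clear -nu n10; lra.
have e2 : 2 <= e by clear -ue u2 nu n10; lra.
have [st1 st2] : t i.+1 - t i > 0 /\ `|(t i.+1 - t i)%:~R - e| <= 1.
  have [] := @interp_stepR R n K i K0; rewrite -/t -[n%:~R]/n%:R => h1R h2R.
  have g1 : e - 1 <= (t i.+1 - t i)%:~R.
    by rewrite -(ler_pM2r KR0) mulrBl eK mul1r un ltW.
  have g2 : (t i.+1 - t i)%:~R <= e + 1.
    by rewrite -(ler_pM2r KR0) mulrDl eK mul1r un ltW.
  split; last by rewrite ler_norml; apply/andP; split; move: g1 g2; clear; lra.
  by rewrite -(@ltr_int R); apply: lt_le_trans g1; clear -e2; lra.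
have [m mE] : exists m : nat, t i.+1 - t i = m%:Z.
  by exists (absz (t i.+1 - t i)%R); clear -st1; lia.
rewrite /block_bad -/t -/zz pr_bad_shift subrr mE -pmulrn.
rewrite mE -pmulrn ler_norml in st2; move/andP: st2 => [de de'].
pose q := cb (R:=R) m%:R.
have q0 : 0 <= q by exact: cb_ge0.
have q3 : q ^+ 3 = m%:R by rewrite /q cb3.
have de1 : e - 1 <= m%:R by clear -de; lra.
have de2 : m%:R <= e + 1 by clear -de'; lra.
have Ku2 : K%:R <= u ^+ 2 by apply: le_trans Ku _; clear -u2 u0; lra.
have H1 : y ^+ 2 / 2 * q <= x * u / K%:R by apply: (@block_deficit R u x y m%:R q e).
have H2 : y ^+ 2 / 2 <= dl * q ^+ 2 by apply: (@block_level R u x y m%:R q e dl K%:R).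
have H3 : u ^+ 2 / K%:R + 1 <= q ^+ 2 by apply: (@block_offset R u m%:R q e).
have H4 : y * q ^+ 2 <= 3 * u ^+ 2 by apply: (@block_width R u x y m%:R q e K%:R).
have th_1 : 1 <= y ^+ 2 / 2.
  have : 2 * 1 <= y * y by apply: ler_pM => //; clear -yth th11; lra.
  by rewrite -expr2; clear; lra.
apply: (le_trans _ (block m (zz i.+1 - zz i) Wb (y ^+ 2 / 2) _ _ _ _ _)).
- by apply: pr_bad_le => //; rewrite mul1r lerD2l lerN2.
- rewrite -(ler_nat R); clear -de1 ue u2 nu n10; lra.
- apply: le_trans H3; rewrite intr_norm.
  have [] := @interp_stepR R z K i K0; rewrite -/zz => h1R h2R.
  have Eu : u ^+ 2 / K%:R * K%:R = u ^+ 2 by rewrite divfK // gt_eqF.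
  rewrite intr_norm ler_norml in zu; move/andP: zu => [zu1 zu2].
  rewrite ler_norml; apply/andP; split; rewrite -(ler_pM2r KR0) ?mulNr mulrDl Eu mul1r.
    clear -h1R zu1; lra.
  clear -h2R zu2; lra.
- have : 2 * y <= y * y by rewrite ler_pM2r //; clear -yth th11; lra.
  rewrite -expr2; clear -yth th11; lra.
- exact: H2.
- apply: le_trans hWb.
  have sy : Num.sqrt (y ^+ 2 / 2) <= y.
    rewrite -[leRHS](ger0_norm (ltW y0)) -sqrtr_sqr; apply: ler_wsqrtr.
    have := sqr_ge0 y; clear; lra.
  apply: (@le_trans _ _ (C1 * (y * q ^+ 2))).
    by rewrite -mulrA ler_pM2l // ler_wpM2r ?sqr_ge0.
  by rewrite [leRHS](_ : _ = C1 * (3 * u ^+ 2)) ?ler_pM2l //; ring.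
Qed.

Lemma polynomial_tail_mid (R : realType) (L : field_law R) (mu al c C1 dl th1 : R) (n1 : nat) :
  0 < al -> 0 < c -> 0 < C1 -> 0 < dl -> 1 <= th1 -> block_bound L mu al c C1 dl th1 n1 ->
  exists2 C2, 0 < C2 & forall (n : nat) (z W : int) (x u : R),
    u = cb n%:R -> n1%:R + 2 <= u -> (2 * th1) ^+ 3 <= x -> 1156 <= x ->
    x <= dl * u ^+ 2 -> x <= u ^+ 2 ->
    `|z|%:~R <= u ^+ 2 -> (3 * C1 + 3) * u ^+ 2 <= W%:~R ->
    pr L (~` gd (strip 0 W) 0 0 n z (mu * n%:R - x * u)) <= C2 / (x + 1) ^+ 4.
Proof.
move=> al0 c0 C10 dl0 th11 block.
(* The ninth power of [y^2 / 2] is [x^6 / 512]. The union bound over [K <= x] blocks leaves [x^5],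
   enough for the fourth power claimed. *)
have [C C0 hC] := expR_stretch_le 9 al0 c0.
exists (9 * 512 * 16 * C); first by clear -C0; lra.
move=> n z W x u uE nu thx x1156 xdl xu zu hW.
have x0 : 0 < x by clear -x1156; lra.
have n10 : 0 <= n1%:R :> R by [].
have u0 : 0 < u by clear -nu n10; lra.
have [K /andP[K1 K2]] := exists_floor (sqrtr_ge0 x).
have s2 : Num.sqrt x ^+ 2 = x by rewrite sqr_sqrtr // ltW.
(* 1156 = 34^2, so [K >= 33], which gives both [K >= 32] and [(K + 1)^2 <= 2 K^2]. *)
have s34 : 34 <= Num.sqrt x.
  rewrite -(@ler_pXn2r _ 2) ?nnegrE ?sqrtr_ge0 // s2.
  by apply: le_trans x1156; clear; lra.
have K33 : 33 <= K%:R :> R by clear -K2 s34; lra.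
have K32 : (32 <= K)%N by rewrite -(ler_nat R); clear -K33; lra.
have Kx : K%:R ^+ 2 <= x by rewrite -s2 ler_pXn2r ?nnegrE ?sqrtr_ge0.
have xK : x <= 2 * K%:R ^+ 2.
  apply: (@le_trans _ _ ((K%:R + 1) ^+ 2)).
    by rewrite -s2 ler_pXn2r ?nnegrE ?sqrtr_ge0 ?addr_ge0 // ltW.
  have : 33 * K%:R <= K%:R ^+ 2 :> R by rewrite expr2 ler_wpM2r.
  by rewrite sqrrD1; clear -K33; lra.
have Ku : K%:R <= u.
  by rewrite -(@ler_pXn2r _ 2) ?nnegrE ?(ltW u0) // (le_trans Kx).
have K0 : (0 < K)%N by exact: leq_trans K32.
have KR0 : 0 < K%:R :> R by rewrite ltr0n.
have [Wb /andP[Wb1 Wb2]] : exists k : nat, 3 * C1 * u ^+ 2 <= k%:R < 3 * C1 * u ^+ 2 + 1.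
  by apply: exists_ceil; rewrite !mulr_ge0 ?sqr_ge0 // ltW.
have u21 : 4 <= u ^+ 2 by apply: le_trans xu; clear -x1156; lra.
have hWb (w : int) : `|w| <= `|z| -> `|w| + Wb%:Z <= W.
  move=> wz; apply: (@le_trans _ _ (`|z| + Wb%:Z)); first by rewrite lerD2r.
  rewrite -(@ler_int R) intrD; apply: le_trans hW; rewrite -[Wb%:~R]/(Wb%:R).
  by clear -zu Wb2 u21; lra.
have Wb_1 : 1 <= Wb%:Z.
  have : 0 < Wb%:R :> R by apply: lt_le_trans Wb1; rewrite !mulr_gt0 // exprn_gt0.
  by rewrite ltr0n.
pose t := interp n K; pose zz := interp z K; pose v := x * u / K%:R.
have v0 : 0 <= v by rewrite divr_ge0 ?mulr_ge0 ?(ltW x0) ?(ltW u0).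
have S0P i (w : site) : (i < K)%N -> 2 * t i + 1 <= w.1 + w.2 ->
    w.1 + w.2 <= 2 * t i.+1 -> strip (zz i) Wb w -> strip 0 W w.
  move=> iK _ _; have := hWb _ (interp_le z K0 (ltnW iK)); rewrite -/zz /strip.
  by clear; lia.
have chE : ~` gd (strip 0 W) 0 0 n z (mu * n%:R - x * u) = chain_bad mu v t zz (strip 0 W) K K%:R.
  have vK : K%:R * v = x * u by rewrite /v mulrC divfK // gt_eqF.
  rewrite -vK -[in RHS](prednK K0) /chain_bad (prednK K0).
  by rewrite /t /zz !interp0 !interpK // subr0.
rewrite chE; apply: (le_trans (pr_le L _ _ (chain_bad_union v0 Wb_1 S0P (leqnn K)))).
- by rewrite -chE; apply: sigC; exact: ev_gd.
- by apply: sig_ex => i _; apply: sigC; exact: ev_gd.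
pose E := 9 * expR (- (c * (cb x ^+ 2 / 2) `^ al)).
apply: (@le_trans _ _ (\sum_(i < K) E)).
  apply: (@pr_ex _ L K (block_bad mu v t zz Wb ^~ 1%N) (fun=> E)) => i iK.
    by apply: sigC; exact: ev_gd.
  by apply: (block_in_chain C10 dl0 th11 block uE).
rewrite sumr_const card_ord -[E *+ K]mulr_natl.
have y3 : cb x ^+ 3 = x by rewrite cb3 // ltW.
have y2 : 2 <= cb x.
  apply: cube_le; first exact: cb_ge0.
  by rewrite y3; apply: le_trans x1156; clear; lra.
have th_1 : 1 <= cb x ^+ 2 / 2.
  have : 2 * 2 <= cb x * cb x by apply: ler_pM.
  by rewrite -expr2; clear; lra.
have hE : E <= 9 * (512 * C / x ^+ 6).
  rewrite ler_pM2l //; apply: (le_trans (hC _ th_1)).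
  have -> : (cb x ^+ 2 / 2) ^+ 9 = x ^+ 6 / 512.
    have -> : (cb x ^+ 2 / 2) ^+ 9 = (cb x ^+ 3) ^+ 6 / 512 by field.
    by rewrite y3.
  by rewrite invf_div mulrA [C * _]mulrC.
have Kxx : K%:R <= x.
  by apply: le_trans Kx; rewrite expr2 ler_peMl // (le_trans _ K33) // ler1n.
apply: (@le_trans _ _ (x * (9 * (512 * C / x ^+ 6)))).
  by apply: ler_pM => //; rewrite mulr_ge0 // expR_ge0.
have -> : x * (9 * (512 * C / x ^+ 6)) = 9 * 512 * C / x ^+ 5 by field; rewrite gt_eqF.
rewrite ler_pdivlMr ?exprn_gt0 ?addr_gt0 // mulrAC ler_pdivrMr ?exprn_gt0 //.
have h16 : (x + 1) ^+ 4 <= 16 * x ^+ 4.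
  rewrite (_ : 16 * x ^+ 4 = (2 * x) ^+ 4); last by ring.
  by rewrite ler_pXn2r ?nnegrE ?mulr_ge0 ?addr_ge0 ?(ltW x0) //; clear -x1156; lra.
have h45 : x ^+ 4 <= x ^+ 5.
  by rewrite [x ^+ 5]exprS ler_peMl ?exprn_ge0 ?(ltW x0) //; clear -x1156; lra.
rewrite (_ : 9 * 512 * 16 * C * x ^+ 5 = 9 * 512 * C * (16 * x ^+ 5)); last by ring.
have D0 : 0 <= 9 * 512 * C by clear -C0; lra.
move: (9 * 512 * C) D0 => D D0.
by rewrite ler_wpM2l //; apply: (le_trans h16); clear -h45; lra.
Qed.

(** Deficits outside the middle range: small ones are covered by the constant, those above [mu n]
    cost nothing as weights are nonnegative, and those between [d1 u^2] and [mu u^2] (in units of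
    [u]) follow by monotonicity from [d1 u^2], at the price of the ratio [q]. *)
Lemma polynomial_tail (R : realType) (L : field_law R) (mu al c C1 dl th1 : R) (n1 : nat) :
  0 < al -> 0 < c -> 0 < C1 -> 0 < dl -> 1 <= th1 -> block_bound L mu al c C1 dl th1 n1 ->
  exists Lw C2 : R, exists n2 : nat, [/\ 1 <= Lw, 0 < C2, (1 < n2)%N &
    forall (n : nat) (z W : int) (m : nat), (n2 <= n)%N -> `|z|%:~R <= cb (R:=R) n%:R ^+ 2 ->
    Lw * cb n%:R ^+ 2 <= W%:~R ->
    pr L (~` gd (strip 0 W) 0 0 n z (mu * n%:R - m%:R * cb n%:R)) <= C2 / (m%:R + 1) ^+ 4].
Proof.
move=> al0 c0 C10 dl0 th11 block.
have [C C0 hC] := polynomial_tail_mid al0 c0 C10 dl0 th11 block.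
pose d1 := Num.min dl 1.
have d10 : 0 < d1 by rewrite lt_min dl0 ltr01.
have d1dl : d1 <= dl by rewrite ge_min lexx.
have d11 : d1 <= 1 by rewrite ge_min lexx orbT.
pose m1 := Num.max mu 1.
have m11 : 1 <= m1 by rewrite le_max lexx orbT.
have mum1 : mu <= m1 by rewrite le_max lexx.
pose x1 := Num.max ((2 * th1) ^+ 3) 1156.
have x11 : 1156 <= x1 by rewrite le_max lexx orbT.
have x1th : (2 * th1) ^+ 3 <= x1 by rewrite le_max lexx.
pose q := m1 / d1.
have q1 : 1 <= q by rewrite ler_pdivlMr // mul1r (le_trans d11).
have qd : q * d1 = m1 by rewrite divfK // gt_eqF.
pose C2 := (x1 + 1) ^+ 4 + C * q ^+ 4.
have Cq0 : 0 <= C * q ^+ 4.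
  by rewrite mulr_ge0 ?(ltW C0) // exprn_ge0 // (le_trans _ q1).
have x10 : 0 <= (x1 + 1) ^+ 4 by rewrite exprn_ge0 //; clear -x11; lra.
have hub : exists n2 : nat, [/\ (1 < n2)%N & n1%:R + 2 + x1 / d1 <= cb n2%:R :> R].
  have [n2 hn2] := exists_nat_ge ((n1%:R + 2 + x1 / d1 : R) ^+ 3).
  exists n2.+2; split => //; apply: cube_le; first exact: cb_ge0.
  by rewrite cb3 //; apply: (le_trans hn2); rewrite ler_nat (leqW (leqnSn n2)).
have [n2 [n21 hn2]] := hub.
exists (3 * C1 + 3), C2, n2; split => //.
- by clear -C10; lra.
- by apply: ltr_pwDl => //; rewrite exprn_gt0 //; clear -x11; lra.
move=> n z W m nn2 zn hW.
pose x : R := m%:R; pose u := cb (R:=R) n%:R.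
rewrite -/x -/u; rewrite -/u in zn; rewrite -/u in hW.
have x0 : 0 <= x by [].
have hu : n1%:R + 2 + x1 / d1 <= u by apply: (le_trans hn2); apply: cb_le => //; rewrite ler_nat.
have xd0 : 0 <= x1 / d1 by rewrite divr_ge0 ?(ltW d10) //; clear -x11; lra.
have n10 : 0 <= n1%:R :> R by [].
have u2 : 2 <= u by clear -hu xd0 n10; lra.
have un1 : n1%:R + 2 <= u by clear -hu xd0 n10; lra.
have u0 : 0 < u by clear -u2; lra.
have un : u ^+ 3 = n%:R by rewrite /u cb3.
have uu : u <= u ^+ 2 by rewrite expr2 ler_peMl ?(ltW u0) //; clear -u2; lra.
have xdu : x1 <= d1 * u ^+ 2.
  have : x1 / d1 <= u ^+ 2 by clear -hu uu n10; lra.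
  by rewrite ler_pdivrMr // mulrC.
have xp : 0 < (x + 1) ^+ 4 by rewrite exprn_gt0 //; clear -x0; lra.
have evb y : sig setT (~` gd (strip 0 W) 0 0 n z y : set (config R)).
  by apply: sigC; exact: ev_gd.
have [xx1|xx1] := leP x x1.
  apply: (le_trans (pr_le1 L (evb _))); rewrite ler_pdivlMr // mul1r.
  have : (x + 1) ^+ 4 <= (x1 + 1) ^+ 4 by rewrite ler_pXn2r ?nnegrE //; clear -x0 xx1; lra.
  by rewrite /C2; clear -Cq0; lra.
have mid y : x1 <= y -> y <= d1 * u ^+ 2 ->
    pr L (~` gd (strip 0 W) 0 0 n z (mu * n%:R - y * u)) <= C / (y + 1) ^+ 4.
  move=> y1 y2; apply: hC => //.
  - exact: le_trans y1.
  - exact: le_trans y1.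
  - by apply: (le_trans y2); rewrite ler_pM2r // exprn_gt0.
  - by apply: (le_trans y2); rewrite ler_piMl // sqr_ge0.
have [xd|xd] := leP x (d1 * u ^+ 2).
  apply: (le_trans (mid _ (ltW xx1) xd)); rewrite ler_wpM2r ?invr_ge0 ?(ltW xp) //.
  rewrite /C2; have : C * 1 <= C * q ^+ 4 by rewrite ler_pM2l // exprn_ege1.
  by clear -x10; lra.
have [xmu|xmu] := leP (mu * n%:R) (x * u).
  rewrite pr_bad0 ?subr_le0 //.
  - rewrite divr_ge0 ?(ltW xp) // addr_ge0 //.
  - rewrite -(@ler_int R) !subr0 intrB -[n%:~R]/(n%:R : R); apply: (le_trans zn).
    rewrite -un; have : 2 * u ^+ 2 <= u ^+ 3 by rewrite [u ^+ 3]exprS ler_wpM2r // sqr_ge0.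
    have : 2 * 2 <= u * u by apply: ler_pM.
    by rewrite -expr2; clear; lra.
  - rewrite subrr normr0 -(@ler_int R) intrB; move: hW.
    have : 3 * u ^+ 2 <= (3 * C1 + 3) * u ^+ 2.
      by rewrite ler_wpM2r ?sqr_ge0 //; clear -C10; lra.
    by clear -u2 uu; lra.
  - rewrite subr0 -(@ler_int R) intrB; move: hW.
    have : 3 * u ^+ 2 <= (3 * C1 + 3) * u ^+ 2.
      by rewrite ler_wpM2r ?sqr_ge0 //; clear -C10; lra.
    by clear -u2 uu zn; lra.
apply: (@le_trans _ _ (pr L (~` gd (strip 0 W) 0 0 n z (mu * n%:R - d1 * u ^+ 2 * u)))).
  by apply: pr_bad_le => //; rewrite lerD2l lerN2 ler_wpM2r // ltW.
apply: (le_trans (mid _ xdu (lexx _))).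
have xm : x <= m1 * u ^+ 2.
  have : x * u <= m1 * u ^+ 2 * u.
    by apply: (le_trans (ltW xmu)); rewrite -un -mulrA -exprSr ler_wpM2r // exprn_ge0 // ltW.
  by rewrite ler_pM2r.
have x1q : x + 1 <= q * (d1 * u ^+ 2 + 1) by rewrite mulrDr mulrA qd mulr1 lerD.
have dp : 0 < d1 * u ^+ 2 + 1 by rewrite ltr_wpDl // mulr_ge0 ?sqr_ge0 // ltW.
rewrite ler_pdivrMr ?exprn_gt0 // mulrAC ler_pdivlMr //.
have h4 : (x + 1) ^+ 4 <= q ^+ 4 * (d1 * u ^+ 2 + 1) ^+ 4.
  rewrite -exprMn ler_pXn2r ?nnegrE // ?addr_ge0 // mulr_ge0 ?(ltW dp) //.
  by clear -q1; lra.
apply: (@le_trans _ _ (C * (q ^+ 4 * (d1 * u ^+ 2 + 1) ^+ 4))).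
  by rewrite ler_wpM2l // ltW.
rewrite mulrA ler_wpM2r ?exprn_ge0 ?(ltW dp) // /C2 lerDr //.
Qed.

(** * From the tail of one block to the tail of a chain *)

Definition fixed_tail (R : realType) (L : field_law R) (mu Lw : R) (n0 : nat) (h : nat -> R) :=
  forall (n : nat) (z W : int) (m : nat), (n0 <= n)%N -> `|z|%:~R <= cb (R:=R) n%:R ^+ 2 ->
    Lw * cb n%:R ^+ 2 <= W%:~R ->
    pr L (~` gd (strip 0 W) 0 0 n z (mu * n%:R - m%:R * cb n%:R)) <= h m.

Definition admissible_chain (R : realType) (Lw : R) (n0 : nat) (v : R) (t z : nat -> int)
    (W : int) (K : nat) (S0 : pred site) :=
  [/\ 0 <= v, 1 <= W,
    forall i (w : site), (i < K)%N -> 2 * t i + 1 <= w.1 + w.2 ->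
      w.1 + w.2 <= 2 * t i.+1 -> strip (z i) W w -> S0 w &
    forall i, (i < K)%N -> exists m : nat, [/\ t i.+1 - t i = m%:Z, (n0 <= m)%N,
      `|z i.+1 - z i|%:~R <= cb (R:=R) m%:R ^+ 2, Lw * cb m%:R ^+ 2 <= W%:~R &
      cb m%:R <= v]].

(** [phi K] is the rate at which one chain of [K] blocks loses more than [C2] units per block. The
    two coarse grainings differ only in [phi] and in the spread of the strips. *)
Definition chain_bound (R : realType) (L : field_law R) (mu Lw C2 : R) (n0 K0 : nat)
    (phi : nat -> R) :=
  forall v t z W K S0, (K0 <= K)%N -> admissible_chain Lw n0 v t z W K S0 ->
  pr L (chain_bad mu v t z S0 K (C2 * K%:R)) <= expR (- phi K).

Lemma fixed_tail_chain (R : realType) (L : field_law R) (mu Lw : R) (n0 : nat) (h : nat -> R)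
    v t z W K S0 B (lam H : R) : fixed_tail L mu Lw n0 h ->
  admissible_chain Lw n0 v t z W K S0 -> 0 <= lam -> lam <= 1 ->
  \sum_(m < B) h m * expR (lam * m%:R) <= H ->
  pr L (chain_bad mu v t z S0 K ((expR 1 * H + 1) * K%:R)) <=
  K%:R * h B + expR (- (lam * K%:R)).
Proof.
move=> ht [v0 W1 S0P adm] lam0 lam1 hH.
apply: (chain_tail v0 W1 S0P (B := B)) => // i j iK.
have [m [tm nm zm Wm vm]] := adm i iK.
rewrite /block_bad pr_bad_shift subrr tm.
apply: (le_trans _ (ht m _ W j nm zm Wm)).
by apply: pr_bad_le => //; rewrite lerD2l lerN2 ler_wpM2l.
Qed.

Lemma sum_inv_pow4_le (R : realType) B :
  \sum_(m < B) ((m%:R + 1 : R) ^+ 4)^-1 <= 3 - 2 / (B%:R + 1).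
Proof.
elim: B => [|B IH]; first by rewrite big_ord0 add0r divr1; lra.
rewrite big_ord_recr /=; apply: (le_trans (lerD IH (lexx _))).
set b : R := B%:R + 1; have b1 : 1 <= b by rewrite lerDr.
have b0 : 0 < b by clear -b1; lra.
rewrite -[B.+1%:R]natr1 -/b -addrA lerD2l.
have b10 : 0 < b + 1 by clear -b0; lra.
have e1 : 2 / b - 2 / (b + 1) = 2 / (b * (b + 1)) by field; rewrite !gt_eqF.
have e2 : (b ^+ 4)^-1 <= 2 / (b * (b + 1)).
  rewrite ler_pdivlMr ?mulr_gt0 // mulrC ler_pdivrMr ?exprn_gt0 //.
  have h1 : b <= b ^+ 4 by rewrite [b ^+ 4]exprS ler_peMr ?(ltW b0) // exprn_ege1.
  have h2 : b ^+ 2 <= b ^+ 4 by rewrite (exprD b 2 2) ler_peMr ?sqr_ge0 // exprn_ege1.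
  by rewrite mulrDr mulr1 -expr2; clear -h1 h2; lra.
clear -e1 e2; lra.
Qed.

(** Truncation at [B ~ sqrt K] with [lam = 1 / B] keeps the exponential weights below [expR 1], so
    [H] is a convergent sum. Thanks to the fourth power [K h(B) <= C / K], and
    [expR (- K / B) <= expR (- B)]; each is at most 1/4. *)
Lemma chain_bound_poly (R : realType) (L : field_law R) (mu Lw C : R) (n0 : nat) : 0 < C ->
  fixed_tail L mu Lw n0 (fun m => C / (m%:R + 1) ^+ 4) ->
  exists C2 : R, exists K0, 0 < C2 /\ chain_bound L mu Lw C2 n0 K0 (fun=> ln 2).
Proof.
move=> C0 ht; pose H := expR 1 * (3 * C).
have H0 : 0 <= H by rewrite mulr_ge0 ?expR_ge0 // mulr_ge0 // ltW.
have [k hk] := exists_nat_ge (4 * C).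
exists (expR 1 * H + 1), (maxn k 16); split.
  by rewrite ltr_pwDr // mulr_ge0 ?expR_ge0.
move=> v t z W K S0; rewrite geq_max => /andP[kK K16] adm.
have [B /andP[B1 B2]] := exists_floor (sqrtr_ge0 (K%:R : R)).
have s2 : Num.sqrt (K%:R : R) ^+ 2 = K%:R by rewrite sqr_sqrtr.
have K16R : 16 <= K%:R :> R by rewrite (ler_nat R 16).
have s4 : 4 <= Num.sqrt K%:R :> R.
  by rewrite -(@ler_pXn2r _ 2) ?nnegrE ?sqrtr_ge0 // s2 (le_trans _ K16R) //; lra.
have B3 : 3 <= B%:R :> R by clear -s4 B2; lra.
have B0 : 0 < B%:R :> R by clear -B3; lra.
have BK : B%:R ^+ 2 <= K%:R :> R by rewrite -s2 ler_pXn2r ?nnegrE ?sqrtr_ge0 // ltW.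
have KB : K%:R <= (B%:R + 1) ^+ 2 :> R.
  by rewrite -s2 ler_pXn2r ?nnegrE ?sqrtr_ge0 ?addr_ge0 // ltW.
have KR0 : 0 < K%:R :> R by clear -K16R; lra.
have := @fixed_tail_chain _ _ _ _ _ _ v t z W K S0 B B%:R^-1 H ht adm.
move=> /(_ _ _ _) hb; apply: (le_trans (hb _ _ _)).
- by rewrite invr_ge0 ltW.
- by rewrite invf_le1 // (le_trans _ B3) // ler1n.
- apply: (@le_trans _ _ (\sum_(m < B) (expR 1 * C) * ((m%:R + 1) ^+ 4)^-1)).
    apply: ler_sum => m _; rewrite [leLHS]mulrC -[leRHS]mulrA; apply: ler_wpM2r.
      by rewrite mulr_ge0 ?(ltW C0) // invr_ge0 exprn_ge0 // addr_ge0.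
    by rewrite ler_expR mulrC ler_pdivrMr // mul1r ler_nat ltnW.
  rewrite -mulr_sumr /H -mulrA ler_wpM2l ?expR_ge0 // [3 * C]mulrC ler_pM2l //.
  apply: (le_trans (sum_inv_pow4_le R B)); rewrite lerBlDr lerDl divr_ge0 // addr_ge0 //.
- rewrite [leRHS]expRN lnK ?posrE //.
  have h1 : K%:R * (C / (B%:R + 1) ^+ 4) <= 4^-1.
    rewrite mulrA ler_pdivrMr ?exprn_gt0 ?ltr_pwDl //.
    have e1 : K%:R * K%:R <= (B%:R + 1) ^+ 4 :> R.
      by rewrite (_ : (B%:R + 1) ^+ 4 = (B%:R + 1) ^+ 2 * (B%:R + 1) ^+ 2) ?ler_pM //; ring.
    have e2 : K%:R * (4 * C) <= K%:R * K%:R.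
      by rewrite ler_pM2l // (le_trans hk) // ler_nat.
    clear -e1 e2; lra.
  have h2 : expR (- (B%:R^-1 * K%:R)) <= 4^-1 :> R.
    rewrite expRN lef_pV2 ?posrE ?expR_gt0 //.
    apply: le_trans (expR_ge1Dx _).
    have : B%:R <= B%:R^-1 * K%:R :> R by rewrite mulrC ler_pdivlMr // -expr2.
    clear -B3; lra.
  clear -h1 h2; lra.
Qed.

(** With [lam = c / 2], half the decay rate, [H] is a geometric series. Truncating at [B = K] costs
    [K C expR (- c K)]; lowering the rate from [c / 2] to [c / 4] absorbs the prefactors. *)
Lemma chain_bound_exp (R : realType) (L : field_law R) (mu Lw C c : R) (n0 : nat) :
  0 < C -> 0 < c -> c <= 1 -> fixed_tail L mu Lw n0 (fun m => C * expR (- (c * m%:R))) ->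
  exists C2 : R, exists K0, 0 < C2 /\ chain_bound L mu Lw C2 n0 K0 (fun K => c / 4 * K%:R).
Proof.
move=> C0 c0 c1 ht; pose q : R := expR (- (c / 2)).
have c20 : 0 < c / 2 by rewrite divr_gt0.
have q1 : q < 1 by rewrite -[ltRHS](expR0 R) ltr_expR oppr_lt0.
have q0 : 0 < 1 - q by rewrite subr_gt0.
pose H := C / (1 - q).
have H0 : 0 <= H by rewrite divr_ge0 // ltW.
have [K0 hK0] := exists_nat_ge (8 * C / c ^+ 2).
exists (expR 1 * H + 1), K0.+1; split.
  by rewrite ltr_pwDr // mulr_ge0 ?expR_ge0.
move=> v t z W K S0 KK adm.
have c2 : c / 2 <= 1 by clear -c1; lra.
apply: (le_trans (fixed_tail_chain (B := K) (lam := c / 2) ht adm (ltW c20) c2 (H := H) _)).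
  apply: (@le_trans _ _ (C * \sum_(m < K) q ^+ m)).
    rewrite mulr_sumr; apply: ler_sum => m _.
    rewrite -mulrA ler_wpM2l ?(ltW C0) // -expRD /q -expRM_natl ler_expR.
    by clear; lra.
  rewrite /H ler_pM2l // -[leRHS]mul1r ler_pdivlMr // mulrC.
  have -> : (1 - q) * \sum_(m < K) q ^+ m = 1 - q ^+ K.
    by rewrite -[RHS](opprB) subrX1 -mulNr opprB.
  by rewrite lerBlDr lerDl exprn_ge0 // expR_ge0.
have KR : 0 < K%:R :> R by rewrite ltr0n; exact: leq_trans KK.
set x := c * K%:R.
have x0 : 0 < x by rewrite mulr_gt0.
have -> : c / 2 * K%:R = x / 2 by rewrite /x; clear; lra.
have -> : c / 4 * K%:R = x / 4 by rewrite /x; clear; lra.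
have e1 : x / 2 * expR (- (x / 2)) <= 1.
  rewrite expRN ler_pdivrMr ?expR_gt0 // mul1r.
  by apply: (le_trans _ (expR_ge1Dx _)); rewrite lerDr.
have hKc : K%:R = x / c by rewrite /x mulrC mulKf // gt_eqF.
have e2 : 2 * C / c + 1 <= expR (x / 4).
  apply: (le_trans _ (expR_ge1Dx _)); rewrite addrC lerD2l.
  have h : 8 * C / c ^+ 2 <= K%:R by rewrite (le_trans hK0) // ler_nat ltnW.
  have : c / 4 * (8 * C / c ^+ 2) <= c / 4 * K%:R by rewrite ler_wpM2l // divr_ge0 // ltW.
  have -> : c / 4 * (8 * C / c ^+ 2) = 2 * C / c by field; rewrite gt_eqF.
  by rewrite /x; clear; lra.
have e3 : K%:R * (C * expR (- x)) <= 2 * C / c * expR (- (x / 2)).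
  have -> : - x = - (x / 2) + - (x / 2) by clear; lra.
  rewrite expRD hKc.
  have -> : x / c * (C * (expR (- (x / 2)) * expR (- (x / 2)))) =
      2 * C / c * (x / 2 * expR (- (x / 2))) * expR (- (x / 2)).
    by field; rewrite gt_eqF.
  rewrite ler_wpM2r ?expR_ge0 // -[leRHS]mulr1 ler_wpM2l //.
  by rewrite divr_ge0 ?mulr_ge0 // ltW.
apply: (@le_trans _ _ ((2 * C / c + 1) * expR (- (x / 2)))).
  by rewrite mulrDl mul1r lerD2r.
apply: (@le_trans _ _ (expR (x / 4) * expR (- (x / 2)))).
  by rewrite ler_wpM2r ?expR_ge0.
by rewrite -expRD ler_expR; clear -x0; lra.
Qed.

(** * Many parallel strips *)

(** Neighbouring regions have centres [2 Wb + 1] apart, just more than the width [2 Wb], which makes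
    them disjoint. Each slab begins at [2 * t i + 1] to contain the joint before block [i]. *)
Definition strip_region (t zb : nat -> int) (Wb : int) (K j : nat) : pred site :=
  fun w => [exists i : 'I_K, [&& 2 * t i + 1 <= w.1 + w.2, w.1 + w.2 <= 2 * t i.+1 &
    strip (zb i + (2 * Wb + 1) * j%:Z) Wb w]].

Lemma nondecreasing_upto (t : nat -> int) (K : nat) : (forall i, (i < K)%N -> t i < t i.+1) ->
  forall i j, (i <= j)%N -> (j <= K)%N -> t i <= t j.
Proof.
move=> ht i; elim=> [|j IH]; first by rewrite leqn0 => /eqP ->.
rewrite leq_eqVlt => /predU1P[->//|ij] jK.
by apply: (le_trans (IH ij (ltnW jK))); rewrite ltW // ht.
Qed.

Lemma strip_region_disjoint t zb Wb K i j : (forall i, (i < K)%N -> t i < t i.+1) -> 1 <= Wb ->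
  (i < j)%N -> [set w | strip_region t zb Wb K i w] `&` [set w | strip_region t zb Wb K j w] = set0.
Proof.
move=> ht W1 ij; apply/seteqP; split => // w [] /=.
move=> /existsP[k /and3P[a1 a2 a3]] /existsP[l /and3P[b1 b2 b3]].
have kl : k = l :> nat.
  case: (ltngtP k l) => // kl.
    have := nondecreasing_upto ht kl (ltnW (ltn_ord l)).
    by clear -a2 b1; lia.
  have := nondecreasing_upto ht kl (ltnW (ltn_ord k)).
  by clear -b2 a1; lia.
rewrite /strip kl in a3; rewrite /strip in b3.
have : (2 * Wb + 1) * i%:Z + (2 * Wb + 1) <= (2 * Wb + 1) * j%:Z.
  have -> : (2 * Wb + 1) * i%:Z + (2 * Wb + 1) = (2 * Wb + 1) * i.+1%:Z.
    by rewrite (_ : i.+1%:Z = i%:Z + 1) ?mulrDr ?mulr1 //; clear; lia.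
  by rewrite ler_wpM2l ?lez_nat //; clear -W1; lia.
move: a3 b3; move: (_ * i%:Z) (_ * j%:Z) => p q; clear -W1; lia.
Qed.

(* The first strip with a good chain is chosen independently of the weights before time
   [t 0] and after time [t K], so joining it to the two endpoints costs only one failure
   probability [q] at each end, with no union bound over the strips. *)
Lemma strips_bound (R : realType) (L : field_law R) (mu : R) (t zb : nat -> int) (K J : nat)
    (r z W Wb : int) (v S x x1 pS q : R) :
  let D j := (2 * Wb + 1) * j%:Z in
  (0 < K)%N -> (forall i, (i < K)%N -> t i < t i.+1) -> 1 <= Wb ->
  (forall i j, (i <= K)%N -> (j < J)%N -> `|zb i + D j| + Wb <= W) -> 0 <= q ->
  (forall j, (j < J)%N ->
    pr L (chain_bad mu v t (fun i => zb i + D j) (strip_region t zb Wb K j) K S) <= pS) ->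
  (forall j, (j < J)%N -> pr L (~` gd (strip 0 W) 0 0 (t 0%N) (zb 0%N + D j) x1) <= q) ->
  (forall j, (j < J)%N -> pr L (~` gd (strip 0 W) (t K) (zb K + D j) r z x1) <= q) ->
  x <= x1 + (mu * (t K - t 0%N)%:~R - S * v) + x1 ->
  pr L (~` gd (strip 0 W) 0 0 r z x) <= pS ^+ J + (q + q).
Proof.
move=> D K0 ht Wb1 hW q0 hB h1 h2 hx.
have chE j : chain_bad mu v t (fun i => zb i + D j) (strip_region t zb Wb K j) K S =
    ~` gd (strip_region t zb Wb K j) (t 0%N) (zb 0%N + D j) (t K) (zb K + D j)
      (mu * (t K - t 0%N)%:~R - S * v).
  by move: K0; rewrite /chain_bad; case: (K).
pose G j : set (config R) := gd (strip_region t zb Wb K j) (t 0%N) (zb 0%N + D j) (t K) (zb K + D j)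
      (mu * (t K - t 0%N)%:~R - S * v).
pose E1 j : set (config R) := ~` gd (strip 0 W) 0 0 (t 0%N) (zb 0%N + D j) x1.
pose E2 j : set (config R) := ~` gd (strip 0 W) (t K) (zb K + D j) r z x1.
have evG j : ev (G j) by exact: ev_gd.
have evE1 j : ev (E1 j) by apply: sigC; exact: ev_gd.
have evE2 j : ev (E2 j) by apply: sigC; exact: ev_gd.
pose B0 : set (config R) := [set f | forall j, (j < J)%N -> (~` G j) f].
pose B1 : set (config R) := [set f | exists2 j, (j < J)%N & first_of G j f /\ E1 j f].
pose B2 : set (config R) := [set f | exists2 j, (j < J)%N & first_of G j f /\ E2 j f].
have sub : ~` gd (strip 0 W) 0 0 r z x `<=` B0 `|` (B1 `|` B2).
  move=> f nf; have [|nB] := pselect (B0 f); [by left|right].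
  have [j jJ Gj] : exists2 j, (j < J)%N & G j f.
    apply: contrapT => h; apply: nB => j jJ Gj; apply: h; by exists j.
  have [{Gj}k kJ fk] : exists2 k, (k < J)%N & first_of G k f by apply: ex_first_of; exists j.
  have [e1|g1] := pselect (E1 k f); first by left; exists k.
  have [e2|g2] := pselect (E2 k f); first by right; exists k.
  exfalso; apply: nf.
  move: g1 => /contrapT g1; move: g2 => /contrapT g2; have Gk : G k f by case: fk.
  have {Gk}Gk : gd (strip 0 W) (t 0%N) (zb 0%N + D k) (t K) (zb K + D k)
      (mu * (t K - t 0%N)%:~R - S * v) f.
    apply: passes_sub Gk => w _ /existsP[i /and3P[_ _]].
    have := hW i k (ltnW (ltn_ord i)) kJ; rewrite /strip /D.
    by move: (_ * k%:Z) => p; clear; lia.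
  have j0 : strip 0 W (t 0%N - (zb 0%N + D k), t 0%N + (zb 0%N + D k) + 1).
    have := hW 0%N k (leq0n _) kJ; rewrite /strip /=.
    by move: (D k) => p; clear -Wb1; lia.
  have jK : strip 0 W (t K - (zb K + D k), t K + (zb K + D k) + 1).
    have := hW K k (leqnn _) kJ; rewrite /strip /=.
    by move: (D k) => p; clear -Wb1; lia.
  apply: (passes_le hx); apply: gd_cat g2; first by rewrite jK.
  by apply: gd_cat g1 Gk; rewrite j0.
have evB0 : ev B0.
  have -> : B0 = ~` [set f | exists2 j, (j < J)%N & G j f].
    apply/seteqP; split => f /=; first by move=> h [j jJ]; exact: h.
    by move=> h j jJ Gj; apply: h; exists j.
  by apply: sigC; apply: sig_ex.
have evf E : (forall j, ev (E j)) ->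
    ev [set f | exists2 j, (j < J)%N & first_of G j f /\ E j f].
  move=> hE; apply: (@sig_ex _ _ J (fun j => first_of G j `&` E j)) => j _.
  by apply: sigI => //; apply: sig_first_of.
apply: (le_trans (pr_le L _ _ sub)).
- by apply: sigC; exact: ev_gd.
- by apply: sigU => //; apply: sigU; apply: evf.
have tmono := nondecreasing_upto ht.
have sigG j : sig [set w : site | 2 * t 0%N + 2 <= w.1 + w.2 /\ w.1 + w.2 <= 2 * t K] (G j).
  apply: sig_passes => w [] /=; rewrite /pt /= => b1 b2 b3 b4 _.
  by clear -b1 b2 b3 b4; split; lia.
have sigf j : sig [set w : site | 2 * t 0%N + 2 <= w.1 + w.2 /\ w.1 + w.2 <= 2 * t K] (first_of G j).
  by apply: sig_first_of.
apply: pr_setU_le => //; [by apply: sigU; apply: evf| |apply: pr_setU_le; try exact: evf].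
- apply: (@pr_all _ L J (fun j => ~` G j) (fun j => [set w | strip_region t zb Wb K j w])).
  + by move=> i j ij _; exact: strip_region_disjoint.
  + by move=> j _; apply: sigC; apply: sig_passes.
  + by move=> j jJ; have := hB j jJ; rewrite chE.
- apply: (@pr_first_of_le _ L J G E1 q) => // j jJ.
  apply: (@pr_indep _ L _ [set w : site | w.1 + w.2 <= 2 * t 0%N] _ _ _ (sigf j)).
    by apply/seteqP; split => // w [] /= [b1 b2] b3; clear -b1 b2 b3; lia.
  apply: sigC; apply: sig_passes => w [] /=; rewrite /pt /= => b1 b2 b3 b4 _.
  by clear -b1 b2 b3 b4; lia.
- apply: (@pr_first_of_le _ L J G E2 q) => // j jJ.
  apply: (@pr_indep _ L _ [set w : site | 2 * t K + 2 <= w.1 + w.2] _ _ _ (sigf j)).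
    by apply/seteqP; split => // w [] /= [b1 b2] b3; clear -b1 b2 b3; lia.
  apply: sigC; apply: sig_passes => w [] /=; rewrite /pt /= => b1 b2 b3 b4 _.
  by clear -b1 b2 b3 b4; lia.
Qed.

(** * Scaling relations behind the choice of [K], [J] and [A] *)

Section StepArith.
Variable R : realType.
Implicit Types s u v w E K nb eps C A b m mu N : R.

(** Here [s = sqrt th], [u = r^(1/3)], and [E] is the block length, with [v^3 = 2 E]. By
    [K v ~ K^(2/3) u <= eps^(2/3) th u], a small [eps] keeps the loss of the chain below a third of
    the deficit. *)
Lemma step_deficit s u v E K nb eps C2 : 0 < s -> 0 < u -> 0 <= C2 -> 0 < K -> 0 < eps ->
  v ^+ 3 = 2 * E -> E * K = nb -> nb <= u ^+ 3 -> K <= eps * s ^+ 3 ->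
  54 * C2 ^+ 3 * eps ^+ 2 <= 1 -> 3 * (C2 * K * v) <= s ^+ 2 * u.
Proof.
move=> s0 u0 C20 K0 eps0 v3 EK nbu Ks he.
apply: cube_le; first by rewrite mulr_ge0 ?exprn_ge0 // ltW.
have -> : (3 * (C2 * K * v)) ^+ 3 = 27 * C2 ^+ 3 * K ^+ 3 * v ^+ 3 by ring.
have -> : 27 * C2 ^+ 3 * K ^+ 3 * v ^+ 3 = 54 * C2 ^+ 3 * K ^+ 2 * nb.
  by rewrite v3 -EK; ring.
have -> : (s ^+ 2 * u) ^+ 3 = s ^+ 6 * u ^+ 3 by ring.
have h0 : 0 <= 54 * C2 ^+ 3 by rewrite mulr_ge0 ?exprn_ge0 // ler0n.
apply: (@le_trans _ _ (54 * C2 ^+ 3 * (eps * s ^+ 3) ^+ 2 * u ^+ 3)).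
  have h1 : K ^+ 2 <= (eps * s ^+ 3) ^+ 2.
    by rewrite ler_pXn2r ?nnegrE ?(ltW K0) // mulr_ge0 ?exprn_ge0 // ltW.
  apply: (@le_trans _ _ (54 * C2 ^+ 3 * K ^+ 2 * u ^+ 3)).
    by rewrite ler_wpM2l // mulr_ge0 ?sqr_ge0.
  by rewrite ler_wpM2r ?exprn_ge0 ?(ltW u0) // ler_wpM2l.
have -> : 54 * C2 ^+ 3 * (eps * s ^+ 3) ^+ 2 * u ^+ 3 =
    54 * C2 ^+ 3 * eps ^+ 2 * (s ^+ 6 * u ^+ 3) by ring.
by rewrite -[leRHS]mul1r ler_wpM2r // mulr_ge0 ?exprn_ge0 // ltW.
Qed.

(** A strip of width [(r/K)^(2/3)] with [K ~ th^(3/2)] has width of order [u^2 / th], so about [th]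
    of them fit side by side into [u^2]. *)
Lemma step_width s u v E K nb eps w0 : 0 < s -> 0 < u -> 0 < K -> 0 < eps -> 0 <= w0 ->
  0 <= E -> v ^+ 3 = 2 * E -> E * K = nb -> nb <= u ^+ 3 -> eps * s ^+ 3 / 2 <= K ->
  w0 ^+ 3 = 16 / eps ^+ 2 -> v ^+ 2 * s ^+ 2 <= w0 * u ^+ 2.
Proof.
move=> s0 u0 K0 eps0 w00 E0 v3 EK nbu sK w3.
apply: cube_le; first by rewrite mulr_ge0 ?sqr_ge0.
have -> : (v ^+ 2 * s ^+ 2) ^+ 3 = (v ^+ 3) ^+ 2 * s ^+ 6 by ring.
have -> : (w0 * u ^+ 2) ^+ 3 = w0 ^+ 3 * u ^+ 6 by ring.
rewrite v3 w3 [leRHS]mulrAC ler_pdivlMr ?exprn_gt0 //.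
have h : E * (eps * s ^+ 3 / 2) <= u ^+ 3.
  by apply: (le_trans _ nbu); rewrite -EK ler_wpM2l.
have : (E * (eps * s ^+ 3 / 2)) ^+ 2 <= (u ^+ 3) ^+ 2.
  rewrite ler_pXn2r ?nnegrE //; last by rewrite exprn_ge0 // ltW.
  by rewrite mulr_ge0 // divr_ge0 // mulr_ge0 ?exprn_ge0 // ltW.
have -> : (E * (eps * s ^+ 3 / 2)) ^+ 2 = ((2 * E) ^+ 2 * s ^+ 6 * eps ^+ 2) / 16 by field.
by rewrite -exprM; clear; lra.
Qed.

(** The bound [s <= mu1 * u] holds whenever the deficit is below [mu r]. It gives
    [K <= eps mu1^3 u^3], so blocks are long if [eps] is small. *)
Lemma step_size s u K E nb eps mu1 N : 0 < s -> 0 < u -> 0 < K -> 0 < eps -> 0 <= N ->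
  s <= mu1 * u -> K <= eps * s ^+ 3 -> eps * (2 * mu1 ^+ 3 * N) <= 1 ->
  E * K = nb -> u ^+ 3 / 2 <= nb -> N <= E.
Proof.
move=> s0 u0 K0 eps0 N0 su Ks he EK nbu.
rewrite -(ler_pM2r K0) EK; apply: (le_trans _ nbu).
have h1 : s ^+ 3 <= (mu1 * u) ^+ 3.
  by rewrite ler_pXn2r ?nnegrE ?(ltW s0) // (le_trans (ltW s0)).
have h2 : N * K <= N * (eps * (mu1 * u) ^+ 3).
  by rewrite ler_wpM2l // (le_trans Ks) // ler_wpM2l // ltW.
apply: (le_trans h2).
have -> : N * (eps * (mu1 * u) ^+ 3) = eps * (2 * mu1 ^+ 3 * N) * (u ^+ 3 / 2) by field.
by rewrite -[leRHS]mul1r ler_wpM2r // divr_ge0 // exprn_ge0 // ltW.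
Qed.

(** The constraint on [A]: the shift [2 A u^2 / K] per block stays below [m^(2/3) ~ (u^3 / K)^(2/3)]
    when [A^3] is small against [K]. The constant is 1024 = 4^3 * 16. *)
Lemma step_slope u b m E K nb A : 0 < u -> 0 <= b -> 0 < K -> 0 <= A ->
  b ^+ 3 = m -> E * K = nb -> u ^+ 3 / 2 <= nb -> 4 <= E -> E - 1 <= m ->
  1024 * A ^+ 3 <= K -> 2 * A * u ^+ 2 / K + 1 <= b ^+ 2.
Proof.
move=> u0 b0 K0 A0 b3 EK nbu E4 Em AK.
have m3 : 3 <= m by clear -E4 Em; lra.
have mE : E / 2 <= m by clear -E4 Em; lra.
have b2 : 2 <= b ^+ 2.
  apply: cube_le; first exact: sqr_ge0.
  rewrite (_ : (b ^+ 2) ^+ 3 = m ^+ 2); last by rewrite -b3; ring.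
  by apply: (@le_trans _ _ (3 ^+ 2)); [lra|rewrite ler_pXn2r ?nnegrE //; clear -m3; lra].
have h : 4 * A * u ^+ 2 / K <= b ^+ 2.
  apply: cube_le; first exact: sqr_ge0.
  rewrite (_ : (b ^+ 2) ^+ 3 = m ^+ 2); last by rewrite -b3; ring.
  apply: (@le_trans _ _ ((u ^+ 3 / (4 * K)) ^+ 2)); last first.
    have p1 : 0 <= u ^+ 3 / (4 * K).
      by rewrite divr_ge0 ?exprn_ge0 ?mulr_ge0 ?(ltW u0) ?(ltW K0).
    have p2 : 0 <= m by clear -m3; lra.
    rewrite ler_pXn2r ?nnegrE //.
    apply: (le_trans _ mE); rewrite ler_pdivrMr ?mulr_gt0 //.
    have -> : E / 2 * (4 * K) = 2 * (E * K) by field.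
    by rewrite EK; clear -nbu; lra.
  have -> : (4 * A * u ^+ 2 / K) ^+ 3 = 1024 * A ^+ 3 * (u ^+ 6 / (16 * K ^+ 3)).
    by field; rewrite gt_eqF.
  have -> : (u ^+ 3 / (4 * K)) ^+ 2 = K * (u ^+ 6 / (16 * K ^+ 3)).
    by field; rewrite gt_eqF.
  by rewrite ler_wpM2r // divr_ge0 ?exprn_ge0 ?mulr_ge0 ?exprn_ge0 // ltW.
have -> : 2 * A * u ^+ 2 / K = (4 * A * u ^+ 2 / K) / 2 by field; rewrite gt_eqF.
by move: (4 * A * u ^+ 2 / K) h => y h; clear -h b2; lra.
Qed.

End StepArith.

Lemma floor_half (R : realType) (x : R) : 2 <= x -> exists k : nat, k%:R <= x /\ x / 2 <= k%:R.
Proof.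
move=> x2; have [k /andP[k1 k2]] : exists k : nat, k%:R <= x < k%:R + 1.
  by apply: exists_floor; clear -x2; lra.
by exists k; split => //; clear -x2 k2; lra.
Qed.

Lemma chain_admissible (R : realType) (Lw u v E A : R) (n0 e nb K j : nat) (a0 b0 Wb : int) :
  let t i := e%:Z + interp nb K i in
  let zb i := a0 + interp b0 K i in
  (0 < K)%N -> 0 <= Lw -> 0 < u -> 0 <= A -> E * K%:R = nb%:R -> u ^+ 3 / 2 <= nb%:R ->
  n0%:R + 4 <= E -> 1024 * A ^+ 3 <= K%:R -> `|b0|%:~R <= 2 * A * u ^+ 2 ->
  v ^+ 3 = 2 * E -> 0 <= v -> Lw * v ^+ 2 <= Wb%:~R -> 1 <= Wb ->
  (forall i, (i < K)%N -> t i < t i.+1) /\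
  admissible_chain Lw n0 v t (fun i => zb i + (2 * Wb + 1) * j%:Z) Wb K (strip_region t zb Wb K j).
Proof.
move=> t zb K0 Lw0 u0 A0 EK nbu nE AK b0A v3 v0 hWb Wb1.
have KR0 : 0 < K%:R :> R by rewrite ltr0n.
have n00 : 0 <= n0%:R :> R by [].
have E4 : 4 <= E by clear -nE n00; lra.
have tstep i : exists m : nat, [/\ t i.+1 - t i = m%:Z, E - 1 <= m%:R & m%:R <= E + 1].
  have [h1 h2] := @interp_stepR R nb K i K0.
  have g1 : E - 1 <= (interp nb K i.+1 - interp nb K i)%:~R.
    by rewrite -(ler_pM2r KR0) mulrBl EK mul1r; exact: ltW h1.
  have g2 : (interp nb K i.+1 - interp nb K i)%:~R <= E + 1.
    by rewrite -(ler_pM2r KR0) mulrDl EK mul1r; exact: ltW h2.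
  have g0 : 0 <= interp nb K i.+1 - interp nb K i.
    by rewrite -(@ler_int R); apply: le_trans g1; clear -E4; lra.
  have tE : t i.+1 - t i = interp nb K i.+1 - interp nb K i by rewrite /t; clear; lia.
  have [m mE] : exists m : nat, interp nb K i.+1 - interp nb K i = m%:Z.
    by exists (absz (interp nb K i.+1 - interp nb K i)%R); clear -g0; lia.
  by exists m; rewrite tE mE; rewrite mE in g1 g2; split.
split.
  move=> i iK; have [m [tE m1 m2]] := tstep i.
  have : (0 < m)%N by rewrite -(ltr_nat R); clear -m1 E4; lra.
  by clear -tE; lia.
split => //.
  move=> i w iK w1 w2 sw; apply/existsP; exists (Ordinal iK).
  by apply/and3P; split.
move=> i iK; have [m [tE m1 m2]] := tstep i; exists m.
have b3 : cb (R:=R) m%:R ^+ 3 = m%:R by rewrite cb3.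
have bv : cb (R:=R) m%:R <= v.
  by apply: cube_le => //; rewrite b3 v3; clear -m2 E4; lra.
split => //.
- by rewrite -(ler_nat R); clear -m1 nE; lra.
- apply: (le_trans _ (step_slope u0 (cb_ge0 _) KR0 A0 b3 EK nbu E4 m1 AK)).
  have [h1 h2] := @interp_stepR R b0 K i K0.
  have -> : zb i.+1 + (2 * Wb + 1) * j%:Z - (zb i + (2 * Wb + 1) * j%:Z) =
      interp b0 K i.+1 - interp b0 K i by rewrite /zb; clear; lia.
  have Eu : 2 * A * u ^+ 2 / K%:R * K%:R = 2 * A * u ^+ 2 by rewrite divfK // gt_eqF.
  rewrite intr_norm ler_norml in b0A; move/andP: b0A => [b1 b2].
  rewrite intr_norm ler_norml; apply/andP; split; rewrite -(ler_pM2r KR0) ?mulNr mulrDl Eu mul1r.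
    by clear -h1 b1; lra.
  by clear -h2 b2; lra.
- by apply: (le_trans _ hWb); rewrite ler_wpM2l // ler_pXn2r ?nnegrE ?cb_ge0.
Qed.

Lemma step_once (R : realType) (L : field_law R) (mu Lw C2 : R) (n0 K0 : nat) (phi : nat -> R)
    (mu1 eps w0 D0 th s u A q : R) (r : nat) (z W : int) :
  let e := (r %/ 216)%N in
  1 <= Lw -> 0 <= C2 -> chain_bound L mu Lw C2 n0 K0 phi ->
  1 <= mu1 -> 0 < eps -> eps <= 1 -> 54 * C2 ^+ 3 * eps ^+ 2 <= 1 ->
  eps * (2 * mu1 ^+ 3 * (n0%:R + 4)) <= 1 -> 0 <= w0 -> w0 ^+ 3 = 16 / eps ^+ 2 ->
  D0 = 2 * Lw * w0 + 3 * mu1 ^+ 2 ->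
  u = cb r%:R -> 10 <= u -> s ^+ 2 = th -> 1 <= s -> s <= mu1 * u ->
  1 <= A -> A <= eps / 2048 * s -> 2000 * D0 <= A * th -> D0 <= th ->
  2 * K0%:R + 4 <= eps * s ^+ 3 ->
  `|z|%:~R <= A * u ^+ 2 -> 4 * A * u ^+ 2 <= W%:~R -> 0 <= q ->
  (forall z' W' : int, `|z'|%:~R <= A * cb (R:=R) e%:R ^+ 2 -> 2 * `|z'| <= e%:Z ->
    8 * A * cb (R:=R) e%:R ^+ 2 <= W'%:~R ->
    pr L (~` gd (strip 0 W') 0 0 e z' (mu * e%:R - (2 * th) * cb e%:R)) <= q) ->
  exists K J : nat, [/\ eps * s ^+ 3 / 2 <= K%:R, A * th / (2000 * D0) <= J%:R &
    pr L (~` gd (strip 0 W) 0 0 r z (mu * r%:R - th * u)) <= expR (- phi K) ^+ J + (q + q)].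
Proof.
move=> e Lw1 C20 hch mu11 eps0 eps1 hC2 hN w00 w03 D0E uE u10 s2 s1 smu A1 As D0A D0th hK0
  zA hW q0 IH.
have s0 : 0 < s by clear -s1; lra.
have u0 : 0 < u by clear -u10; lra.
have r0 : 0 <= r%:R :> R by [].
have un : u ^+ 3 = r%:R by rewrite uE cb3.
have r1000 : 1000 <= r%:R :> R.
  rewrite -un; apply: (@le_trans _ _ (10 ^+ 3)); first by clear; lra.
  by rewrite ler_pXn2r ?nnegrE // ltW.
have [e1 e2] : e%:R * 216 <= r%:R :> R /\ r%:R < e%:R * 216 + 216 :> R.
  have E := divn_eq r 216; have lt : (r %% 216 < 216)%N by rewrite ltn_mod.
  have : (r%:R : R) = e%:R * 216 + (r %% 216)%:R by rewrite {1}E natrD natrM.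
  have : (r %% 216)%:R < 216 :> R by rewrite (ltr_nat R _ 216).
  have : 0 <= (r %% 216)%:R :> R by [].
  by move: (_ %% _)%:R => x; clear; lra.
pose nb := (r - 2 * e)%N.
have er : (2 * e <= r)%N by rewrite -(ler_nat R) natrM; clear -e1 r1000; lra.
have nbR : nb%:R = r%:R - 2 * e%:R :> R by rewrite natrB // natrM.
have nbu : u ^+ 3 / 2 <= nb%:R by rewrite un nbR; clear -e1 r1000; lra.
have nbu' : nb%:R <= u ^+ 3.
  have : 0 <= e%:R :> R by []. 
  by rewrite un nbR; clear; lra.
have K02 : 0 <= K0%:R :> R by [].
have [K [Kle Kge]] : exists k : nat, k%:R <= eps * s ^+ 3 /\ eps * s ^+ 3 / 2 <= k%:R.
  by apply: floor_half; clear -hK0 K02; lra.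
have K0K : (K0 <= K)%N by rewrite -(ler_nat R); clear -hK0 Kge; lra.
have K2 : 2 <= K%:R :> R by clear -hK0 Kge K02; lra.
have Kpos : (0 < K)%N by rewrite -(ltr_nat R); clear -K2; lra.
have KR0 : 0 < K%:R :> R by clear -K2; lra.
have D00 : 3 <= D0.
  rewrite D0E; have : 1 <= mu1 ^+ 2 by rewrite exprn_ege1.
  have : 0 <= 2 * Lw * w0 by rewrite mulr_ge0 // mulr_ge0 //; clear -Lw1; lra.
  by clear; lra.
have th1 : 1 <= th by rewrite -s2 exprn_ege1.
(* [D0 u^2 / th] bounds the spacing of the strips, so [J] of them spread over at most
   [A u^2 / 1000]. *)
have [J [Jle Jge]] : exists k : nat, k%:R <= A * th / (1000 * D0) /\ A * th / (1000 * D0) / 2 <= k%:R.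
  apply: floor_half; rewrite ler_pdivlMr; first by clear -D0A; lra.
  by clear -D00; lra.
exists K, J; split => //.
  apply: (le_trans _ Jge); rewrite (_ : A * th / (1000 * D0) / 2 = A * th / (2000 * D0)) //.
  by field; clear -D00; lra.
pose E : R := nb%:R / K%:R.
have EK : E * K%:R = nb%:R by rewrite /E divfK // gt_eqF.
have E0 : 0 <= E by rewrite divr_ge0.
have nE : n0%:R + 4 <= E.
  by apply: (@step_size R s u K%:R E nb%:R eps mu1) => //; rewrite addr_ge0.
(* Rounded blocks have length at most [E + 1 <= 2 E], so [v] is a common unit of loss for all of
   them. *)
pose v := cb (2 * E).
have v0 : 0 <= v by exact: cb_ge0.
have v3 : v ^+ 3 = 2 * E by rewrite /v cb3 // mulr_ge0.
have vdef : 3 * (C2 * K%:R * v) <= s ^+ 2 * u.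
  by apply: (@step_deficit R s u v E K%:R nb%:R eps).
have vw : v ^+ 2 * s ^+ 2 <= w0 * u ^+ 2.
  by apply: (@step_width R s u v E K%:R nb%:R eps).
have Lw0 : 0 <= Lw by clear -Lw1; lra.
have v2 : 0 < v ^+ 2.
  rewrite exprn_gt0 // cb_gt0 //; clear -nE; have : 0 <= n0%:R :> R by []. 
  by clear -nE; lra.
have [Wb /andP[Wb1 Wb2]] : exists k : nat, Lw * v ^+ 2 <= k%:R < Lw * v ^+ 2 + 1.
  by apply: exists_ceil; rewrite mulr_ge0 // ltW.
have Wb0 : 1 <= Wb%:Z.
  have : 0 < Wb%:R :> R by apply: lt_le_trans Wb1; rewrite mulr_gt0 //; clear -Lw1; lra.
  by rewrite ltr0n.
pose U := A * u ^+ 2.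
have u2 : 100 <= u ^+ 2.
  by apply: (@le_trans _ _ (10 ^+ 2)); [clear; lra|rewrite ler_pXn2r ?nnegrE // ltW].
have uU : u ^+ 2 <= U by rewrite /U ler_peMl // sqr_ge0.
have U100 : 100 <= U by exact: le_trans uU.
(* The first term of [D0] accounts for the strip width, the second for rounding it up, by
   [th <= mu1^2 u^2]. *)
have DW : (2 * Wb%:R + 1) * s ^+ 2 <= D0 * u ^+ 2.
  have h1 : Lw * (v ^+ 2 * s ^+ 2) <= Lw * (w0 * u ^+ 2) by rewrite ler_wpM2l.
  have h2 : s ^+ 2 <= (mu1 * u) ^+ 2.
    by rewrite ler_pXn2r ?nnegrE ?(ltW s0) // (le_trans (ltW s0)).
  rewrite exprMn in h2.
  have h3 : (2 * Wb%:R + 1) * s ^+ 2 <= (2 * (Lw * v ^+ 2) + 3) * s ^+ 2.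
    by rewrite ler_wpM2r ?sqr_ge0 //; clear -Wb2; lra.
  by rewrite D0E; clear -h1 h2 h3; lra.
have Wb0R : 0 <= Wb%:R :> R by [].
have DU : 2 * Wb%:R + 1 <= U.
  apply: (le_trans _ uU).
  have : (2 * Wb%:R + 1) * s ^+ 2 <= s ^+ 2 * u ^+ 2.
    by apply: (le_trans DW); rewrite s2 ler_wpM2r // sqr_ge0.
  by rewrite mulrC ler_pM2l // exprn_gt0.
have DJ : (2 * Wb%:R + 1) * J%:R <= U / 1000.
  have h : (2 * Wb%:R + 1) * J%:R <= (2 * Wb%:R + 1) * (A * th / (1000 * D0)).
    by rewrite ler_wpM2l //; clear -Wb0R; lra.
  apply: (le_trans h).
  have -> : (2 * Wb%:R + 1) * (A * th / (1000 * D0)) =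
      ((2 * Wb%:R + 1) * s ^+ 2) * (A / (1000 * D0)) by rewrite s2; ring.
  have AD : 0 <= A / (1000 * D0).
    by apply: divr_ge0; [clear -A1; lra|clear -D00; lra].
  apply: (le_trans (ler_wpM2r AD DW)).
  have -> : D0 * u ^+ 2 * (A / (1000 * D0)) = U / 1000 by rewrite /U; field; clear -D00; lra.
  exact: lexx.
(* Each end piece takes the share [z / 216] of the offset. Its window is about
   [A (u/6)^2 = A u^2 / 36], which leaves room for the spread of the strips. *)
pose a0 := (z %/ 216)%Z; pose b0 := z - 2 * a0.
pose t i := e%:Z + interp nb K i; pose zb i := a0 + interp b0 K i.
have a0z : 216 * `|a0| <= `|z| + 216.
  have E1 := divz_eq z 216; have m0 : 0 <= (z %% 216)%Z by apply: modz_ge0.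
  have m1 : (z %% 216)%Z < 216 by apply: ltz_pmod.
  by rewrite -/a0 in E1; move: E1 m0 m1; clear; lia.
have zR : `|z|%:~R <= U :> R by exact: zA.
have a0R : `|a0|%:~R <= U / 216 + 1 :> R.
  have : (216 * `|a0|)%:~R <= (`|z| + 216)%:~R :> R by rewrite ler_int.
  by rewrite intrM intrD; clear -zR; lra.
have b0R : `|b0|%:~R <= 2 * A * u ^+ 2.
  have : `|b0|%:~R <= (`|z| + 2 * `|a0|)%:~R :> R.
    by rewrite ler_int /b0; clear; lia.
  by rewrite intrD intrM -mulrA -/U; clear -zR a0R U100; lra.
(* 2048 = 2 * 1024: from [A <= k s] with [k = eps / 2048 <= 1] one gets [A^3 <= k s^3], and
   [K >= eps s^3 / 2]. *)
have AK : 1024 * A ^+ 3 <= K%:R.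
  apply: (le_trans _ Kge).
  have [k kE] : exists k : R, k = eps / 2048 by exists (eps / 2048).
  rewrite -kE in As.
  have k0 : 0 <= k by rewrite kE; clear -eps0; lra.
  have k1 : k <= 1 by rewrite kE; clear -eps0 eps1; lra.
  have h1 : A ^+ 3 <= (k * s) ^+ 3.
    by rewrite ler_pXn2r ?nnegrE ?mulr_ge0 ?(ltW s0) //; clear -A1; lra.
  have h2 : k ^+ 3 <= k by rewrite exprS ler_piMr // exprn_ile1.
  have h3 : (k * s) ^+ 3 <= k * s ^+ 3.
    by rewrite exprMn ler_wpM2r // exprn_ge0 // ltW.
  by rewrite kE in h3; rewrite kE in h1; clear -h1 h3; lra.
have Wb1' : Lw * v ^+ 2 <= Wb%:Z%:~R by exact: Wb1.
have A0 : 0 <= A by clear -A1; lra.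
have chadm j := @chain_admissible R Lw u v E A n0 e nb K j a0 b0 Wb Kpos Lw0 u0 A0 EK nbu nE AK
  b0R v3 v0 Wb1' Wb0.
have tmono := (chadm 0%N).1.
have Dj j : (j < J)%N -> 0 <= (2 * Wb%:Z + 1) * j%:Z /\ ((2 * Wb%:Z + 1) * j%:Z)%:~R <= U / 1000 :> R.
  move=> jJ; split; first by rewrite mulr_ge0.
  apply: (le_trans _ DJ); rewrite intrM intrD intrM -[Wb%:Z%:~R]/(Wb%:R : R) -[j%:Z%:~R]/(j%:R : R).
  by rewrite ler_wpM2l ?ler_nat ?(ltnW jJ) //; clear -Wb0R; lra.
have tK : t K = r%:Z - e%:Z by rewrite /t interpK // /nb; clear -er; lia.
have t0 : t 0%N = e%:Z by rewrite /t interp0 addr0.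
have zb0 : zb 0%N = a0 by rewrite /zb interp0 addr0.
have zbK : zb K = z - a0 by rewrite /zb interpK // /b0; clear; lia.
have c0 : 0 <= cb (R:=R) e%:R by exact: cb_ge0.
have ce3 : cb (R:=R) e%:R ^+ 3 = e%:R by rewrite cb3.
have ce6 : cb (R:=R) e%:R <= u / 6.
  apply: cube_le; first by rewrite divr_ge0 // ltW.
  by rewrite ce3 expr_div_n un; clear -e1; lra.
have ce7 : u / 7 <= cb (R:=R) e%:R.
  apply: cube_le => //; first by rewrite ce3 expr_div_n un; clear -e2 r1000; lra.
have ce6' : cb (R:=R) e%:R ^+ 2 <= u ^+ 2 / 36.
  have : cb (R:=R) e%:R ^+ 2 <= (u / 6) ^+ 2.
    by rewrite ler_pXn2r ?nnegrE // divr_ge0 // ltW.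
  by rewrite expr_div_n; clear; lra.
have ce7' : u ^+ 2 / 49 <= cb (R:=R) e%:R ^+ 2.
  have : (u / 7) ^+ 2 <= cb (R:=R) e%:R ^+ 2.
    by rewrite ler_pXn2r ?nnegrE // divr_ge0 // ltW.
  by rewrite expr_div_n; clear; lra.
have Ac7 : U / 49 <= A * cb (R:=R) e%:R ^+ 2 by rewrite /U -mulrA ler_wpM2l.
have Ac6 : A * cb (R:=R) e%:R ^+ 2 <= U / 36 by rewrite /U -mulrA ler_wpM2l.
(* Needed for [2 * |z'| <= e] in the induction hypothesis. *)
have Ue : U * 20 <= e%:R.
  have h : A <= eps / 2048 * (mu1 * u).
    by apply: (le_trans As); apply: ler_wpM2l; [clear -eps0; lra|exact: smu].
  have h2 : eps * mu1 <= 1 / 8.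
    have m3 : mu1 <= mu1 ^+ 3 by rewrite [mu1 ^+ 3]exprS ler_peMr ?exprn_ege1 //; clear -mu11; lra.
    have n00 : 0 <= n0%:R :> R by [].
    have m30 : 0 <= mu1 ^+ 3 by rewrite exprn_ge0 //; clear -mu11; lra.
    have h3 : mu1 ^+ 3 * 4 <= mu1 ^+ 3 * (n0%:R + 4) by rewrite ler_wpM2l // lerDr.
    have h4 : eps * (8 * mu1) <= eps * (2 * mu1 ^+ 3 * (n0%:R + 4)).
      by rewrite ler_wpM2l ?(ltW eps0) //; clear -m3 h3; lra.
    by clear -h4 hN; lra.
  have h5 : U <= eps * mu1 / 2048 * u ^+ 3.
    rewrite /U [u ^+ 3]exprS mulrA ler_wpM2r ?sqr_ge0 //.
    by apply: (le_trans h); clear; lra.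
  have h6 : eps * mu1 / 2048 * u ^+ 3 <= 1 / 16384 * u ^+ 3.
    by apply: ler_wpM2r; [rewrite exprn_ge0 // ltW|clear -h2; lra].
  by clear -h5 h6 un e2 r1000; lra.
have tKt0 : (t K - t 0%N)%:~R = r%:R - 2 * e%:R :> R.
  by rewrite tK t0 !intrB; clear; lra.
have Kz : (K0 <= K)%N by [].
apply: (@strips_bound R L mu t zb K J r z W Wb v (C2 * K%:R) (mu * r%:R - th * u)
   (mu * e%:R - 2 * th * cb e%:R)) => //.
- move=> i j iK jJ; have [d0 d1] := Dj j jJ.
  set p := (2 * Wb%:Z + 1) * j%:Z in d0 d1 *.
  have h1 : `|zb i| <= `|z| + 3 * `|a0|.
    have := interp_le b0 Kpos iK; rewrite /zb /b0; clear; lia.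
  rewrite -(@ler_int R); apply: (le_trans _ hW); rewrite -mulrA -/U.
  apply: (@le_trans _ _ ((`|z| + 3 * `|a0| + p + Wb%:Z)%:~R)).
    by rewrite ler_int; clear -h1 d0; lia.
  rewrite !intrD intrM -[Wb%:Z%:~R]/(Wb%:R : R).
  by clear -zR a0R d1 DU U100 Wb0R; lra.
- by move=> j jJ; apply: hch => //; exact: (chadm j).2.
- move=> j jJ; have [d0 d1] := Dj j jJ; rewrite t0 zb0.
  set p := (2 * Wb%:Z + 1) * j%:Z in d0 d1 *.
  apply: IH.
  + apply: (le_trans _ Ac7); apply: (@le_trans _ _ ((`|a0| + p)%:~R)).
      by rewrite ler_int; clear -d0; lia.
    by rewrite intrD; clear -a0R d1 U100; lra.
  + rewrite -(@ler_int R); apply: (@le_trans _ _ ((2 * (`|a0| + p))%:~R)).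
      by rewrite ler_int; clear -d0; lia.
    by rewrite intrM intrD -[e%:Z%:~R]/(e%:R : R); clear -a0R d1 U100 Ue; lra.
  + apply: (le_trans _ hW); rewrite -[8 * A * _]mulrA -[4 * A * _]mulrA -/U.
    by clear -Ac6 U100; lra.
- move=> j jJ; have [d0 d1] := Dj j jJ; rewrite tK zbK pr_bad_shift.
  rewrite (_ : r%:Z - (r%:Z - e%:Z) = e%:Z); last by clear; lia.
  set p := (2 * Wb%:Z + 1) * j%:Z in d0 d1 *.
  (* The last piece starts off centre; seen from its start, the strip still contains a centred one
     of this smaller width. *)
  pose W1 := W - `|z - a0 + p|.
  apply: (@le_trans _ _ (pr L (~` gd (strip 0 W1) 0 0 e (z - (z - a0 + p))
      (mu * e%:R - 2 * th * cb e%:R)))).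
    by apply: pr_bad_le => // w; rewrite /strip /W1; clear; lia.
  apply: IH.
  + apply: (le_trans _ Ac7); apply: (@le_trans _ _ ((`|a0| + p)%:~R)).
      by rewrite ler_int; clear -d0; lia.
    by rewrite intrD; clear -a0R d1 U100; lra.
  + rewrite -(@ler_int R); apply: (@le_trans _ _ ((2 * (`|a0| + p))%:~R)).
      by rewrite ler_int; clear -d0; lia.
    by rewrite intrM intrD -[e%:Z%:~R]/(e%:R : R); clear -a0R d1 U100 Ue; lra.
  + apply: (@le_trans _ _ ((W - (`|z| + `|a0| + p))%:~R)); last first.
      by rewrite ler_int /W1; clear -d0; lia.
    rewrite intrB !intrD -[8 * A * _]mulrA; move: hW; rewrite -[4 * A * _]mulrA -/U => hW.
    by clear -hW Ac6 zR a0R d1 U100; lra.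
- rewrite tKt0.
  have h1 : 2 * th * cb e%:R <= 2 * th * (u / 6) by rewrite ler_wpM2l //; clear -th1; lra.
  have h2 : 3 * (C2 * K%:R * v) <= th * u by rewrite -s2.
  by move: (C2 * K%:R * v) h2 => y h2; clear -h1 h2; lra.
Qed.

(** * Induction on the scale *)

(** [A th] is the admissible offset in units of r^(2/3). The condition [2 * |z| <= r] keeps the
    endpoint reachable, also when the deficit exceeds [mu r]. *)
Definition tail_bound (R : realType) (L : field_law R) (mu c th1 : R) (p : nat) (A : R -> R) :=
  forall (r : nat) (z W : int) (th : R), th1 <= th -> (0 < r)%N ->
  `|z|%:~R <= A th * cb (R:=R) r%:R ^+ 2 -> 2 * `|z| <= r%:Z ->
  4 * A th * cb (R:=R) r%:R ^+ 2 <= W%:~R ->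
  pr L (~` gd (strip 0 W) 0 0 r z (mu * r%:R - th * cb r%:R)) <= expR (- (c * th ^+ p)).

(* The end pieces have length about r/216, so a deficit of th r^(1/3)/3 is twice th at their
   scale; strong induction on r with th doubled bounds them. *)
Lemma lower_tail_step (R : realType) (L : field_law R) (mu Lw C2 : R) (n0 K0 : nat)
    (phi : nat -> R) : 1 <= Lw -> 0 <= C2 -> chain_bound L mu Lw C2 n0 K0 phi ->
  exists eps D0 : R, [/\ 0 < eps, 0 < D0 &
    forall (A : R -> R) (p : nat) (c th0 : R), 0 < c -> (0 < p)%N -> 1 <= th0 ->
    (forall th, th0 <= th -> [/\ 1 <= A th, A th <= eps / 2048 * Num.sqrt th,
       A th <= A (2 * th) & A (2 * th) <= 2 * A th]) ->
    (forall th (K J : nat), th0 <= th -> eps * Num.sqrt th ^+ 3 / 2 <= K%:R ->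
       A th * th / (2000 * D0) <= J%:R -> 2 * (c * th ^+ p) <= phi K * J%:R) ->
    exists th1, 1 <= th1 /\ tail_bound L mu c th1 p A].
Proof.
move=> Lw1 C20 hch.
pose mu1 := Num.max mu 1.
have mu11 : 1 <= mu1 by rewrite le_max lexx orbT.
have mumu1 : mu <= mu1 by rewrite le_max lexx.
pose d1 := 54 * C2 ^+ 3; pose d2 := 2 * mu1 ^+ 3 * (n0%:R + 4).
have d10 : 0 <= d1 by rewrite mulr_ge0 ?exprn_ge0 // ler0n.
have d20 : 0 <= d2.
  by rewrite mulr_ge0 ?addr_ge0 // mulr_ge0 // exprn_ge0 // (le_trans _ mu11).
(* Makes [eps], [eps * d1] and [eps * d2] at most 1 simultaneously. *)
pose eps := (1 + d1 + d2)^-1.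
have den0 : 0 < 1 + d1 + d2 by clear -d10 d20; lra.
have eps0 : 0 < eps by rewrite invr_gt0.
have epsM x : x <= 1 + d1 + d2 -> eps * x <= 1 by move=> h; rewrite mulrC ler_pdivrMr // mul1r.
have eps1 : eps <= 1 by have := epsM 1; rewrite mulr1; apply; clear -d10 d20; lra.
have e1 : 54 * C2 ^+ 3 * eps ^+ 2 <= 1.
  have h : eps * d1 <= 1 by apply: epsM; clear -d20; lra.
  rewrite -/d1 expr2 mulrA [d1 * eps]mulrC.
  by apply: mulr_ile1 => //; rewrite ?mulr_ge0 // ltW.
have e2 : eps * (2 * mu1 ^+ 3 * (n0%:R + 4)) <= 1 by apply: epsM; rewrite -/d2; clear -d10; lra.
pose w0 := cb (16 / eps ^+ 2).
have w00 : 0 <= w0 by exact: cb_ge0.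
have w03 : w0 ^+ 3 = 16 / eps ^+ 2 by rewrite /w0 cb3 // divr_ge0 ?sqr_ge0.
pose D0 := 2 * Lw * w0 + 3 * mu1 ^+ 2.
have D00 : 3 <= D0.
  have h1 : 1 <= mu1 ^+ 2 by rewrite exprn_ege1.
  have h2 : 0 <= 2 * Lw * w0 by rewrite mulr_ge0 // mulr_ge0 //; clear -Lw1; lra.
  by rewrite /D0; clear -h1 h2; lra.
exists eps, D0; split => //; first by clear -D00; lra.
move=> A p c th0 c0 p0 th01 hA hphi.
pose k0 := (2 * K0%:R + 4) / eps.
have k00 : 0 <= k0 by rewrite divr_ge0 ?addr_ge0 ?mulr_ge0 // ltW.
have kc0 : 0 <= 2 / c by rewrite divr_ge0 // ltW.
have m20 : 1 <= mu1 ^+ 2 by rewrite exprn_ege1.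
(* In this order the terms give: the hypotheses on [A] and [phi]; [K >= K0]; a quantity of at least
   2 to round down to [J]; [u >= 10]; and [c th^p >= 2]. *)
pose th1 := th0 + k0 + 2000 * D0 + 100 * mu1 ^+ 2 + 2 / c.
exists th1; split; first by rewrite /th1; clear -th01 k00 D00 m20 kc0; lra.
move=> r; elim/ltn_ind: r => r IH z W th hth r0 zA z2 hW.
have [g0 [g1 [g2 [g3 g4]]]] : th0 <= th /\ k0 <= th /\ 2000 * D0 <= th /\
    100 * mu1 ^+ 2 <= th /\ 2 / c <= th.
  by move: hth; rewrite /th1; clear -th01 k00 D00 m20 kc0; lra.
have [A1 A2 A3 A4] := hA _ g0.
have th_1 : 1 <= th by exact: le_trans g0.
set u := cb (R:=R) r%:R in zA hW *.
have un : u ^+ 3 = r%:R by rewrite /u cb3.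
have r1 : 1 <= r%:R :> R by rewrite ler1n.
have u1 : 1 <= u by exact: cb_ge1.
have u0 : 0 < u by exact: lt_le_trans u1.
have uu1 : 1 <= u ^+ 2 by rewrite exprn_ege1.
(* The induction bottoms out here: [100 mu1^2 <= th] puts every [r] with [u < 10] into the trivial
   case. *)
have [triv|nontriv] := leP (mu * r%:R) (th * u).
  have U1 : 1 <= A th * u ^+ 2 by rewrite -[leLHS]mulr1; apply: ler_pM.
  rewrite pr_bad0 ?expR_ge0 ?subr_le0 // !subr0.
  - by clear -z2 r0; lia.
  - rewrite normr0 -(@ler_int R) intrB; move: hW; rewrite -[4 * A th * _]mulrA.
    by move: (A th * u ^+ 2) U1 => y y1 h; clear -y1 h; lra.
  - rewrite -(@ler_int R) intrB; move: hW zA; rewrite -[4 * A th * _]mulrA.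
    by move: (A th * u ^+ 2) U1 => y y1 h h'; clear -y1 h h'; lra.
pose s := Num.sqrt th.
have s2 : s ^+ 2 = th by rewrite sqr_sqrtr // (le_trans _ th_1).
have s1 : 1 <= s by rewrite -(@ler_pXn2r _ 2) ?nnegrE ?sqrtr_ge0 // s2 expr1n.
have mu10 : 0 < mu1 by exact: lt_le_trans mu11.
have thu : th < mu1 ^+ 2 * u ^+ 2.
  have h : th * u < mu1 * u ^+ 2 * u.
    apply: (lt_le_trans nontriv); rewrite -un [u ^+ 3]exprSr mulrA ler_wpM2r ?(ltW u0) //.
    by rewrite ler_wpM2r // sqr_ge0.
  rewrite ltr_pM2r // in h; apply: (lt_le_trans h); rewrite ler_wpM2r ?sqr_ge0 //.
  by rewrite expr2 ler_peMl // ltW.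
have smu : s <= mu1 * u.
  rewrite -(@ler_pXn2r _ 2) ?nnegrE ?sqrtr_ge0 ?mulr_ge0 ?(ltW mu10) ?(ltW u0) //.
  by rewrite exprMn s2 ltW.
have u10 : 10 <= u.
  have : 10 ^+ 2 <= u ^+ 2.
    rewrite -(@ler_pM2l _ (mu1 ^+ 2)) ?exprn_gt0 //; apply: (le_trans _ (ltW thu)).
    by apply: (le_trans _ g3); clear; lra.
  by rewrite ler_pXn2r ?nnegrE // ltW.
have hs3 : 2 * K0%:R + 4 <= eps * s ^+ 3.
  have h1 : 2 * K0%:R + 4 <= eps * th.
    by move: g1; rewrite /k0 ler_pdivrMr // [th * _]mulrC.
  apply: (le_trans h1); rewrite ler_wpM2l ?(ltW eps0) // -s2.
  by rewrite [s ^+ 3]exprS ler_peMl // exprn_ge0 // (le_trans _ s1).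
have D0th : 2000 * D0 <= A th * th.
  by apply: (le_trans g2); rewrite ler_peMl // (le_trans _ th_1).
have er : (r %/ 216 < r)%N by rewrite ltn_Pdiv.
have e0 : (0 < r %/ 216)%N.
  rewrite divn_gt0 //.
  have : 216%:R <= r%:R :> R.
    rewrite -un; apply: (@le_trans _ _ (10 ^+ 3)); first by clear; lra.
    by rewrite ler_pXn2r ?nnegrE // ltW.
  by rewrite ler_nat.
pose q := expR (- (c * (2 * th) ^+ p)).
have D0le : D0 <= th by clear -g2 D00; lra.
have hIH (z' W' : int) : `|z'|%:~R <= A th * cb (R:=R) (r %/ 216)%:R ^+ 2 ->
    2 * `|z'| <= (r %/ 216)%:Z -> 8 * A th * cb (R:=R) (r %/ 216)%:R ^+ 2 <= W'%:~R ->
    pr L (~` gd (strip 0 W') 0 0 (r %/ 216)%N z'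
      (mu * (r %/ 216)%:R - (2 * th) * cb (r %/ 216)%:R)) <= q.
  move=> h1 h2 h3; have y0 := sqr_ge0 (cb (R:=R) (r %/ 216)%:R).
  apply: IH => //.
  - by clear -hth th_1; lra.
  - by apply: (le_trans h1); rewrite ler_wpM2r.
  - apply: (le_trans _ h3); rewrite ler_wpM2r //; clear -A4; lra.
have [K [J [hK hJ hpr]]] := @step_once R L mu Lw C2 n0 K0 phi mu1 eps w0 D0 th s u (A th) q r z W
  Lw1 C20 hch mu11 eps0 eps1 e1 e2 w00 w03 erefl erefl u10 s2 s1 smu A1 A2 D0th
  D0le hs3 zA hW (expR_ge0 _) hIH.
apply: (le_trans hpr).
have hp := hphi th K J g0 hK hJ.
set y := c * th ^+ p in hp *.
have y2 : 2 <= y.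
  have h1 : 2 <= c * th by move: g4; rewrite ler_pdivrMr // mulrC.
  apply: (le_trans h1); rewrite /y ler_wpM2l ?(ltW c0) //.
  by rewrite -[leLHS]expr1 ler_weXn2l.
have q2 : q <= expR (- (2 * y)).
  rewrite /q ler_expR lerN2 exprMn /y mulrCA ler_wpM2l ?(ltW c0) //.
  rewrite ler_wpM2r ?exprn_ge0 ?(le_trans _ th_1) //.
  by rewrite -[leLHS]expr1 ler_weXn2l // ler1n.
have b2 : expR (- phi K) ^+ J <= expR (- (2 * y)).
  by rewrite -expRM_natl ler_expR mulrN lerN2 [leRHS]mulrC.
(* Three failures are added, all chains and the two ends, each at most [expR (- (2 * y))]; half of
   the exponent absorbs the factor 3. *)
have h3 : 3 <= expR y by apply: (le_trans _ (expR_ge1Dx y)); clear -y2; lra.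
have -> : expR (- y) = expR y * expR (- (2 * y)) by rewrite -expRD; congr expR; clear; lra.
apply: (@le_trans _ _ (3 * expR (- (2 * y)))).
  by clear -q2 b2; lra.
by rewrite ler_wpM2r ?expR_ge0.
Qed.

(** One chain fails with probability at most 1/2, and with [A = 1] there are [J ~ th] independent
    chains. *)
Lemma linear_tail_bound (R : realType) (L : field_law R) (mu Lw C : R) (n0 : nat) :
  1 <= Lw -> 0 < C -> fixed_tail L mu Lw n0 (fun m => C / (m%:R + 1) ^+ 4) ->
  exists c th1, [/\ 0 < c, 1 <= th1 & tail_bound L mu c th1 1 (fun=> 1)].
Proof.
move=> Lw1 C0 ht.
have [C2 [K0 [C20 hch]]] := chain_bound_poly C0 ht.
have [eps [D0 [eps0 D00 step]]] := lower_tail_step Lw1 (ltW C20) hch.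
have [D DE] : exists D : R, D = 2000 * D0 by exists (2000 * D0).
have D1 : 0 < D by rewrite DE; clear -D00; lra.
have [k kE] : exists k : R, k = eps / 2048 by exists (eps / 2048).
have k0 : 0 < k by rewrite kE; clear -eps0; lra.
rewrite -DE -kE in step.
have ln20 : 0 < ln 2 :> R by rewrite ln_gt0 // ltr1n.
pose c := ln 2 / D / 2.
have c0 : 0 < c by rewrite /c divr_gt0 // divr_gt0.
have kk : 0 <= (1 / k) ^+ 2 by exact: sqr_ge0.
have [||||th1 [th11 htb]] := step (fun=> 1) 1%N c (1 + (1 / k) ^+ 2) c0.
- by [].
- by rewrite lerDl.
- move=> th hth; split => //; last by clear; lra.
  rewrite mulrC -ler_pdivrMr //.
  rewrite -[leLHS]ger0_norm ?divr_ge0 ?(ltW k0) // -sqrtr_sqr ler_wsqrtr //.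
  by clear -hth; lra.
- move=> th K J _ _; rewrite mul1r expr1 => hJ.
  apply: (@le_trans _ _ (ln 2 * (th / D))); last by rewrite ler_pM2l.
  rewrite /c.
  by rewrite le_eqVlt; apply/orP; left; apply/eqP; field; rewrite gt_eqF.
by exists c, th1.
Qed.

(** The prefactor [expR (c' * th1)] makes the bound trivial for [m <= th1]. From [n >= 8] comes
    n^(1/3) >= 2, so offsets up to n^(2/3) satisfy [2 * |z| <= n]. *)
Lemma exponential_fixed_tail (R : realType) (L : field_law R) (mu c th1 : R) :
  0 < c -> 1 <= th1 -> tail_bound L mu c th1 1 (fun=> 1) ->
  exists C c' : R, [/\ 0 < C, 0 < c', c' <= 1 &
    fixed_tail L mu 4 8 (fun m => C * expR (- (c' * m%:R)))].
Proof.
move=> c0 th11 htb; pose c' := Num.min c 1.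
have c'0 : 0 < c' by rewrite lt_min c0 ltr01.
have c'c : c' <= c by rewrite ge_min lexx.
exists (expR (c' * th1)), c'; split => //.
- exact: expR_gt0.
- by rewrite ge_min lexx orbT.
move=> n z W m n8 zn hW.
have m0 : 0 <= m%:R :> R by [].
have ev8 : sig setT (~` gd (strip 0 W) 0 0 n z (mu * n%:R - m%:R * cb n%:R) : set (config R)).
  by apply: sigC; exact: ev_gd.
have [mth|mth] := leP (m%:R : R) th1.
  apply: (le_trans (pr_le1 L ev8)); rewrite -expRD -[leLHS]expR0 ler_expR.
  by rewrite -mulrBr mulr_ge0 ?(ltW c'0) // subr_ge0.
apply: (@le_trans _ _ (expR (- (c * m%:R ^+ 1)))).
  apply: htb => //.
  - exact: ltW.
  - exact: leq_trans n8.
  - by rewrite mul1r.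
  - set u := cb (R:=R) n%:R in zn.
    have un : u ^+ 3 = n%:R by rewrite /u cb3.
    have u2 : 2 <= u.
      apply: cube_le; first exact: cb_ge0.
      rewrite un; apply: (@le_trans _ _ 8%:R); last by rewrite ler_nat.
      by clear; lra.
    rewrite -(@ler_int R) intrM -[n%:Z%:~R]/(n%:R : R) -un.
    have : 2 * u ^+ 2 <= u ^+ 3 by rewrite [u ^+ 3]exprS ler_wpM2r // sqr_ge0.
    by clear -zn; lra.
  - by rewrite mulr1.
rewrite expr1 -expRD ler_expR.
have h1 : c' * m%:R <= c * m%:R by rewrite ler_wpM2r.
have h2 : 0 <= c' * th1 by rewrite mulr_ge0 ?(ltW c'0) // (le_trans _ th11).
by clear -h1 h2; lra.
Qed.

(** With [s = sqrt th], the rate per chain is of order [K ~ s^3] and [J ~ A th ~ s^3], so their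
    product is of order [s^6 = th^3]; [c'] collects the constants. *)
Lemma cubic_tail_bound (R : realType) (L : field_law R) (mu Lw C c : R) (n0 : nat) :
  1 <= Lw -> 0 < C -> 0 < c -> c <= 1 ->
  fixed_tail L mu Lw n0 (fun m => C * expR (- (c * m%:R))) ->
  exists c' th1 k, [/\ 0 < c', 1 <= th1, 0 < k &
    tail_bound L mu c' th1 3 (fun th => k * Num.sqrt th)].
Proof.
move=> Lw1 C0 c0 c1 ht.
have [C2 [K0 [C20 hch]]] := chain_bound_exp C0 c0 c1 ht.
have [eps [D0 [eps0 D00 step]]] := lower_tail_step Lw1 (ltW C20) hch.
have [D DE] : exists D : R, D = 2000 * D0 by exists (2000 * D0).
have D1 : 0 < D by rewrite DE; clear -D00; lra.
have [k kE] : exists k : R, k = eps / 2048 by exists (eps / 2048).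
have k0 : 0 < k by rewrite kE; clear -eps0; lra.
rewrite -DE -kE in step.
pose c' := c / 4 * (eps / 2) * (k / D) / 2.
have kD0 : 0 < k / D by rewrite divr_gt0.
have c'0 : 0 < c'.
  by rewrite /c' divr_gt0 // mulr_gt0 // mulr_gt0 // divr_gt0.
have kk : 0 <= (1 / k) ^+ 2 by exact: sqr_ge0.
have [||||th1 [th11 htb]] := step (fun th => k * Num.sqrt th) 3%N c' (1 + (1 / k) ^+ 2) c'0.
- by [].
- by rewrite lerDl.
- move=> th hth; have th0 : 0 <= th by clear -hth kk; lra.
  split.
  + rewrite mulrC -ler_pdivrMr //.
    rewrite -[leLHS]ger0_norm ?divr_ge0 ?(ltW k0) // -sqrtr_sqr ler_wsqrtr //.
    by clear -hth; lra.
  + exact: lexx.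
  + by rewrite ler_pM2l // ler_wsqrtr //; clear -th0; lra.
  + rewrite mulrCA ler_pM2l //.
    rewrite -[2 in leRHS]ger0_norm // -sqrtr_sqr -sqrtrM ?sqr_ge0 // ler_wsqrtr //.
    by rewrite (_ : 2 ^+ 2 = 4) //; [clear -th0; lra|ring].
- move=> th K J hth hK hJ.
  have th0 : 0 <= th by clear -hth kk; lra.
  set s := Num.sqrt th in hK hJ.
  have s0 : 0 <= s by exact: sqrtr_ge0.
  have s2 : s ^+ 2 = th by rewrite sqr_sqrtr.
  apply: (@le_trans _ _ (c / 4 * ((eps * s ^+ 3 / 2) * (k * s * th / D)))).
    rewrite -s2 /c'.
    by rewrite le_eqVlt; apply/orP; left; apply/eqP; field; rewrite gt_eqF.
  rewrite -[c / 4 * K%:R * _]mulrA; apply: ler_wpM2l; first by rewrite divr_ge0 // ltW.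
  apply: ler_pM => //.
  - by rewrite divr_ge0 // mulr_ge0 ?exprn_ge0 // ltW.
  - by apply: divr_ge0; [rewrite !mulr_ge0 // ltW|exact: ltW].
by exists c', th1, k.
Qed.

Lemma cubic_lower_tail (R : realType) (L : field_law R) (mu al G rho c th0 : R) (n0 : nat) :
  0 < al -> 0 < c -> 1 <= th0 -> (0 < n0)%N -> 0 < G -> 0 < rho ->
  lower_tail L mu al c th0 n0 -> upper_tail L mu al G rho c th0 n0 ->
  exists c' th1 : R, [/\ 0 < c', 1 <= th1 & forall (r : nat) (th : R), (0 < r)%N -> th1 <= th ->
    pr L (~` gd predT 0 0 r 0 (mu * r%:R - th * cb r%:R)) <= expR (- (c' * th ^+ 3))].
Proof.
move=> al0 c0 th01 n00 G0 rho0 low up.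
have [C1 [dl [t1 [n1 [C10 dl0 t11 n10 hb]]]]] := block_tail al0 c0 th01 n00 G0 rho0 low up.
have [Lw [C2 [n2 [Lw1 C20 n21 hp]]]] := polynomial_tail al0 c0 C10 dl0 t11 hb.
have [ce [t2 [ce0 t21 hlin]]] := linear_tail_bound Lw1 C20 hp.
have [C3 [ce' [C30 ce'0 ce'1 hexp]]] := exponential_fixed_tail ce0 t21 hlin.
have four1 : 1 <= 4 :> R by clear; lra.
have [c' [th1 [k [c'0 th11 k0 hcub]]]] := cubic_tail_bound four1 C30 ce'0 ce'1 hexp.
exists c', th1; split => // r th r0 hth.
have x0 : 0 <= 4 * (k * Num.sqrt th) * cb (R:=R) r%:R ^+ 2.
  by rewrite mulr_ge0 ?sqr_ge0 // mulr_ge0 // mulr_ge0 ?sqrtr_ge0 // ltW.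
have [W /andP[W1 _]] := exists_ceil x0.
apply: le_trans (hcub r 0 W th hth r0 _ _ W1).
- exact: pr_bad_le.
- by rewrite normr0 mulr_ge0 ?sqr_ge0 // mulr_ge0 ?sqrtr_ge0 // ltW.
- by rewrite normr0 mulr0.
Qed.

(** * From the passage times to configurations *)

Section PassageTimes.
Variables (d : measure_display) (T : measurableType d) (R : realType).
Variables (P : probability T R) (nu : probability R R) (xi : site -> T -> R).
Hypothesis xi_meas : forall v : site, measurable_fun setT (xi v).
Hypothesis xi_law : forall (v : site) (B : set R), measurable B ->
     P (xi v @^-1` B) = nu B.
Hypothesis xi_indep : forall (s : seq site) (B : site -> set R), uniq s ->
     (forall i, measurable (B i)) ->
     P (\bigcap_(i in [set i | i \in s]) (xi i @^-1` B i)) =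
     (\prod_(i <- s) P (xi i @^-1` B i))%E.
Hypothesis nu_supp : nu `[0%R, +oo[%classic = 1%E.

Local Notation L := (law_of_field xi_meas xi_law xi_indep).
Local Notation X := (Xrz xi).

(** X is the supremum of a sequence of measurable functions, indexed by codes of site sequences;
    codes that give no path contribute -oo. *)
Lemma measurable_Xrz r z : measurable_fun (setT : set T) (X r z : T -> \bar R).
Proof.
pose g (k : nat) (w : T) : \bar R :=
  if @unpickle (seq site) k is Some g then
    if directed_path (1, 1) (r%:Z - z, r%:Z + z) g then
      (path_weight (fun v => xi v w) (1, 1) g)%:E else -oo%E
  else -oo%E.
have mg k : measurable_fun (setT : set T) (g k).
  rewrite /g; move: (@unpickle (seq site) k) => [h|]; last exact: measurable_cst.
  case: (directed_path _ _ h); last exact: measurable_cst.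
  apply/measurable_EFinP; rewrite /path_weight.
  by apply: measurable_sum => v; exact: xi_meas.
have -> : X r z = (fun w => esups (g ^~ w) 0%N).
  apply/funext => w; apply/eqP; rewrite eq_le; apply/andP; split.
    apply: ge_ereal_sup => _ [h dh <-]; apply: ereal_sup_ubound.
    exists (pickle h) => //; rewrite /g pickleK.
    by have -> : directed_path (1, 1) (r%:Z - z, r%:Z + z) h = true by exact: dh.
  apply: ge_ereal_sup => _ [k _ <-]; rewrite /g.
  move: (@unpickle (seq site) k) => [h|]; last by rewrite leNye.
  case: ifP => [dh|_]; last by rewrite leNye.
  by apply: ereal_sup_ubound; exists h.
exact: measurable_fun_esups.
Qed.

(** The null event off which truncation at 0 changes no weight; events about X and about
    configurations are compared modulo it. *)
Definition negative_weight : set T := \bigcup_n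
  (if @unpickle site n is Some v then xi v @^-1` `]-oo, 0[%classic else set0).

Lemma measurable_negative_weight : measurable negative_weight.
Proof.
apply: bigcupT_measurable => n; case: (@unpickle site n) => [v|]; last exact: measurable0.
by rewrite -[X in measurable X]setTI; apply: xi_meas => //; exact: measurable_itv.
Qed.

Lemma negative_weight0 : P negative_weight = 0%E.
Proof.
apply: measure_negligible; first exact: measurable_negative_weight.
apply: negligible_bigcup => n; case: (@unpickle site n) => [v|]; last exact: negligible_set0.
have mi : measurable (`]-oo, 0[%classic : set R) by exact: measurable_itv.
have e : P (xi v @^-1` `]-oo, 0[%classic) = 0%E.
  rewrite xi_law // (_ : `]-oo, 0[%classic = ~` `[0%R, +oo[%classic); last first.
    apply/seteqP; split => x /=; rewrite !in_itv /= andbT leNgt; first by move=> ->.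
    by move=> /negP; rewrite negbK.
  by rewrite probability_setC ?nu_supp ?subee //; exact: measurable_itv.
apply/negligibleP; last exact: e.
by rewrite -[X in measurable X]setTI; apply: xi_meas.
Qed.

Lemma weight_ge0 w v : ~ negative_weight w -> 0 <= xi v w.
Proof.
move=> h; rewrite leNgt; apply/negP => vw; apply: h.
by exists (pickle v); [exact: I|rewrite pickleK /= in_itv].
Qed.

Lemma le_mod_negative (A B : set T) : measurable A -> measurable B ->
  A `<=` B `|` negative_weight -> (P A <= P B)%E.
Proof.
move=> mA mB AB; have mN := measurable_negative_weight.
apply: (@le_trans _ _ (P (B `|` negative_weight))).
  by apply: le_measure; rewrite ?inE //; exact: measurableU.
have N0 : (P negative_weight <= 0)%E by rewrite negative_weight0.
apply: (le_trans (measureU2 _ mB mN)); rewrite -[leRHS]adde0.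
by apply: leeD; [exact: lexx|exact: N0].
Qed.

Lemma pw_path_weight w u g : ~ negative_weight w ->
  pw (field_of xi w) u g = path_weight (fun v => xi v w) u g.
Proof.
move=> h; rewrite /pw /path_weight; apply: eq_bigr => v _.
by rewrite max_l // weight_ge0.
Qed.

Lemma gd_Xrz (r : nat) (z : int) (x : R) (w : T) : ~ negative_weight w ->
  gd predT 0 0 r z x (field_of xi w) ->
  (x%:E <= X r z w)%E.
Proof.
move=> h [g [dg _ hg]]; apply: (@le_trans _ _ (path_weight (fun v => xi v w) (1, 1) g)%:E).
  by rewrite lee_fin -pw_path_weight.
by apply: ereal_sup_ubound; exists g.
Qed.

Lemma not_gd_Xrz (r : nat) (z : int) (x : R) (w : T) : ~ negative_weight w ->
  ~ gd predT 0 0 r z x (field_of xi w) ->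
  (X r z w <= x%:E)%E.
Proof.
move=> h ng; apply: ge_ereal_sup => _ [g dg <-]; rewrite lee_fin leNgt; apply/negP => xg.
apply: ng; exists g; split; [exact: dg|by apply/allP|].
by rewrite pw_path_weight // ltW.
Qed.

Lemma pr_event_le (M : set (config R)) (B : set T) (x : R) : sig setT M -> measurable B ->
  field_of xi @^-1` M `<=` B `|` negative_weight -> (P B <= x%:E)%E -> pr L M <= x.
Proof.
move=> sM mB MB Bx; rewrite -lee_fin /= -(field_prE P xi_meas sM).
by apply: le_trans Bx; apply: le_mod_negative => //; exact: (measurable_field xi_meas).
Qed.

Lemma event_le_pr (M : set (config R)) (B : set T) : sig setT M -> measurable B ->
  B `<=` field_of xi @^-1` M `|` negative_weight -> (P B <= (pr L M)%:E)%E.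
Proof.
move=> sM mB BM; rewrite /= -(field_prE P xi_meas sM).
by apply: le_mod_negative => //; exact: (measurable_field xi_meas).
Qed.

Lemma measurable_Xrz_centered r z (m c : R) :
  measurable [set w | (X r z w - m%:E < c%:E)%E] /\
  measurable [set w | (X r z w - m%:E > c%:E)%E] /\
  measurable [set w | (X r z w - m%:E <= c%:E)%E].
Proof.
have mf : measurable_fun setT (fun w => X r z w - m%:E)%E.
  apply: emeasurable_funB; [exact: measurable_Xrz|exact: measurable_cst].
split; [|split].
- by have := emeasurable_fun_infty_o measurableT mf c%:E; rewrite setTI.
- by have := emeasurable_fun_o_infty measurableT mf c%:E; rewrite setTI.
- by have := emeasurable_fun_infty_c measurableT mf c%:E; rewrite setTI.
Qed.

End PassageTimes.

Lemma tails_of_assumptions (d : measure_display) (T : measurableType d) (R : realType)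
  (P : probability T R) (nu : probability R R) (xi : site -> T -> R)
  (xi_meas : forall v : site, measurable_fun setT (xi v))
  (xi_law : forall (v : site) (B : set R), measurable B ->
     P (xi v @^-1` B) = nu B)
  (xi_indep : forall (s : seq site) (B : site -> set R), uniq s ->
     (forall i, measurable (B i)) ->
     P (\bigcap_(i in [set i | i \in s]) (xi i @^-1` B i)) =
     (\prod_(i <- s) P (xi i @^-1` B i))%E)
  (nu_supp : nu `[0%R, +oo[%classic = 1%E)
  (mu : R)
  (LS : exists rho G H g1 g2 : R,
     [/\ 0 < rho, 0 < G, 0 < H, 0 < g1 & 0 < g2] /\
     \forall r \near \oo, forall z : int, `|z%:~R| <= rho * r%:R :> R ->
       ((mu * r%:R - G * z%:~R ^+ 2 / r%:R - H * z%:~R ^+ 4 / r%:R ^+ 3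
           - g1 * r%:R `^ 3^-1)%:E <= Eb P (Xrz xi r z)
        /\ Eb P (Xrz xi r z) <=
           (mu * r%:R - G * z%:~R ^+ 2 / r%:R - g2 * r%:R `^ 3^-1)%:E)%E)
  (UTLT : exists alpha : R, 0 < alpha /\
     forall eps : R, 0 < eps -> exists c theta0 r0 : R,
       [/\ 0 < c, 0 < theta0, 0 < r0 &
         forall (r : nat) (theta : R) (z : int),
           r0 < r%:R -> theta0 < theta -> `|z%:~R| <= (1 - eps) * r%:R :> R ->
           (P [set w | Xrz xi r z w - Eb P (Xrz xi r z)
                         > (theta * r%:R `^ 3^-1)%:E]
              <= (expR (- (c * theta `^ alpha)))%:E
            /\ P [set w | Xrz xi r z w - Eb P (Xrz xi r z)
                         < (- (theta * r%:R `^ 3^-1))%:E]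
              <= (expR (- (c * theta `^ alpha)))%:E)%E]) :
  let L := law_of_field xi_meas xi_law xi_indep in
  exists al G rho c th0 : R, exists n0 : nat,
  [/\ 0 < al, 0 < c & 1 <= th0] /\ [/\ (0 < n0)%N, 0 < G & 0 < rho] /\
  [/\ lower_tail L mu al c th0 n0, upper_tail L mu al G rho c th0 n0 &
    forall n, (n0 <= n)%N -> exists2 m, Eb P (Xrz xi n 0) = m%:E & m <= mu * n%:R].
Proof.
move=> L.
have ple := pr_event_le xi_meas xi_law xi_indep nu_supp.
have mX := measurable_Xrz_centered xi_meas.
have [rho [G [H [g1 [g2 [[rho0 G0 H0 g10 g20] [N1 _ hLS]]]]]]] := LS.
have [al [al0 hUT]] := UTLT.
have [c [t0 [r0 [c0 t00 r00 hc]]]] := hUT (1 / 2) ltac:(by clear; lra).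
pose rho' := Num.min rho (1 / 2).
have rho'0 : 0 < rho' by rewrite lt_min rho0 /=; clear; lra.
have rho'1 : rho' <= rho by rewrite ge_min lexx.
have rho'2 : rho' <= 1 / 2 by rewrite ge_min lexx orbT.
pose C := G + H + g1.
pose th0 := 2 * (t0 + C) + 1.
have C0 : 0 < C by rewrite /C; clear -G0 H0 g10; lra.
(* Ensures [rho' * n^(1/3) >= 1], so all offsets up to n^(2/3) lie in the range [rho' n]. *)
have [N2 hN2] := exists_nat_ge (r0 + 1 + (1 / rho') ^+ 3).
pose n0 := (maxn N1 N2).+1.
have ir0 : 0 <= 1 / rho' by rewrite divr_ge0 // ltW.
have nR n : (n0 <= n)%N -> [/\ (N1 <= n)%N, r0 < n%:R, 1 <= cb (R:=R) n%:R &
    1 <= rho' * cb n%:R].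
  rewrite /n0 gtn_max => /andP[n1 n2].
  have hn : r0 + 1 + (1 / rho') ^+ 3 <= n%:R by rewrite (le_trans hN2) // ler_nat ltnW.
  have i30 : 0 <= (1 / rho') ^+ 3 by rewrite exprn_ge0.
  split; [exact: ltnW|clear -hn i30; lra|apply: cb_ge1; clear -hn i30 r00; lra|].
  rewrite mulrC -ler_pdivrMr //; apply: cube_le; first exact: cb_ge0.
  by rewrite cb3 //; clear -hn r00; lra.
have mean n (z : int) : (n0 <= n)%N -> `|z|%:~R <= rho' * n%:R -> exists m : R,
    [/\ Eb P (Xrz xi n z) = m%:E, m <= mu * n%:R - G * z%:~R ^+ 2 / n%:R - g2 * cb n%:R &
      `|z|%:~R <= cb (R:=R) n%:R ^+ 2 -> mu * n%:R - C * cb n%:R <= m].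
  move=> nn zr; have [N1n r0n u1 _] := nR n nn.
  have zr' : `|z%:~R| <= rho * n%:R :> R.
    by rewrite -intr_norm (le_trans zr) // ler_wpM2r.
  have [lo hi] := hLS n N1n z zr'.
  have fin : Eb P (Xrz xi n z) \is a fin_num.
    by rewrite fin_numElt (lt_le_trans (ltNyr _) lo) (le_lt_trans hi (ltry _)).
  exists (fine (Eb P (Xrz xi n z))); rewrite fineK //; split => //.
    by rewrite -lee_fin fineK.
  move=> zu; rewrite -lee_fin fineK //; apply: le_trans lo; rewrite lee_fin.
  rewrite -/(cb n%:R); set u := cb (R:=R) n%:R in u1 zu *.
  have un : u ^+ 3 = n%:R by rewrite /u cb3.
  have u0 : 0 < u by exact: lt_le_trans u1.
  have z2 : z%:~R ^+ 2 <= u ^+ 4 :> R.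
    have : (`|z%:~R| : R) ^+ 2 <= (u ^+ 2) ^+ 2.
      by rewrite ler_pXn2r ?nnegrE ?sqr_ge0 // -intr_norm.
    by rewrite real_normK ?num_real // -exprM.
  have h1 : G * z%:~R ^+ 2 / n%:R <= G * u.
    rewrite -un ler_pdivrMr ?exprn_gt0 // -mulrA -exprS ler_wpM2l //; exact: ltW.
  have h2 : H * z%:~R ^+ 4 / n%:R ^+ 3 <= H * u.
    rewrite -un ler_pdivrMr ?exprn_gt0 ?exprn_gt0 // -mulrA ler_wpM2l ?(ltW H0) //.
    rewrite -exprM -exprS; apply: (@le_trans _ _ ((u ^+ 4) ^+ 2)).
      rewrite (_ : z%:~R ^+ 4 = (z%:~R ^+ 2) ^+ 2); last by rewrite -exprM.
      by rewrite ler_pXn2r ?nnegrE ?sqr_ge0 ?exprn_ge0 // ltW.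
    by rewrite -exprM; apply: ler_weXn2l.
  by rewrite /C; clear -h1 h2; lra.
exists al, G, rho', (c * (2^-1) `^ al), th0, n0; split; [split|split; [split|split]] => //.
- by rewrite mulr_gt0 // powR_gt0.
- by rewrite /th0; clear -t00 C0; lra.
- move=> n z th nn zu hth; have [N1n r0n u1 ru] := nR n nn.
  set u := cb (R:=R) n%:R in u1 ru zu *.
  have u0 : 0 < u by exact: lt_le_trans u1.
  have un : u ^+ 3 = n%:R by rewrite /u cb3.
  have th00 : 0 < th by move: hth; rewrite /th0; clear -t00 C0; lra.
  have zr : `|z|%:~R <= rho' * n%:R.
    by apply: (le_trans zu); rewrite -un [u ^+ 3]exprS mulrA -[leLHS]mul1r ler_wpM2r // sqr_ge0.
  have [m [mE m1 /(_ zu) m2]] := mean n z nn zr.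
  have zr2 : `|z%:~R| <= (1 - 1 / 2) * n%:R :> R.
    rewrite -intr_norm (le_trans zr) // ler_wpM2r //; clear -rho'2; lra.
  have [_] := hc n (th / 2) z r0n ltac:(by move: hth; rewrite /th0; clear -C0; lra) zr2.
  rewrite mE -/(cb n%:R) -/u => hP.
  have -> : c * 2^-1 `^ al * th `^ al = c * (th / 2) `^ al.
    by rewrite -mulrA -powRM ?(ltW th00) // mulrC [th / 2]mulrC [c * _]mulrC.
  apply: (ple _ _ _ _ _ _ hP).
  + by apply: sigC; exact: ev_gd.
  + by have [] := mX n z m (- (th / 2 * u)).
  + move=> w ng; have [|nw] := pselect (negative_weight xi w); [by right|left => /=].
    have := not_gd_Xrz nw ng => hX.
    rewrite EFinN lteBlDr // -EFinD; apply: (le_lt_trans hX); rewrite lte_fin.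
    have : C * u < th / 2 * u by rewrite ltr_pM2r //; move: hth; rewrite /th0; clear -t00; lra.
    by rewrite -/u in m2; clear -m2; lra.
- move=> n z th nn zr hth; have [N1n r0n u1 ru] := nR n nn.
  set u := cb (R:=R) n%:R in u1 ru *.
  have u0 : 0 < u by exact: lt_le_trans u1.
  have th00 : 0 < th by move: hth; rewrite /th0; clear -t00 C0; lra.
  have [m [mE m1 _]] := mean n z nn zr.
  have zr2 : `|z%:~R| <= (1 - 1 / 2) * n%:R :> R.
    rewrite -intr_norm (le_trans zr) // ler_wpM2r //; clear -rho'2; lra.
  have [hP _] := hc n th z r0n ltac:(by move: hth; rewrite /th0; clear -C0 t00; lra) zr2.
  rewrite mE -/(cb n%:R) -/u in hP; rewrite -/u in m1.
  apply: (@le_trans _ _ (expR (- (c * th `^ al)))).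
    apply: (ple _ _ _ _ _ _ hP); first exact: ev_gd.
    + by have [_ []] := mX n z m (th * u).
    + move=> w gw; have [|nw] := pselect (negative_weight xi w); [by right|left => /=].
      have := gd_Xrz nw gw => hX.
      rewrite EFinN lteBrDr // -EFinD; apply: (lt_le_trans _ hX); rewrite lte_fin.
      (* The gap [g2 u] in (LS) supplies the strict inequality in the event of (UT). *)
      have : 0 < g2 * u by rewrite mulr_gt0.
      by clear -m1; lra.
  rewrite ler_expR lerN2 -mulrA ler_wpM2l ?(ltW c0) // -[leRHS]mul1r ler_wpM2r ?powR_ge0 //.
  have e1 : 1 `^ al = 1 :> R by rewrite powR1.
  by rewrite -[leRHS]e1; apply: powR_le_mono => //; clear; lra.
- move=> n nn; have [N1n r0n u1 ru] := nR n nn.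
  have [|m [mE m1 _]] := mean n 0 nn.
    by rewrite normr0 mulr_ge0 // ltW.
  exists m => //; apply: (le_trans m1).
  have : 0 <= g2 * cb n%:R by rewrite mulr_ge0 ?cb_ge0 // ltW.
  by rewrite expr0n /= mulr0 mul0r; clear; lra.
Qed.

Theorem theorem3 (d : measure_display) (T : measurableType d) (R : realType)
  (P : probability T R) (nu : probability R R) (xi : site -> T -> R)
  (* the xi_v are random variables *)
  (xi_meas : forall v : site, measurable_fun setT (xi v))
  (* with common law nu *)
  (xi_law : forall (v : site) (B : set R), measurable B ->
     P (xi v @^-1` B) = nu B)
  (* mutually independent *)
  (xi_indep : forall (s : seq site) (B : site -> set R), uniq s ->
     (forall i, measurable (B i)) ->
     P (\bigcap_(i in [set i | i \in s]) (xi i @^-1` B i)) =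
     (\prod_(i <- s) P (xi i @^-1` B i))%E)
  (* nu supported on [0, oo) *)
  (nu_supp : nu `[0%R, +oo[%classic = 1%E)
  (* mu = lim r^{-1} E[X_r] < oo *)
  (mu : R)
  (hmu : (fun r : nat => ((r%:R)^-1)%:E * Eb P (Xrz xi r 0))%E @ \oo --> mu%:E)
  (* Assumption (LS) *)
  (LS : exists rho G H g1 g2 : R,
     [/\ 0 < rho, 0 < G, 0 < H, 0 < g1 & 0 < g2] /\
     \forall r \near \oo, forall z : int, `|z%:~R| <= rho * r%:R :> R ->
       ((mu * r%:R - G * z%:~R ^+ 2 / r%:R - H * z%:~R ^+ 4 / r%:R ^+ 3
           - g1 * r%:R `^ 3^-1)%:E <= Eb P (Xrz xi r z)
        /\ Eb P (Xrz xi r z) <=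
           (mu * r%:R - G * z%:~R ^+ 2 / r%:R - g2 * r%:R `^ 3^-1)%:E)%E)
  (* Assumptions (UT) and (LT), with common exponent alpha *)
  (UTLT : exists alpha : R, 0 < alpha /\
     forall eps : R, 0 < eps -> exists c theta0 r0 : R,
       [/\ 0 < c, 0 < theta0, 0 < r0 &
         forall (r : nat) (theta : R) (z : int),
           r0 < r%:R -> theta0 < theta -> `|z%:~R| <= (1 - eps) * r%:R :> R ->
           (P [set w | Xrz xi r z w - Eb P (Xrz xi r z)
                         > (theta * r%:R `^ 3^-1)%:E]
              <= (expR (- (c * theta `^ alpha)))%:E
            /\ P [set w | Xrz xi r z w - Eb P (Xrz xi r z)
                         < (- (theta * r%:R `^ 3^-1))%:E]
              <= (expR (- (c * theta `^ alpha)))%:E)%E]) :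
  exists c r0 theta0 : R, 0 < c /\
    forall (theta : R) (r : nat), theta0 < theta -> r0 < r%:R ->
      (P [set w | Xrz xi r 0 w - Eb P (Xrz xi r 0)
                    <= (- (theta * r%:R `^ 3^-1))%:E]
         <= (expR (- (c * theta ^+ 3)))%:E)%E.
Proof.
have mX := measurable_Xrz_centered xi_meas.
set L := law_of_field xi_meas xi_law xi_indep.
have [al [G [rho [c [th0 [n0 [[al0 c0 th01] [[n00 G0 rho0] [low up mean]]]]]]]]] := 
  tails_of_assumptions xi_meas xi_law xi_indep nu_supp LS UTLT.
have [c' [th1 [c'0 th11 htail]]] := cubic_lower_tail al0 c0 th01 n00 G0 rho0 low up.
(* The tail is applied at [th / 2], whence 8 = 2^3. A passage of weight [mu r - th / 2 u] strictly
   contradicts X_r <= [mu r - th u], which follows from the event because E[X_r] <= [mu r]. *)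
exists (c' / 8), n0%:R, (2 * th1); split; first by rewrite divr_gt0.
move=> th r hth hr.
have n0r : (n0 <= r)%N by rewrite -(ler_nat R) ltW.
have [m mE mr] := mean r n0r; rewrite mE -/(cb r%:R).
have th00 : 0 < th by clear -hth th11; lra.
have r0 : (0 < r)%N by exact: leq_trans n0r.
have u0 : 0 < cb (R:=R) r%:R by rewrite cb_gt0 // ltr0n.
have h := htail r (th / 2) r0 ltac:(by clear -hth; lra).
have -> : c' / 8 * th ^+ 3 = c' * (th / 2) ^+ 3 by field.
apply: (@le_trans _ _ (pr L (~` gd predT 0 0 r 0 (mu * r%:R - th / 2 * cb r%:R)))%:E); last first.
  by rewrite lee_fin.
apply: (event_le_pr xi_meas xi_law xi_indep nu_supp).
- by apply: sigC; exact: ev_gd.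
- by have [_ []] := mX r 0 m (- (th * cb r%:R)).
- move=> w /= hX; have [|nw] := pselect (negative_weight xi w); [by right|left].
  move=> gw; have := le_trans (gd_Xrz nw gw) (_ : Xrz xi r 0 w <= (mu * r%:R - th * cb r%:R)%:E)%E.
  rewrite lee_fin => /(_ _) hle.
  have : mu * r%:R - th / 2 * cb r%:R <= mu * r%:R - th * cb r%:R.
    apply: hle; rewrite EFinN leeBlDr // -EFinD in hX; apply: (le_trans hX).
    by rewrite lee_fin; clear -mr; lra.
  have : 0 < th * cb r%:R by rewrite mulr_gt0.
  by clear; lra.
Qed.
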